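(* Let $(p:A\to M,[\cdot,\cdot],\rho)$ be a Lie algebroid of rank $r$ with prolongation $\mathscr{A}$. If a symplectic section $\Omega\in\Gamma(\wedge^2\mathscr{A}^* )$ vanishes on the vertical subbundle, then $$\Omega=\Theta+\mathrm{d}_{\mathscr{A}}\zeta,$$ where $\zeta\in\Gamma(\mathscr{A}^* )$ and $\Theta\in\Gamma(\wedge^2\mathscr{A}^* )$ are horizontal, $\Theta$ is $\mathrm{d}_{\mathscr{A}}$-closed, and $\mathrm{rank}(\mathrm{d}_{\mathscr{A}}\zeta)=2r$.
   Context: The prolongation of the Lie algebroid $(p:A\to M,[\cdot,\cdot],\rho)$ is the vector bundle $p_A:\mathscr{A}\to A$ with $$\mathscr{A}=\{(a,b,v)\in A\times A\times TA\mid v\in T_aA,\ p(a)=p(b),\ \rho(b)=T_ap(v)\},\qquad p_A(a,b,v)=a,$$ of rank $2r$. It is a Lie algebroid over $A$ with anchor $\hat\rho(a,b,v)=v$ and bracket determined, via the Leibniz rule, by its values on projectable sections, i.e. sections $Z(a)=(a,\sigma(p(a)),X(a))$ with $\sigma\in\Gamma(A)$ and $X\in\mathfrak{X}(A)$ $p$-related to $\rho(\sigma)$: for two such sections, $[Z_1,Z_2](a)=(a,[\sigma_1,\sigma_2](p(a)),[X_1,X_2](a))$. Let $\mathrm{d}_{\mathscr{A}}$ be the Lie algebroid de Rham differential on $\Gamma(\wedge^\bullet\mathscr{A}^* )$ (Koszul formula). The vertical subbundle is $\mathrm{Vert}(\mathscr{A})=\{(a,b,v)\in\mathscr{A}\mid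 b=0\}$ (so also $T_ap(v)=0$). A section $\omega\in\Gamma(\wedge^k\mathscr{A}^* )$ is horizontal if $\mathrm{i}_Z\omega=0$ for every section $Z$ of $\mathrm{Vert}(\mathscr{A})$. A symplectic section $\Omega\in\Gamma(\wedge^2\mathscr{A}^* )$ is one that is $\mathrm{d}_{\mathscr{A}}$-closed and non-degenerate, i.e. $\mathscr{A}\to\mathscr{A}^*$, $z\mapsto\mathrm{i}_z\Omega$ is a vector bundle isomorphism. It vanishes on the vertical subbundle if $\Omega|_{\mathrm{Vert}(\mathscr{A})\times\mathrm{Vert}(\mathscr{A})}=0$. The rank of a $2$-section is the rank (at every point) of the induced bundle map $\mathscr{A}\to\mathscr{A}^*$. *)

(* Defs.v *)
From HB Require Import structures.
From mathcomp Require Import all_boot all_order all_algebra.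
From mathcomp Require Import all_classical all_reals all_analysis.
From mathcomp Require Import ring.

Set Implicit Arguments.
Unset Strict Implicit.
Unset Printing Implicit Defensive.
Import Order.TTheory GRing.Theory Num.Theory.
Import numFieldNormedType.Exports.
Local Open Scope classical_set_scope.
Local Open Scope ring_scope.

Section Calculus.
Context {R : realType}.

(* C^k on an open set [U]: [f] is continuous and its directional derivatives
   exist and are C^(k-1). *)
Fixpoint Ck n (k : nat) (U : set 'rV[R]_n) (f : 'rV[R]_n -> R) : Prop :=
  (forall x, U x -> {for x, continuous f}) /\
  if k is k'.+1 then
    forall v, (forall x, U x -> derivable f x v) /\ Ck k' U ('D_v f)
  else True.

Definition smooth_on n (U : set 'rV[R]_n) (f : 'rV[R]_n -> R) : Prop :=
  forall k, Ck k U f.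

Lemma eq_Ck n k (U : set 'rV[R]_n) f g : open U ->
  (forall x, U x -> f x = g x) -> Ck k U f -> Ck k U g.
Proof.
move=> oU.
have nearU h1 h2 x : (forall y, U y -> h1 y = h2 y) -> U x ->
    {near x, (h1 : 'rV[R]_n -> R) =1 h2}.
  by move=> e Ux; apply: filterS (open_nbhs_nbhs (conj oU Ux)) => y /e.
have eq_cont h1 h2 : (forall y, U y -> h1 y = h2 y) ->
    (forall x, U x -> {for x, continuous h1}) ->
    forall x, U x -> {for x, continuous (h2 : 'rV[R]_n -> R)}.
  move=> e c x Ux; have -> : {for x, continuous h2} = (h2 @ x --> h1 x).
    by rewrite e.
  by apply: cvg_trans (c _ Ux); apply: (@near_eq_cvg _ _ (nbhs x));
    exact: nearU.
elim: k f g => [|k IH] f g fg [cf df]; split=> //; try exact: eq_cont cf.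
move=> v; have [dfv Dfv] := df v; split=> [x Ux|].
  exact: near_eq_derivable (nearU _ _ _ fg Ux) (dfv _ Ux).
by apply: IH Dfv => x Ux; apply: near_eq_derive; exact: nearU.
Qed.

Lemma CkW n k (U : set 'rV[R]_n) f : Ck k.+1 U f -> Ck k U f.
Proof.
elim: k f => [|k IH] f [cf df]; split=> // v.
by have [d D] := df v; split=> //; apply: IH.
Qed.

Lemma Ck_cst n k (U : set 'rV[R]_n) (a : R) : open U -> Ck k U (cst a).
Proof.
move=> oU; elim: k a => [|k IH] a; split=> //; try by move=> x _; exact: cst_continuous.
move=> v; split=> [x _|]; first exact: derivable_cst.
apply: (@eq_Ck _ _ _ (cst 0)) => // x _.
by apply/esym; exact: derive_cst.
Qed.

Lemma CkD n k (U : set 'rV[R]_n) f g : open U ->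
  Ck k U f -> Ck k U g -> Ck k U (f \+ g).
Proof.
move=> oU; elim: k f g => [|k IH] f g [cf df] [cg dg].
  by split=> // x Ux; apply: continuousD; [exact: (cf _ Ux)|exact: (cg _ Ux)].
split=> [x Ux|v]; first by apply: continuousD; [exact: (cf _ Ux)|exact: (cg _ Ux)].
have [df1 Df] := df v; have [dg1 Dg] := dg v; split=> [x Ux|].
  by apply: derivableD; [exact: df1|exact: dg1].
apply: eq_Ck (IH _ _ Df Dg) => // x Ux /=.
by rewrite deriveD //; [exact: df1|exact: dg1].
Qed.

Lemma CkM n k (U : set 'rV[R]_n) f g : open U ->
  Ck k U f -> Ck k U g -> Ck k U (f \* g).
Proof.
move=> oU; elim: k f g => [|k IH] f g hf hg.
  case: hf hg => [cf _] [cg _].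
  by split=> // x Ux; apply: continuousM; [exact: (cf _ Ux)|exact: (cg _ Ux)].
have [[cf df] [cg dg]] := (hf, hg).
split=> [x Ux|v]; first by apply: continuousM; [exact: (cf _ Ux)|exact: (cg _ Ux)].
have [df1 Df] := df v; have [dg1 Dg] := dg v; split=> [x Ux|].
  by apply: derivableM; [exact: df1|exact: dg1].
apply: eq_Ck (CkD oU (IH _ _ (CkW hf) Dg) (IH _ _ (CkW hg) Df)) => // x Ux /=.
by rewrite deriveM //; [exact: df1|exact: dg1].
Qed.

Lemma Ck_sum n k (U : set 'rV[R]_n) m (f : 'I_m -> 'rV[R]_n -> R) : open U ->
  (forall i, Ck k U (f i)) -> Ck k U (fun x => \sum_i f i x).
Proof.
move=> oU; elim: m f => [|m IH] f hf.
  by apply: eq_Ck (Ck_cst k 0 oU) => // x _; rewrite big_ord0.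
apply: eq_Ck (CkD oU (hf ord0) (IH (fun i => f (lift ord0 i)) _)) => // x _ /=.
by rewrite big_ord_recl.
Qed.

Lemma Ck_coord n k (U : set 'rV[R]_n) i : open U ->
  Ck k U (fun z => z 0 i).
Proof.
move=> oU; have co : continuous (fun z : 'rV[R]_n => z 0 i).
  exact: coord_continuous.
case: k => [|k]; split=> //; try by move=> x _; exact: co.
move=> v; split=> [x _|]; first exact/diff_derivable/differentiable_coord.
apply: eq_Ck (Ck_cst k (v 0 i) oU) => // x _ /=.
rewrite /derive; apply/esym/(@cvg_lim R) => //.
apply: cvg_near_cst; near=> h; have h0 : h != 0 by near: h; exact: nbhs_dnbhs_neq.
by rewrite /= !mxE addrK [LHS]mulKf.
Unshelve. all: by end_near.
Qed.

Lemma Ck_lsubmx n m k (U : set 'rV[R]_n) (V : set 'rV[R]_(n + m)) f :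
  V `<=` lsubmx @^-1` U -> Ck k U f -> Ck k V (f \o lsubmx).
Proof.
move=> VU; elim: k f => [|k IH] f [cf df].
  split=> // z /VU Uz; apply: continuous_comp; last exact: (cf _ Uz).
  exact: continuous_lsubmx.
split=> [z /VU Uz|v].
  by apply: continuous_comp; [exact: continuous_lsubmx|exact: (cf _ Uz)].
have [d D] := df (lsubmx v).
have E z : (fun h : R => h^-1 *: (((f \o lsubmx) \o shift z) (h *: v) - (f \o lsubmx) z))
  = (fun h : R => h^-1 *: ((f \o shift (lsubmx z)) (h *: lsubmx v) - f (lsubmx z))).
  by apply/funext => h /=; rewrite linearP.
split=> [z /VU Uz|]; first by rewrite /derivable E; exact: d.
have -> : 'D_v (f \o lsubmx) = 'D_(lsubmx v) f \o lsubmx.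
  by apply/funext => z; rewrite /derive E.
exact: IH.
Qed.

End Calculus.

Section Atlas.
Context {R : realType}.

(* [coord] and [param] are mutually inverse between [cdom] and its image; their
   values elsewhere are irrelevant. *)
Record chart (T : Type) (n : nat) := Chart {
  cdom : set T;
  coord : T -> 'rV[R]_n;
  param : 'rV[R]_n -> T }.

Definition cimage T n (c : chart T n) (W : set T) : set 'rV[R]_n :=
  coord c @` (cdom c `&` W).

Record atlas (T : Type) (n : nat) := Atlas {
  charts : set (chart T n);
  chart_cover : forall x, exists2 c, charts c & cdom c x;
  coordK : forall c, charts c -> forall x, cdom c x -> param c (coord c x) = x;
  cimage_open : forall c c', charts c -> charts c' -> open (cimage c (cdom c'));
  transition_smooth : forall c c', charts c -> charts c' -> forall j,
    smooth_on (cimage c (cdom c')) (fun u => coord c' (param c u) 0 j) }.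

(* Smoothness of [f] on the open set [W]. *)
Definition smooth_within T n (At : atlas T n) (W : set T) (f : T -> R) :=
  forall c, charts At c -> smooth_on (cimage c W) (f \o param c).

Lemma cimage_setT T n (c : chart T n) : cimage c setT = cimage c (cdom c).
Proof. by rewrite /cimage setIT setIid. Qed.

Section Tangent.
Variables (T : Type) (n : nat) (At : atlas T n).

Definition smooth_fun : {pred T -> R^o} := fun f => `[< smooth_within At setT f >].

Lemma open_cimageT c : charts At c -> open (cimage c setT).
Proof. by move=> hc; rewrite cimage_setT; exact: (cimage_open hc hc). Qed.

Fact smooth_fun_subring : subring_closed smooth_fun.
Proof.
split=> [|f g /asboolP hf /asboolP hg|f g /asboolP hf /asboolP hg];
  apply/asboolP => c hc k.
- exact: (Ck_cst k 1 (open_cimageT hc)).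
- apply: (eq_Ck (open_cimageT hc)) (CkD (open_cimageT hc) (hf _ hc k)
    (CkM (open_cimageT hc) (Ck_cst k (-1) (open_cimageT hc)) (hg _ hc k))) => x _ /=.
  by rewrite mulN1r.
- exact: (CkM (open_cimageT hc) (hf _ hc k) (hg _ hc k)).
Qed.
HB.instance Definition _ :=
  GRing.isSubringClosed.Build (T -> R^o) smooth_fun smooth_fun_subring.

Fact smooth_fun_submod : submod_closed smooth_fun.
Proof.
split=> [|a f g /asboolP hf /asboolP hg]; apply/asboolP => c hc k.
  exact: (Ck_cst k 0 (open_cimageT hc)).
exact: (CkD (open_cimageT hc) (CkM (open_cimageT hc) (Ck_cst k a (open_cimageT hc)) (hf _ hc k))
  (hg _ hc k)).
Qed.
HB.instance Definition _ :=
  GRing.isSubmodClosed.Build R (T -> R^o) smooth_fun smooth_fun_submod.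

Record Cinf := MkCinf { Cinf_fun :> T -> R^o; _ : Cinf_fun \in smooth_fun }.
HB.instance Definition _ := [isSub for Cinf_fun].
HB.instance Definition _ := [Choice of Cinf by <:].
HB.instance Definition _ := GRing.SubChoice_isSubComPzRing.Build
  (T -> R^o : comPzRingType) smooth_fun Cinf (subringClosedP smooth_fun).
HB.instance Definition _ := [SubZmodule_isSubLmodule of Cinf by <:].

Lemma Cinf_smooth (f : Cinf) : smooth_within At setT f.
Proof. by apply/asboolP; exact: (valP f). Qed.

(* The function [g] as an element of C^oo(T); only used on smooth [g]. *)
Definition to_Cinf (g : T -> R) : Cinf := insubd (0 : Cinf) (g : T -> R^o).

Definition derivation_at (a : T) : {pred Cinf -> R^o} := fun v =>
  `[< (forall (k : R) (f g : Cinf), v (k *: f + g) = k * v f + v g) /\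
      (forall f g : Cinf, v (f * g) = f a * v g + g a * v f) >].

Fact derivation_at_submod (a : T) : submod_closed (derivation_at a).
Proof.
split=> [|k u v /asboolP[lu du] /asboolP[lv dv]]; apply/asboolP.
  by split=> *; rewrite /GRing.zero /= ?mulr0 ?addr0.
have E h : (k *: u + v) h = k * u h + v h by [].
by split=> *; rewrite !E ?lu ?du ?lv ?dv; ring.
Qed.
HB.instance Definition _ (a : T) :=
  GRing.isSubmodClosed.Build R (Cinf -> R^o) (derivation_at a)
    (derivation_at_submod a).

Record tangent (a : T) := Tangent {
  derivation :> Cinf -> R^o; _ : derivation \in derivation_at a }.
HB.instance Definition _ (a : T) := [isSub for @derivation a].
HB.instance Definition _ (a : T) := [Choice of tangent a by <:].
HB.instance Definition _ (a : T) := [SubChoice_isSubLmodule of tangent a by <:].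

Definition smooth_vfield (X : forall a, tangent a) : Prop :=
  forall f : Cinf, smooth_within At setT (fun a => X a f).

Definition lie_derivative (X : forall a, tangent a) (g : T -> R) : T -> R :=
  fun a => X a (to_Cinf g).

(* The value at [a] of the bracket of vector fields, as a functional. *)
Definition vfield_bracket (X Y : forall a, tangent a) (a : T) (f : Cinf) : R :=
  lie_derivative X (fun b => Y b f) a - lie_derivative Y (fun b => X b f) a.

(* A Lie bracket on the sections of a family [E] of vector spaces over [T], with
   anchor [rho]. The sections under consideration are those in [S]; [br] is a
   total operation whose values on other sections are irrelevant. *)
Record is_lie_bracket (E : T -> lmodType R) (S : set (forall a, E a))
    (rho : forall a, E a -> tangent a)
    (br : (forall a, E a) -> (forall a, E a) -> forall a, E a) : Prop := {
  br_closed : forall s t, S s -> S t -> S (br s t);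
  br_anti : forall s t, S s -> S t -> forall a, br s t a = - br t s a;
  br_linear : forall (k : R) s t u, S s -> S t -> S u -> forall a,
    br s (fun b => k *: t b + u b) a = k *: br s t a + br s u a;
  br_jacobi : forall s t u, S s -> S t -> S u -> forall a,
    br s (br t u) a + br t (br u s) a + br u (br s t) a = 0;
  br_leibniz : forall (f : Cinf) s t, S s -> S t -> forall a,
    br s (fun b => f b *: t b) a = f a *: br s t a + rho a (s a) f *: t a }.

End Tangent.
End Atlas.
Arguments derivation_at {R T n} At a _.
Arguments smooth_fun {R T n} At _.

Section Bundle.
Context {R : realType}.

Record manifold (n : nat) := Manifold {
  points :> topologicalType;
  matlas : atlas (R := R) points n;
  cdom_open : forall c, charts matlas c -> open (cdom c);
  coord_cont : forall c, charts matlas c -> forall x, cdom c x ->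
    {for x, continuous (coord c)};
  param_cont : forall c, charts matlas c -> forall u, cimage c setT u ->
    {for u, continuous (param c)};
  manifold_hausdorff : hausdorff_space points;
  manifold_second_countable : @second_countable points }.

(* A local trivialization over [tdom]; irrelevant outside [tdom]. *)
Record trivialization (T : Type) (E : T -> lmodType R) (r : nat) := Triv {
  tdom : set T;
  tcoord : forall x, {linear E x -> 'rV[R]_r};
  tinv : forall x, 'rV[R]_r -> E x }.

Record vector_bundle (n : nat) (M : manifold n) (r : nat) := VectorBundle {
  fibre :> M -> lmodType R;
  trivs : set (trivialization fibre r);
  triv_cover : forall x, exists2 t, trivs t & tdom t x;
  tdom_open : forall t, trivs t -> open (tdom t);
  tcoordK : forall t, trivs t -> forall x, tdom t x ->
    cancel (tcoord t x) (tinv t x);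
  tinvK : forall t, trivs t -> forall x, tdom t x ->
    cancel (tinv t x) (tcoord t x);
  triv_smooth : forall t t', trivs t -> trivs t' -> forall i j,
    smooth_within (matlas M) (tdom t `&` tdom t')
      (fun x => tcoord t' x (tinv t x (delta_mx 0 i)) 0 j) }.

Arguments trivs {n M r} _ _.

Section Total.
Variables (n r : nat) (M : manifold n) (A : vector_bundle M r).

Definition total_space := {x : M & A x}.

Definition vec x (e : A x) : total_space := existT _ x e.

Definition base (a : total_space) : M := projT1 a.

Definition total_chart (c : chart M n) (t : trivialization A r) :
    chart total_space (n + r) :=
  Chart [set a | cdom c (base a) /\ tdom t (base a)]
    (fun a => row_mx (coord c (base a)) (tcoord t (base a) (projT2 a)))
    (fun z => vec (tinv t (param c (lsubmx z)) (rsubmx z))).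

Definition total_charts : set (chart total_space (n + r)) :=
  [set C | exists c t, [/\ charts (matlas M) c, trivs A t & C = total_chart c t]].

Lemma cimage_total c t (W : set M) : trivs A t ->
  cimage (total_chart c t) (base @^-1` W) =
    lsubmx @^-1` cimage c (tdom t `&` W).
Proof.
move=> ht; apply/seteqP; split=> [_ [a [[ca ta] Wa] <-]|z [x [cx [tx Wx]] xz]] /=.
  by exists (base a) => //; rewrite row_mxKl.
exists (vec (tinv t x (rsubmx z))) => //=.
by rewrite tinvK // xz hsubmxK.
Qed.

Lemma cimage_open_sub c (W : set M) : charts (matlas M) c -> open W -> open (cimage c W).
Proof.
move=> hc oW; have oT : open (cimage c setT).
  by rewrite cimage_setT; exact: (cimage_open hc hc).
rewrite openE => _ [x [cx Wx] <-].
have ux : cimage c setT (coord c x) by exists x.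
have nW : nbhs (param c (coord c x)) W.
  by rewrite (coordK hc cx); apply: open_nbhs_nbhs.
have nT : nbhs (coord c x) (param c @^-1` W `&` cimage c setT).
  by apply: filterI; [exact: (param_cont hc ux nW)|exact: open_nbhs_nbhs].
apply: filterS nT => u [Wu [y [cy _] yu]].
exists y => //; split=> //; move: Wu.
by rewrite /= -yu (coordK hc cy).
Qed.

Lemma tinv_sum t x (y : 'rV[R]_r) : trivs A t -> tdom t x ->
  tinv t x y = \sum_i y 0 i *: tinv t x (delta_mx 0 i).
Proof.
move=> ht tx; apply: (can_inj (tcoordK ht tx)).
rewrite tinvK // linear_sum [LHS]row_sum_delta; apply: eq_bigr => i _.
by rewrite linearZ /= tinvK.
Qed.

Fact total_chart_cover a : exists2 C, total_charts C & cdom C a.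
Proof.
have [c hc ca] := chart_cover (matlas M) (base a).
have [t ht ta] := triv_cover A (base a).
by exists (total_chart c t) => //; exists c, t.
Qed.

Fact total_coordK C : total_charts C ->
  forall a, cdom C a -> param C (coord C a) = a.
Proof.
move=> [c [t [hc ht ->]]] [x e] /= [cx tx]; rewrite row_mxKl row_mxKr.
by rewrite (coordK hc cx) tcoordK.
Qed.

Lemma total_cimageE c t c' t' : trivs A t ->
  cimage (total_chart c t) (cdom (total_chart c' t')) =
    lsubmx @^-1` cimage c (tdom t `&` (cdom c' `&` tdom t')).
Proof. exact: cimage_total. Qed.

Fact total_cimage_open C C' : total_charts C -> total_charts C' ->
  open (cimage C (cdom C')).
Proof.
move=> [c [t [hc ht ->]]] [c' [t' [hc' ht' ->]]]; rewrite total_cimageE //.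
apply: open_comp; first by move=> z _; exact: continuous_lsubmx.
apply: cimage_open_sub => //.
by do !apply: openI; [exact: tdom_open|exact: cdom_open|exact: tdom_open].
Qed.

Fact total_transition_smooth C C' : total_charts C -> total_charts C' ->
  forall j, smooth_on (cimage C (cdom C')) (fun u => coord C' (param C u) 0 j).
Proof.
move=> hC hC' j k; have := total_cimage_open hC hC'.
move: hC hC' => [c [t [hc ht ->]]] [c' [t' [hc' ht' ->]]].
rewrite total_cimageE //; set U := _ @^-1` _ => oU.
have sub W W' : W `<=` W' -> @lsubmx R 1 n r @^-1` cimage c W `<=`
    lsubmx @^-1` cimage c W'.
  by move=> WW' z [x [cx /WW' Wx] xz]; exists x.
case: (split_ordP j) => i ->.
  apply: (eq_Ck oU (f := (fun u => coord c' (param c u) 0 i) \o lsubmx)).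
    by move=> z _ /=; rewrite row_mxEl.
  by apply: Ck_lsubmx (transition_smooth hc hc' i k); apply: sub => x [_ []].
apply: (eq_Ck oU (f := fun z => \sum_l z 0 (rshift n l) *
  ((fun u => let x := param c u in tcoord t' x (tinv t x (delta_mx 0 l)) 0 i)
     \o lsubmx) z)).
  move=> z [x [cx [tx _]] xz] /=; rewrite row_mxEr -xz (coordK hc cx).
  rewrite [in RHS](tinv_sum _ ht tx) linear_sum summxE; apply: eq_bigr => l _.
  by rewrite linearZ /= !mxE.
apply: Ck_sum => // l; apply: CkM => //; first exact: Ck_coord.
by apply: Ck_lsubmx (triv_smooth ht ht' l i hc k); apply: sub => x [? []].
Qed.

(* The manifold structure of the total space: coordinates on the base followed
   by linear coordinates on the fibre. *)
Definition total_atlas : atlas total_space (n + r) :=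
  Atlas total_chart_cover total_coordK total_cimage_open total_transition_smooth.

Fact pullback_subproof (f : Cinf (matlas M)) :
  (f : M -> R) \o base \in smooth_fun total_atlas.
Proof.
apply/asboolP => _ [c [t [hc ht ->]]] k.
have -> : setT = base @^-1` setT by [].
rewrite cimage_total //; apply: Ck_lsubmx (Cinf_smooth f hc k).
by move=> z [x [cx _] xz]; exists x.
Qed.

Definition pullback (f : Cinf (matlas M)) : Cinf total_atlas :=
  MkCinf (pullback_subproof f).

Fact tangent_proj_subproof a (v : tangent total_atlas a) :
  (fun f => v (pullback f)) \in derivation_at (matlas M) (base a).
Proof.
case: v => v /= /asboolP[lv dv]; apply/asboolP; split=> [k f g|f g].
  by rewrite -lv; congr v; apply/val_inj.
by rewrite -[f (base a)]/(pullback f a) -[g (base a)]/(pullback g a) -dv;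
  congr v; apply/val_inj.
Qed.

(* T_a p : T_a A -> T_{p(a)} M *)
Definition tangent_proj a (v : tangent total_atlas a) :
    tangent (matlas M) (base a) := Tangent (tangent_proj_subproof v).

Definition smooth_section (s : forall x, A x) : Prop :=
  forall t, trivs A t -> forall j,
    smooth_within (matlas M) (tdom t) (fun x => tcoord t x (s x) 0 j).

(* Smooth sections of the pull-back bundle p^*A -> A. *)
Definition smooth_pullback_section (b : forall a : total_space, A (base a)) : Prop :=
  forall t, trivs A t -> forall j,
    smooth_within total_atlas (base @^-1` tdom t)
      (fun a => tcoord t (base a) (b a) 0 j).

End Total.
End Bundle.
Arguments manifold : clear implicits.

Section LieAlgebroid.
Context {R : realType}.

Record lie_algebroid (n : nat) (M : manifold R n) (r : nat) := LieAlgebroid {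
  bundle :> vector_bundle M r;
  anchor : forall x, {linear bundle x -> tangent (matlas M) x};
  bracket : (forall x, bundle x) -> (forall x, bundle x) -> forall x, bundle x;
  anchor_smooth : forall s, smooth_section s ->
    smooth_vfield (fun x => anchor x (s x));
  bracketP : is_lie_bracket [set s | smooth_section s]
    (fun x => anchor x) bracket }.

Section Prolongation.
Variables (n r : nat) (M : manifold R n) (A : lie_algebroid M r).
Local Notation TA := (tangent (total_atlas A)).

Definition in_prolong (a : total_space A) : {pred (A (base a) * TA a)%type} :=
  fun z => `[< anchor A (base a) z.1 = tangent_proj z.2 >].

Fact in_prolong_submod a : submod_closed (@in_prolong a).
Proof.
split=> [|k u v /asboolP hu /asboolP hv]; apply/asboolP => /=.
  by rewrite linear0; apply/val_inj.
by rewrite linearP hu hv; apply/val_inj.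
Qed.
HB.instance Definition _ a :=
  GRing.isSubmodClosed.Build R (A (base a) * TA a)%type (@in_prolong a)
    (@in_prolong_submod a).

(* The fibre over [a] of the prolongation; the first component [a] of the
   triples (a, b, v) is the index of the family. *)
Record prolong (a : total_space A) := Prolong {
  prolong_pair : (A (base a) * TA a)%type;
  _ : prolong_pair \in @in_prolong a }.
HB.instance Definition _ a := [isSub for @prolong_pair a].
HB.instance Definition _ a := [Choice of prolong a by <:].
HB.instance Definition _ a := [SubChoice_isSubLmodule of prolong a by <:].

Definition pfibre a (z : prolong a) : A (base a) := (prolong_pair z).1.
Definition panchor a (z : prolong a) : TA a := (prolong_pair z).2.

Definition psection := forall a : total_space A, prolong a.

(* The prolongation is a subbundle of p^*A + TA, so smoothness is
   componentwise. *)
Definition psmooth (Z : psection) : Prop :=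
  smooth_pullback_section (fun a => pfibre (Z a)) /\
  smooth_vfield (fun a => panchor (Z a)).

(* [Z] projects onto the section [s] of [A]: Z(a) = (a, s(p(a)), X(a)). *)
Definition projectable (Z : psection) (s : forall x, A x) : Prop :=
  [/\ psmooth Z, smooth_section s & forall a, pfibre (Z a) = s (base a)].

(* The Lie algebroid structure of the prolongation, presented by its defining
   properties: these determine the bracket on smooth sections. *)
Record prolongation_bracket := ProlongationBracket {
  pbracket :> psection -> psection -> psection;
  pbracketP : is_lie_bracket (E := prolong) [set Z | psmooth Z]
    panchor pbracket;
  pbracket_proj : forall Z1 Z2 s1 s2, projectable Z1 s1 -> projectable Z2 s2 ->
    forall a, pfibre (pbracket Z1 Z2 a) = bracket s1 s2 (base a) /\
      panchor (pbracket Z1 Z2 a) =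
        vfield_bracket (fun b => panchor (Z1 b)) (fun b => panchor (Z2 b)) a
        :> (_ -> _) }.

(* Smoothness of a section of the exterior power of the dual bundle is tested by
   evaluation on smooth sections. *)
Record form1 := Form1 {
  form1_fun :> forall a, {linear prolong a -> R^o};
  form1_smooth : forall Z, psmooth Z ->
    smooth_within (total_atlas A) setT (fun a => form1_fun a (Z a)) }.

Record form2 := Form2 {
  form2_fun :> forall a, prolong a -> prolong a -> R;
  form2_linear : forall a (k : R) (z z' w : prolong a),
    form2_fun (k *: z + z') w = k * form2_fun z w + form2_fun z' w;
  form2_linearr : forall a (k : R) (z w w' : prolong a),
    form2_fun z (k *: w + w') = k * form2_fun z w + form2_fun z w';
  form2_alt : forall a (z : prolong a), form2_fun z z = 0;
  form2_smooth : forall Z W, psmooth Z -> psmooth W ->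
    smooth_within (total_atlas A) setT (fun a => form2_fun (Z a) (W a)) }.

Definition vertical a (z : prolong a) : Prop := pfibre z = 0.

Definition vertical_section (Z : psection) : Prop :=
  psmooth Z /\ forall a, vertical (Z a).

Definition horizontal1 (zeta : form1) : Prop :=
  forall Z, vertical_section Z -> forall a, zeta a (Z a) = 0.

Definition horizontal2 (Theta : form2) : Prop :=
  forall Z, vertical_section Z -> forall a w, Theta a (Z a) w = 0.

Definition vanishes_on_vertical (Omega : form2) : Prop :=
  forall a z w, vertical z -> vertical w -> Omega a z w = 0.

Definition pderiv (Z : psection) (g : total_space A -> R) : total_space A -> R :=
  lie_derivative (fun a => panchor (Z a)) g.

(* The Koszul formula in degrees 1 and 2. [is_differential zeta eta] says that the
   2-form [eta] is the differential of [zeta]; it determines [eta]. *)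
Definition d1 (B : prolongation_bracket) (zeta : form1) (X Y : psection)
    (a : total_space A) : R :=
  pderiv X (fun b => zeta b (Y b)) a - pderiv Y (fun b => zeta b (X b)) a
  - zeta a (B X Y a).

Definition d2 (B : prolongation_bracket) (Omega : form2) (X Y Z : psection)
    (a : total_space A) : R :=
  pderiv X (fun b => Omega b (Y b) (Z b)) a
  - pderiv Y (fun b => Omega b (X b) (Z b)) a
  + pderiv Z (fun b => Omega b (X b) (Y b)) a
  - Omega a (B X Y a) (Z a) + Omega a (B X Z a) (Y a) - Omega a (B Y Z a) (X a).

Definition is_differential (B : prolongation_bracket) (zeta : form1)
    (eta : form2) : Prop :=
  forall X Y, psmooth X -> psmooth Y -> forall a,
    eta a (X a) (Y a) = d1 B zeta X Y a.

Definition closed2 (B : prolongation_bracket) (Omega : form2) : Prop :=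
  forall X Y Z, psmooth X -> psmooth Y -> psmooth Z -> forall a,
    d2 B Omega X Y Z a = 0.

(* z |-> i_z Omega is an isomorphism from each fibre onto its dual. *)
Definition nondegenerate (Omega : form2) : Prop :=
  forall a (l : {linear prolong a -> R^o}),
    exists! z, forall w, Omega a z w = l w.

Definition symplectic (B : prolongation_bracket) (Omega : form2) : Prop :=
  closed2 B Omega /\ nondegenerate Omega.

(* At every [a], the image of z |-> i_z eta has a basis of [k] elements, namely
   the i_(e_j) eta. *)
Definition has_rank (eta : form2) (k : nat) : Prop :=
  forall a, exists e : 'I_k -> prolong a,
    (forall x : 'I_k -> R,
       (forall w, \sum_j x j * eta a (e j) w = 0) -> forall j, x j = 0) /\
    (forall z, exists x : 'I_k -> R,
       forall w, eta a z w = \sum_j x j * eta a (e j) w).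

End Prolongation.
End LieAlgebroid.

(* Main.v *)
From HB Require Import structures.
From Pilot Require Import Defs.
From mathcomp Require Import all_boot all_order all_algebra.
From mathcomp Require Import all_classical all_reals all_analysis.
From mathcomp Require Import ssrAC ring lra.
Import Pilot.Defs.

(* Let [V_j] be vertical lifts of a local frame [e_j] of [A] and [X_i] sections of the
   prolongation projecting onto [e_i]. As [Omega] vanishes on vertical pairs, it is, modulo
   horizontal forms, given by the functions [G_ji = Omega(V_j, X_i)]. The vertical lifts
   commute and the [[V_j, X_i]] are vertical, so closedness of [Omega] on [(V_j, V_k, X_i)]
   reads [V_j G_ki = V_k G_ji]: on every fibre [G_ji dy_j] is a closed 1-form. The Poincare
   lemma on the fibres gives the primitive
   [zeta_a(z) = int_0^1 Omega_(s a)(vertical lift of a, z_s) ds],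
   where [z_s] is any element over [s a] with the same [A]-component as [z]; it is horizontal
   and [d zeta] agrees with [Omega] as soon as one argument is vertical. Hence
   [Omega - d zeta] is horizontal. The vertical subspace is Lagrangian, which transfers
   nondegeneracy from [Omega] to [d zeta].

   Tangent vectors are derivations of global functions, so locality and Hadamard's lemma
   provide their coordinates in a chart; bump functions extend local frames. *)

Set Implicit Arguments.
Unset Strict Implicit.
Unset Printing Implicit Defensive.
Import Order.TTheory GRing.Theory Num.Theory.
Import numFieldNormedType.Exports.
Local Open Scope classical_set_scope.
Local Open Scope ring_scope.
Arguments trivs {R n M r} _ _.

(** * Derivatives along curves *)

(** The formula for [zeta] mentions no chart, so nothing has to be glued: charts only serve to
    verify its linearity, its smoothness and the Poincare identity. Since the charts of the total
    space contain whole fibres, the dilations [a |-> s a] never leave them.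

    The bracket is given axiomatically, as an operation on global sections, and is prescribed only
    on projectable ones. Two facts must therefore be deduced. That the anchor respects all brackets
    follows from the Jacobi and Leibniz identities; it underlies both the closedness of a
    differential and the commutation of vertical lifts. The Koszul formula, an expression in
    sections, must be shown tensorial before it defines a form on the fibres.

    Regularity is expressed by iterated directional derivatives, without linearity in the direction,
    so the calculus has to start from the mean value theorem. *)

Lemma cvg_sumr {R : realType} (T : Type) (F : set_system T) {FF : Filter F} (I : Type)
    (r : seq I) (f : I -> T -> R) (l : I -> R) :
  (forall i, f i x @[x --> F] --> l i) ->
  \sum_(i <- r) f i x @[x --> F] --> \sum_(i <- r) l i.
Proof. by move=> fl; apply: cvg_big => [|//]; exact: add_continuous. Qed.

(** Replacing [h] by [h * k] in the difference quotient uses nothing beyond the direction [v]; the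
    case [k = 0] is treated apart. *)
Lemma derive_scale {R : realType} (V : normedModType R) (f : V -> R) x v (k : R) : derivable f x v ->
  derivable f x (k *: v) /\ 'D_(k *: v) f x = k * 'D_v f x.
Proof.
have [->|k0] := eqVneq k 0.
  by move=> _; rewrite scale0r mul0r derive0; split=> //; exact: derivable0.
move=> /cvg_ex[/= l lP].
suff H : h^-1 *: ((f \o shift x) (h *: (k *: v)) - f x) @[h --> 0^'] --> k * l.
  split; first by apply/cvg_ex; exists (k * l).
  rewrite /derive; have -> := cvg_lim (@Rhausdorff R) H.
  by rewrite (cvg_lim (@Rhausdorff R) lP).
have E : (fun h : R => h^-1 *: ((f \o shift x) (h *: (k *: v)) - f x)) =
    (fun h => k * ((h * k)^-1 *: ((f \o shift x) ((h * k) *: v) - f x))).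
  apply/funext => h /=; rewrite scalerA; set X := (_ - _).
  change (h^-1 * X = k * ((h * k)^-1 * X)).
  by rewrite invfM mulrA mulrCA divff// mulr1.
rewrite E; apply: cvgMr; apply: (cvg_comp (fun h => h * k) _ _ lP).
move=> P [e /= e0 eP].
exists (e / `|k|) => /=; first by rewrite divr_gt0 ?normr_gt0.
move=> h /= he h0; apply: eP; last by rewrite mulf_neq0.
move: he; rewrite /= !sub0r !normrN normrM ltr_pdivlMr ?normr_gt0//.
Qed.

Section Derivative.
Context {R : realType} {n : nat}.
Implicit Types (U : set 'rV[R]_n) (f : 'rV[R]_n -> R) (x v w : 'rV[R]_n).

Lemma is_derive_line f x v (s : R) : derivable f (s *: v + x) v ->
  is_derive s 1 (fun s : R => f (s *: v + x)) ('D_v f (s *: v + x)).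
Proof.
have E : (fun h : R => h^-1 *: (((fun s : R => f (s *: v + x)) \o shift s) (h *: 1) -
    f (s *: v + x))) =
  (fun h : R => h^-1 *: ((f \o shift (s *: v + x)) (h *: v) - f (s *: v + x))).
  by apply/funext => h /=; rewrite addrA -scalerDl [h *: 1]mulr1.
by move=> d; split; rewrite /derivable /derive E.
Qed.

Lemma mvt_line f x v :
  (forall s : R, 0 <= s <= 1 -> derivable f (s *: v + x) v) ->
  exists2 s : R, 0 < s < 1 & f (v + x) - f x = 'D_v f (s *: v + x).
Proof.
move=> df; have d s : s \in `[0, 1]%R -> derivable (fun s : R => f (s *: v + x)) s 1.
  by rewrite in_itv => /df /is_derive_line[].
have [|s|s] := @MVT _ (fun s : R => f (s *: v + x)) (fun s => 'D_v f (s *: v + x))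
    0 1 ltr01.
- by move=> s; rewrite in_itv => /andP[s0 s1]; apply/is_derive_line/df; rewrite !ltW.
- exact: (derivable_within_continuous d).
- rewrite in_itv => s01; rewrite subr0 mulr1 scale1r scale0r add0r => E.
  by exists s.
Qed.

Lemma C1_derivable U f x v : Ck 1 U f -> U x -> derivable f x v.
Proof. by move=> [_ /(_ v)[d _]] /d. Qed.

Lemma C1_derive_cont U f x v : Ck 1 U f -> U x -> {for x, continuous ('D_v f)}.
Proof. by move=> [_ /(_ v)[_ [d _]]] /d. Qed.

(** The clause on all radii [d] keeps the intermediate point as close to [x] as the farther of the
    two ends, so that it converges with them. *)
Lemma mvt_point U f x e : Ck 1 U f -> 0 < e -> ball x e `<=` U ->
  forall y z, ball x e y -> ball x e z -> exists2 p,
    (forall d, ball x d y -> ball x d z -> ball x d p) & f z - f y = 'D_(z - y) f p.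
Proof.
move=> cf e0 xeU y z xy xz.
have conv d (s : R) : 0 <= s <= 1 -> ball x d y -> ball x d z ->
    ball x d (s *: (z - y) + y).
  rewrite -ball_normE /ball_ /= => /andP[s0 s1] yd zd.
  have -> : x - (s *: (z - y) + y) = s *: (x - z) + (1 - s) *: (x - y).
    by apply/rowP => i; rewrite !mxE; ring.
  rewrite (le_lt_trans (ler_normD _ _))// !normrZ (ger0_norm s0) ger0_norm ?subr_ge0//.
  have [s00|] := leP s 0.
    by have -> : s = 0 by [apply/le_anti; rewrite s00]; rewrite mul0r add0r subr0 mul1r.
  move=> sp; have P1 : 0 < s * (d - `|x - z|) by rewrite mulr_gt0 ?subr_gt0.
  have P2 : 0 <= (1 - s) * (d - `|x - y|) by rewrite mulr_ge0 ?subr_ge0// ltW.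
  by move: (`|x - z|) (`|x - y|) P1 P2 => p q; lra.
have [s s01|s s01] := @mvt_line f y (z - y).
  by apply: C1_derivable cf _; apply: xeU; exact: conv.
rewrite subrK => E; exists (s *: (z - y) + y) => // d yd zd; apply: conv => //.
by move/andP: s01 => [? ?]; rewrite !ltW.
Qed.

(** Both ends move, so as to cover increments such as [f (h *: (v + w) + x) - f (h *: v + x)],
    neither end of which is [x]. *)
Lemma mvt_curve U f x (F : set_system R) {FF : Filter F} (y z : R -> 'rV[R]_n) :
  open U -> Ck 1 U f -> U x -> y h @[h --> F] --> x -> z h @[h --> F] --> x ->
  exists2 p : R -> 'rV[R]_n, p h @[h --> F] --> x &
    \forall h \near F, f (z h) - f (y h) = 'D_(z h - y h) f (p h).
Proof.
move=> oU cf Ux yx zx; have /nbhs_ballP[e e0 xeU] := open_nbhs_nbhs (conj oU Ux).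
(* Where an end lies outside the ball the premises fail and the value 0 is arbitrary; this does not
   happen near the limit. *)
have pP h : exists p, ball x e (y h) -> ball x e (z h) ->
    (forall d, ball x d (y h) -> ball x d (z h) -> ball x d p) /\
    f (z h) - f (y h) = 'D_(z h - y h) f p.
  have [Y|] := pselect (ball x e (y h)); last by exists 0.
  have [Z|] := pselect (ball x e (z h)); last by exists 0.
  by have [p p1 p2] := mvt_point cf e0 xeU Y Z; exists p.
have [p {}pP] := choice pP; exists p; last first.
  near=> h; have [||_ //] := pP h.
  - by near: h; exact: (cvg_ball yx).
  - by near: h; exact: (cvg_ball zx).
apply/cvg_ballP => d d0; near=> h; have [||+ _] := pP h.
- by near: h; exact: (cvg_ball yx).
- by near: h; exact: (cvg_ball zx).
by apply; near: h; [exact: (cvg_ball yx)|exact: (cvg_ball zx)].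
Unshelve. all: by end_near. Qed.

Lemma cvg_line x v : h *: v + x @[h --> (0 : R)^'] --> x.
Proof.
have -> : nbhs x = nbhs (0 *: v + x) by rewrite scale0r add0r.
apply: cvgD; last exact: cvg_cst.
by apply: cvgZr_tmp; apply: cvg_within.
Qed.

(** The increment along [v + w] is split at [h *: v + x]. On the second leg the mean value theorem
    gives [h * 'D_w f (p h)] with [p h] tending to [x], and ['D_w f] is continuous. *)
Lemma C1_deriveD U f x v w : open U -> Ck 1 U f -> U x ->
  'D_(v + w) f x = 'D_v f x + 'D_w f x.
Proof.
move=> oU cf Ux.
have [p px E] := mvt_curve oU cf Ux (@cvg_line x v) (@cvg_line x (v + w)).
have L1 : h^-1 *: (f (h *: v + x) - f x) @[h --> 0^'] --> 'D_v f x.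
  by have /cvg_ex[l lP] := C1_derivable (v:=v) cf Ux; rewrite /derive (cvg_lim (@Rhausdorff R) lP).
have L2 : 'D_w f (p h) @[h --> 0^'] --> 'D_w f x.
  exact: (cvg_comp p _ px (C1_derive_cont (v:=w) cf Ux)).
have L : h^-1 * (f (h *: v + x) - f x) + 'D_w f (p h) @[h --> 0^'] -->
    'D_v f x + 'D_w f x by exact: (cvgD L1 L2).
suff : h^-1 * (f (h *: (v + w) + x) - f x) @[h --> 0^'] --> 'D_v f x + 'D_w f x.
  by move=> H; apply/(@cvg_lim R).
apply: cvg_trans L; apply: near_eq_cvg; near=> h => /=.
have h0 : h != 0 by near: h; exact: nbhs_dnbhs_neq.
have Ep : f (h *: (v + w) + x) - f (h *: v + x) = h * 'D_w f (p h).
  have -> : f (h *: (v + w) + x) - f (h *: v + x) =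
      'D_(h *: (v + w) + x - (h *: v + x)) f (p h) by near: h.
  have -> : h *: (v + w) + x - (h *: v + x) = h *: w.
    by apply/rowP => i; rewrite !mxE; ring.
  have [//|_ ->//] := derive_scale (x := p h) h (v := w) (f := f).
  apply: C1_derivable cf _; near: h; apply: px; exact: open_nbhs_nbhs.
by rewrite -['D_w f (p h)](mulKf h0) -Ep; ring.
Unshelve. all: by end_near. Qed.

Lemma C1_derive_sum U f x v : open U -> Ck 1 U f -> U x ->
  'D_v f x = \sum_i v 0 i * 'D_(delta_mx 0 i) f x.
Proof.
move=> oU cf Ux; rewrite {1}[v]row_sum_delta.
rewrite (big_morph (fun v => 'D_v f x) (id1 := 0) (op1 := +%R)
  (fun v w => C1_deriveD v w oU cf Ux) (derive0 f x)).
by apply: eq_bigr => i _; have [] := derive_scale (v 0 i) (C1_derivable (v:=delta_mx 0 i) cf Ux).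
Qed.

(** The derivative at the intermediate point is expanded in coordinates, so that only the
    coordinates of [a h *: (z h - y h)] have to converge. *)
Lemma chain_curve U f x w (F : set_system R) {FF : Filter F} (a : R -> R)
    (y z : R -> 'rV[R]_n) :
  open U -> Ck 1 U f -> U x -> y h @[h --> F] --> x -> z h @[h --> F] --> x ->
  (forall i, a h * (z h - y h) 0 i @[h --> F] --> (w : 'rV_n) 0 i) ->
  a h * (f (z h) - f (y h)) @[h --> F] --> 'D_w f x.
Proof.
move=> oU cf Ux yx zx yzw; have [p px E] := mvt_curve oU cf Ux yx zx.
rewrite (C1_derive_sum w oU cf Ux).
have L (i : 'I_n) : (a h * (z h - y h) 0 i) * 'D_(delta_mx 0 i) f (p h) @[h --> F] -->
    w 0 i * 'D_(delta_mx 0 i) f x.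
  by apply: cvgM; [exact: yzw|exact: (cvg_comp p _ px (C1_derive_cont cf Ux))].
have {}L : \sum_i (a h * (z h - y h) 0 i) * 'D_(delta_mx 0 i) f (p h) @[h --> F] -->
    \sum_i w 0 i * 'D_(delta_mx 0 i) f x by exact: cvg_sumr.
apply: cvg_trans L; apply: near_eq_cvg; near=> h.
have -> : f (z h) - f (y h) = 'D_(z h - y h) f (p h) by near: h.
rewrite (C1_derive_sum _ oU cf); last by near: h; apply: px; exact: open_nbhs_nbhs.
by rewrite big_distrr; apply: eq_bigr => i _ /=; rewrite mulrA.
Unshelve. all: by end_near. Qed.

End Derivative.

Lemma cvg_row {R : realType} n (T : Type) (F : set_system T) {FF : Filter F}
    (f : T -> 'rV[R]_n) (l : 'rV[R]_n) :
  (forall i, f x 0 i @[x --> F] --> l 0 i) -> f x @[x --> F] --> l.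
Proof.
move=> fl; apply/cvg_ballP => e e0.
have H (i : 'I_n) : \forall x \near F, ball (l 0 i) e (f x 0 i) by exact: (cvg_ball (fl i)).
have := filter_forall FF H; apply: filterS => x xP; split=> // i j; rewrite (ord1 i); exact: xP.
Qed.

Lemma continuous_row {R : realType} n (T : topologicalType) (f : T -> 'rV[R]_n) (x : T) :
  (forall i, {for x, continuous (fun y => f y 0 i)}) -> {for x, continuous f}.
Proof. by move=> cf; apply: (@cvg_row _ _ _ (nbhs x)) => i; exact: cf. Qed.

(** * The chain rule and C^k functions under composition *)

Section Composition.
Context {R : realType}.

Lemma derive_comp m n (U : set 'rV[R]_n) (f : 'rV[R]_n -> R) (phi : 'rV[R]_m -> 'rV[R]_n) z v :
  open U -> Ck 1 U f -> U (phi z) -> (forall j, {for z, continuous (fun z => phi z 0 j)}) ->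
  (forall j, derivable (fun z => phi z 0 j) z v) ->
  derivable (f \o phi) z v /\
  'D_v (f \o phi) z = 'D_(\row_j 'D_v (fun z => phi z 0 j) z) f (phi z).
Proof.
move=> oU cf Uz cphi dphi; set w := \row_j _.
have H : h^-1 * (f (phi (h *: v + z)) - f (phi z)) @[h --> 0^'] --> 'D_w f (phi z).
  apply: (chain_curve (y := fun=> phi z) oU cf Uz); first exact: cvg_cst.
    apply: cvg_row => i.
    exact: (cvg_comp _ (fun z => phi z 0 i) (@cvg_line _ _ z v) (cphi i)).
  move=> i; have /cvg_ex[l lP] := dphi i.
  rewrite mxE /derive (cvg_lim (@Rhausdorff R) lP).
  by under eq_fun do rewrite !mxE.
split; first by apply/cvg_ex; eexists; exact: H.
by rewrite [LHS]/derive; apply/(@cvg_lim R).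
Qed.

(** The sets [V] need not be open: all conditions in [Ck] are limits in the whole space, taken at
    points of the set. *)
Lemma Ck_local n k (U : set 'rV[R]_n) f :
  (forall x, U x -> exists2 V, V x & Ck k V f) -> Ck k U f.
Proof.
elim: k f => [|k IH] f loc.
  by split=> // x /loc[V Vx [cf _]]; exact: cf.
split=> [x /loc[V Vx [cf _]]|v]; first exact: cf.
split=> [x /loc[V Vx [_ /(_ v)[d _]]]|]; first exact: d.
by apply: IH => x /loc[V Vx [_ /(_ v)[_ d]]]; exists V.
Qed.

Lemma Ck_sub n k (U V : set 'rV[R]_n) f : V `<=` U -> Ck k U f -> Ck k V f.
Proof. by move=> VU cf; apply: Ck_local => x /VU Ux; exists U. Qed.

Lemma Ck_le n k l (U : set 'rV[R]_n) f : (l <= k)%N -> Ck k U f -> Ck l U f.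
Proof.
elim: k => [|k IH]; first by rewrite leqn0 => /eqP ->.
by rewrite leq_eqVlt => /orP[/eqP->//|/IH H] /CkW.
Qed.

Lemma Ck_comp m n k (U : set 'rV[R]_n) (V : set 'rV[R]_m) f (phi : 'rV[R]_m -> 'rV[R]_n) :
  open U -> open V -> V `<=` phi @^-1` U ->
  (forall j, Ck k V (fun z => phi z 0 j)) -> Ck k U f -> Ck k V (f \o phi).
Proof.
move=> oU oV VU; elim: k f => [|k IH] f cphi cf.
  split=> // z Vz; apply: continuous_comp; last by case: cf => [cf _]; exact/cf/VU.
  by apply: continuous_row => j; case: (cphi j) => c _; exact: c.
have dc z v : V z -> _ := fun Vz => derive_comp (v := v) oU (Ck_le (ltn0Sn k) cf) (VU _ Vz)
  (fun j => (cphi j).1 _ Vz) (fun j => ((cphi j).2 v).1 _ Vz).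
split=> [z Vz|v]; last split=> [z Vz|].
- apply: continuous_comp; last by case: cf => [cf _]; exact/cf/VU.
  by apply: continuous_row => j; case: (cphi j) => c _; exact: c.
- by have [] := dc z v Vz.
apply: (eq_Ck oV (f := fun z => \sum_j 'D_v (fun z => phi z 0 j) z * ('D_(delta_mx 0 j) f \o phi) z)).
  move=> z Vz; have [_ ->] := dc z v Vz.
  rewrite (C1_derive_sum _ oU (Ck_le (ltn0Sn k) cf) (VU _ Vz)).
  by apply: eq_bigr => j _; rewrite mxE.
apply: Ck_sum => // j; apply: CkM => //; first exact: ((cphi j).2 v).2.
by apply: IH => [i|]; [exact: CkW|exact: (cf.2 _).2].
Qed.

Lemma CkV n k (U : set 'rV[R]_n) (f : 'rV[R]_n -> R) : open U ->
  (forall x, U x -> f x != 0) -> Ck k U f -> Ck k U (fun x => (f x)^-1).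
Proof.
move=> oU f0; elim: k f f0 => [|k IH] f f0 cf.
  by split=> // x Ux; exact: (continuousV (f0 _ Ux) (cf.1 _ Ux)).
split=> [x Ux|v]; first by exact: (continuousV (f0 _ Ux) (cf.1 _ Ux)).
have [d D] := cf.2 v; split=> [x Ux|]; first by apply: derivableV; [exact: f0|exact: d].
apply: (eq_Ck oU (f := (cst (-1) \* 'D_v f) \* ((fun x => (f x)^-1) \* (fun x => (f x)^-1)))).
  move=> x Ux /=; rewrite deriveV ?f0//; last exact: d.
  rewrite -invfM -expr2 -exprVn; set a := _ ^-1 ^+ 2.
  change (-1 * 'D_v f x * a = (- a) * 'D_v f x); ring.
have IV := IH f f0 (CkW cf).
by do !apply: CkM => //; exact: Ck_cst.
Qed.

End Composition.

(** * Integrals over the unit interval *)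

Section UnitInterval.
Context {R : realType}.
Implicit Types (h g : R -> R).

Definition int01 h : R := (\int[@lebesgue_measure R]_(s in `[0%R, 1%R]) h s)%R.

(** Continuity at the end points is two-sided. The integrands are continuous past the interval, and
    the condition is then stable under pointwise operations without subspace topologies. *)
Definition cont01 h := forall s : R, 0 <= s <= 1 -> {for s, continuous h}.

Lemma cont01_within h : cont01 h -> {within `[0%R, 1%R], continuous h}.
Proof.
move=> ch; apply: continuous_in_subspaceT => s; rewrite inE /= in_itv /= => s01.
exact: ch.
Qed.

Lemma cont01_integrable h : cont01 h ->
  (@lebesgue_measure R).-integrable `[0%R, 1%R] (EFin \o h).
Proof.
move=> /cont01_within ch; apply: continuous_compact_integrable => //.
exact: segment_compact.
Qed.

Lemma eq_int01 h g : (forall s : R, 0 <= s <= 1 -> h s = g s) -> int01 h = int01 g.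
Proof.
by move=> hg; apply: eq_Rintegral => s; rewrite inE /= in_itv /=; exact: hg.
Qed.

Lemma int01D h g : cont01 h -> cont01 g -> int01 (fun s => h s + g s) = int01 h + int01 g.
Proof. by move=> ch cg; apply: RintegralD => //; exact: cont01_integrable. Qed.

Lemma int01Z (k : R) h : cont01 h -> int01 (fun s => k * h s) = k * int01 h.
Proof. by move=> ch; apply: RintegralZl => //; exact: cont01_integrable. Qed.

Lemma cont01D h g : cont01 h -> cont01 g -> cont01 (fun s => h s + g s).
Proof. by move=> ch cg s s01; apply: continuousD; [exact: ch|exact: cg]. Qed.

Lemma cont01M h g : cont01 h -> cont01 g -> cont01 (fun s => h s * g s).
Proof. by move=> ch cg s s01; apply: continuousM; [exact: ch|exact: cg]. Qed.

Lemma cont01_cst (k : R) : cont01 (fun=> k).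
Proof. by move=> s _; exact: cst_continuous. Qed.

Lemma cont01_sum (I : Type) (r : seq I) (h : I -> R -> R) : (forall i, cont01 (h i)) ->
  cont01 (fun s => \sum_(i <- r) h i s).
Proof. by move=> ch s s01; apply: (@cvg_sumr _ _ (nbhs s)) => i; exact: ch. Qed.

Lemma int010 : int01 (fun=> 0) = 0.
Proof. by rewrite /int01 Rintegral_cst// mul0r. Qed.

Lemma int01_sum (I : Type) (r : seq I) (h : I -> R -> R) : (forall i, cont01 (h i)) ->
  int01 (fun s => \sum_(i <- r) h i s) = \sum_(i <- r) int01 (h i).
Proof.
move=> ch; elim: r => [|i r IH].
  by rewrite big_nil -[RHS]int010; apply: eq_int01 => s _; rewrite big_nil.
rewrite big_cons -IH -int01D//; last exact: cont01_sum.
by apply: eq_int01 => s _; rewrite big_cons.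
Qed.

Lemma int01_bound h (e : R) : cont01 h -> (forall s : R, 0 <= s <= 1 -> `|h s| <= e) ->
  `|int01 h| <= e.
Proof.
move=> ch he; have ih := cont01_integrable ch.
apply: le_trans (le_normr_Rintegral _ ih) _ => //.
have -> : e = (\int[@lebesgue_measure R]_(s in `[0%R, 1%R]) e)%R.
  by rewrite Rintegral_cst//= lebesgue_measure_itv/= lte_fin ltr01 oppr0 adde0 mulr1.
have ie : (@lebesgue_measure R).-integrable `[0%R, 1%R] (EFin \o fun=> e).
  by apply: cont01_integrable; exact: cont01_cst.
have inh : (@lebesgue_measure R).-integrable `[0%R, 1%R] (EFin \o fun s => `|h s|).
  apply: (cont01_integrable (h := fun s => `|h s|)) => s s01.
  by apply: continuous_comp; [exact: ch|exact: norm_continuous].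
by apply: le_Rintegral => // s; rewrite /= in_itv /=; exact: he.
Qed.

Lemma int01_derive (G g : R -> R) : cont01 g ->
  (forall s : R, 0 <= s <= 1 -> is_derive s 1 G (g s)) -> int01 g = G 1 - G 0.
Proof.
move=> cg dG.
have cG (s : R) : 0 <= s <= 1 -> {for s, continuous G}.
  by move=> /dG[d _]; apply/differentiable_continuous/derivable1_diffP.
rewrite /int01 /Rintegral (@continuous_FTC2 _ _ G)//.
- exact: cont01_within.
- split.
  + by move=> s; rewrite in_itv /= => /andP[? ?]; have [] := dG s; rewrite ?ltW.
  + by apply: cvg_at_right_filter; apply: cG; rewrite lexx ler01.
  + by apply: cvg_at_left_filter; apply: cG; rewrite lexx ler01.
- move=> s; rewrite in_itv /= => /andP[? ?]; rewrite derive1E.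
  have s01 : 0 <= s <= 1 by rewrite !ltW.
  by have [_ ->] := dG s s01.
Qed.

End UnitInterval.

(** * Differentiation under the integral sign *)

Section ParamIntegral.
Context {R : realType}.

(** The parameter becomes the first coordinate, so that joint regularity in [s] and [z] is [Ck] in
    R^(1+m). *)
Definition slice m (s : R) (z : 'rV[R]_m) : 'rV[R]_(1 + m) := row_mx (const_mx s) z.

Lemma slice_line m (s h : R) (v z : 'rV[R]_m) :
  slice s (h *: v + z) = h *: row_mx 0 v + slice s z.
Proof. by rewrite /slice scale_row_mx add_row_mx scaler0 add0r. Qed.

Lemma cvg_slice m (T : Type) (F : set_system T) {FF : Filter F} (s : T -> R) (z : T -> 'rV[R]_m)
  s0 z0 : s x @[x --> F] --> s0 -> z x @[x --> F] --> z0 ->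
  slice (s x) (z x) @[x --> F] --> slice s0 z0.
Proof.
move=> ss zz; apply: cvg_row => i; case: (split_ordP i) => j ->.
  rewrite row_mxEl mxE; apply: cvg_trans ss; apply: near_eq_cvg.
  by apply: nearW => x; rewrite row_mxEl mxE.
rewrite row_mxEr; have : z x 0 j @[x --> F] --> z0 0 j.
  exact: (cvg_comp _ (fun z : 'rV_m => z 0 j) zz (@coord_continuous _ _ _ 0 j z0)).
apply: cvg_trans; apply: near_eq_cvg.
by apply: nearW => x; rewrite row_mxEr.
Qed.

(** Compactness of [0, 1], in its near-covering form, makes the continuity at the points over [z0]
    uniform in [s]. *)
Lemma slice_uniform m (G : 'rV[R]_(1 + m) -> R) z0 (e : R) :
  (forall s : R, 0 <= s <= 1 -> {for slice s z0, continuous G}) -> 0 < e ->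
  \forall z \near z0, forall s : R, 0 <= s <= 1 -> `|G (slice s z) - G (slice s z0)| < e.
Proof.
move=> cG e0.
have /compact_near_coveringP nc := @segment_compact R 0 1.
have := nc _ (nbhs z0) (fun z s => `|G (slice s z) - G (slice s z0)| < e) _ _.
move=> H; suff K : \forall z \near z0, `[0, 1]%classic `<=`
    (fun s : R => `|G (slice s z) - G (slice s z0)| < e).
  by apply: filterS K => z zP s s01; apply: zP; rewrite /= in_itv.
apply: H => s; rewrite /= in_itv /= => s01.
have L1 : G (slice p.1 p.2) @[p --> (s, z0)] --> G (slice s z0).
  apply: (cvg_comp (fun p : R * 'rV_m => slice p.1 p.2) G _ (cG s s01)).
  by apply: cvg_slice; [exact: cvg_fst|exact: cvg_snd].
have L2 : G (slice p.1 z0) @[p --> (s, z0)] --> G (slice s z0).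
  apply: (cvg_comp (fun p : R * 'rV_m => slice p.1 z0) G _ (cG s s01)).
  by apply: cvg_slice; [exact: cvg_fst|exact: cvg_cst].
have L : G (slice p.1 p.2) - G (slice p.1 z0) @[p --> (s, z0)] --> 0.
  by rewrite -(subrr (G (slice s z0))); exact: (cvgB L1 L2).
by move/cvgrPdist_lt: L => /(_ _ e0); apply: filterS => p; rewrite sub0r normrN.
Qed.

Lemma cont01_slice m (W : set 'rV[R]_(1 + m)) (F : 'rV[R]_(1 + m) -> R) z :
  Ck 0 W F -> (forall s : R, 0 <= s <= 1 -> W (slice s z)) -> cont01 (fun s => F (slice s z)).
Proof.
move=> [cF _] Wz s s01; apply: continuous_comp; last exact/cF/Wz.
by apply: (@cvg_slice _ _ (nbhs s)); [exact: cvg_id|exact: cvg_cst].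
Qed.

(** The tube lemma for the segment over [z]. *)
Lemma open_tube m (W : set 'rV[R]_(1 + m)) z : open W ->
  (forall s : R, 0 <= s <= 1 -> W (slice s z)) ->
  \forall z' \near z, forall s : R, 0 <= s <= 1 -> W (slice s z').
Proof.
move=> oW Wz; have /compact_near_coveringP nc := @segment_compact R 0 1.
have H := nc _ (nbhs z) (fun z s => W (slice s z)) _ _.
suff K : \forall z' \near z, `[0, 1]%classic `<=` (fun s : R => W (slice s z')).
  by apply: filterS K => z' zP s s01; apply: zP; rewrite /= in_itv.
apply: H => s; rewrite /= in_itv /= => /Wz Ws.
have L : slice p.1 p.2 @[p --> (s, z)] --> slice s z.
  by apply: cvg_slice; [exact: cvg_fst|exact: cvg_snd].
exact: (L W (open_nbhs_nbhs (conj oW Ws))).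
Qed.

(** For each [s] separately the mean value theorem turns the difference quotient into a value of the
    derivative near [slice s z]; [slice_uniform] bounds the error for all [s] at once. *)
Lemma derive_int01 m (W : set 'rV[R]_(1 + m)) (F : 'rV[R]_(1 + m) -> R) z v :
  open W -> Ck 1 W F -> (forall s : R, 0 <= s <= 1 -> W (slice s z)) ->
  is_derive z v (fun z => int01 (fun s => F (slice s z)))
    (int01 (fun s => 'D_(row_mx 0 v) F (slice s z))).
Proof.
move=> oW cF Wz; set DF := 'D_(row_mx 0 v) F.
have cDF : Ck 0 W DF by have [] := cF.2 (row_mx 0 v).
set l := int01 _; suff L : h^-1 * (int01 (fun s => F (slice s (h *: v + z))) -
    int01 (fun s => F (slice s z))) @[h --> 0^'] --> l.
  by split; [apply/cvg_ex; exists l|rewrite /derive; apply/(@cvg_lim R)].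
apply/cvgrPdist_le => e e0.
have /nbhs_ballP[d d0 dP] : \forall z' \near z,
    (forall s : R, 0 <= s <= 1 -> `|DF (slice s z') - DF (slice s z)| < e) /\
    (forall s : R, 0 <= s <= 1 -> W (slice s z')).
  near=> z'; split; near: z'; last exact: open_tube.
  by apply: slice_uniform => // s /Wz Ws; exact: cDF.1.
near=> h; have h0 : h != 0 by near: h; exact: nbhs_dnbhs_neq.
have zh : ball z d (h *: v + z) by near: h; exact: (cvg_ball (@cvg_line _ _ z v)).
have seg (c : R) : 0 <= c <= 1 -> ball z d (c *: (h *: v) + z).
  move=> /andP[c0 c1]; move: zh; rewrite -ball_normE /ball_ /= !opprD !(addrC _ (- z)).
  rewrite !addrA !subrr !add0r !normrN [`|c *: _|]normrZ (ger0_norm c0) => zh.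
  by apply: le_lt_trans zh; rewrite ler_piMl.
have cs z' : ball z d z' -> cont01 (fun s => F (slice s z')).
  by move=> /dP[_ W']; apply: cont01_slice W'; exact: CkW.
have zz : ball z d z by exact: ballxx.
have cd : cont01 (fun s => DF (slice s z)) by exact: cont01_slice cDF Wz.
have -> : l - h^-1 * (int01 (fun s => F (slice s (h *: v + z))) - int01 (fun s => F (slice s z))) =
   int01 (fun s => DF (slice s z) + (- h^-1) * (F (slice s (h *: v + z)) + (-1) * F (slice s z))).
  have c1 := cont01M (@cont01_cst _ (-1)) (cs _ zz).
  have c2 := cont01D (cs _ zh) c1.
  rewrite int01D//; last exact: cont01M (@cont01_cst _ _) c2.
  rewrite int01Z// int01D//; last exact: cs.
  rewrite int01Z; last exact: cs.
  change (int01 (fun s => DF (slice s z))) with l; ring.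
apply: int01_bound.
  apply: cont01D cd (cont01M (@cont01_cst _ _) (cont01D (cs _ zh) (cont01M (@cont01_cst _ _) (cs _ zz)))).
move=> s s01.
have [c c01|c c01 E] := @mvt_line _ _ F (slice s z) (h *: row_mx 0 v).
  rewrite scalerA -slice_line -scalerA.
  have [_ /(_ s s01)Ws] := dP _ (seg c c01).
  by have [] := derive_scale h (C1_derivable (v := row_mx 0 v) cF Ws).
have c01' : 0 <= c <= 1 by case/andP: c01 => ? ?; rewrite !ltW.
have [/(_ s s01)D /(_ s s01)Ws] := dP _ (seg c c01').
move: E; rewrite scalerA -!slice_line -scalerA.
have [_ ->] := derive_scale h (C1_derivable (v := row_mx 0 v) cF Ws).
move=> E; rewrite mulN1r E mulNr mulKf// distrC; exact: ltW.
Unshelve. all: by end_near. Qed.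

Lemma continuous_int01 m (W : set 'rV[R]_(1 + m)) (F : 'rV[R]_(1 + m) -> R) z :
  open W -> Ck 0 W F -> (forall s : R, 0 <= s <= 1 -> W (slice s z)) ->
  {for z, continuous (fun z => int01 (fun s => F (slice s z)))}.
Proof.
move=> oW cF Wz; apply/(@cvgrPdist_le _ _ _ (nbhs z)) => e e0.
have H1 : \forall z' \near z, forall s : R, 0 <= s <= 1 ->
    `|F (slice s z') - F (slice s z)| < e.
  by apply: slice_uniform => // s /Wz Ws; exact: cF.1.
have H2 := open_tube oW Wz; near=> z'.
have Wz' : forall s : R, 0 <= s <= 1 -> W (slice s z') by near: z'.
have c1 := cont01_slice cF Wz; have c2 := cont01_slice cF Wz'.
have -> : int01 (fun s => F (slice s z)) - int01 (fun s => F (slice s z')) =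
    int01 (fun s => F (slice s z) + (-1) * F (slice s z')).
  by rewrite int01D ?int01Z ?mulN1r//; exact: cont01M (@cont01_cst _ _) c2.
apply: int01_bound; first exact: cont01D c1 (cont01M (@cont01_cst _ _) c2).
have Fz' : forall s : R, 0 <= s <= 1 -> `|F (slice s z') - F (slice s z)| < e by near: z'.
by move=> s s01; rewrite mulN1r distrC ltW// Fz'.
Unshelve. all: by end_near. Qed.

Lemma Ck_int01 m k (W : set 'rV[R]_(1 + m)) (F : 'rV[R]_(1 + m) -> R) U :
  open W -> open U -> Ck k W F ->
  (forall z, U z -> forall s : R, 0 <= s <= 1 -> W (slice s z)) ->
  Ck k U (fun z => int01 (fun s => F (slice s z))).
Proof.
move=> oW oU cF UW; elim: k F cF => [|k IH] F cF.
  by split=> // z /UW Uz; exact: continuous_int01 Uz.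
have d v z : U z -> _ := fun Uz => derive_int01 v oW (Ck_le (ltn0Sn k) cF) (UW _ Uz).
split=> [z /UW Uz|v]; first exact: continuous_int01 oW (Ck_le (leq0n _) cF) Uz.
split=> [z Uz|]; first by have [] := d v z Uz.
apply: (eq_Ck oU (f := fun z => int01 (fun s => 'D_(row_mx 0 v) F (slice s z)))).
  by move=> z Uz; have [_ ->] := d v z Uz.
exact: (IH _ (cF.2 (row_mx 0 v)).2).
Qed.

End ParamIntegral.

(** * Bump functions *)

Section Bump.
Context {R : realType}.

(* [x^-j * exp (-1/x)] for [x > 0]: the derivatives of [exp (-1/x)] are combinations of these. *)
Definition flat j (x : R) : R := if 0 < x then x^-1 ^+ j * expR (- x^-1) else 0.

Lemma flat_ge0 j x : 0 <= flat j x.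
Proof.
rewrite /flat; case: ifP => // x0.
by rewrite mulr_ge0 ?expR_ge0// exprn_ge0// invr_ge0 ltW.
Qed.

Lemma flat_le j x : flat j x <= j.+1`!%:R * `|x|.
Proof.
rewrite /flat; case: ifPn => [x0|_]; last by rewrite mulr_ge0.
have y0 : 0 < x^-1 by rewrite invr_gt0.
rewrite gtr0_norm// expRN; move: (expR_ge1Dxn j (ltW y0)) => H.
have {}H : x^-1 ^+ j.+1 / j.+1`!%:R <= expR x^-1 by apply: le_trans H; rewrite lerDr.
rewrite ler_pdivrMr ?expR_gt0//; move: H; rewrite ler_pdivrMr ?ltr0n ?fact_gt0// => H.
rewrite exprSr in H; rewrite -(ler_pM2r y0); apply: le_trans H _.
have nx : x != 0 by rewrite gt_eqF.
by rewrite le_eqVlt; apply/orP; left; apply/eqP; field.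
Qed.

Lemma is_derive_flat_gt0 j (x : R) : 0 < x ->
  is_derive x 1 (fun y : R => y^-1 ^+ j * expR (- y^-1))
    (- (j%:R * (x^-1 ^+ j.+1 * expR (- x^-1))) + x^-1 ^+ j.+2 * expR (- x^-1)).
Proof.
move=> x0; have nx : x != 0 by rewrite gt_eqF.
have V : is_derive x 1 (fun y : R => y^-1) (- x ^- 2).
  by have := is_deriveV (f := id) nx (is_derive_id x 1); rewrite [_ *: _]mulr1.
elim: j => [|j IH].
  have E : is_derive x 1 (fun y : R => expR (- y^-1)) (expR (- x^-1) * x ^- 2).
    apply: (is_derive1_comp (f := expR) (g := fun y : R => - y^-1)).
    by have := is_deriveN V; rewrite opprK.
  have -> : (fun y : R => y^-1 ^+ 0 * expR (- y^-1)) = (fun y : R => expR (- y^-1)).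
    by apply/funext => y; rewrite expr0 mul1r.
  by apply: (is_derive_eq E); rewrite mul0r oppr0 add0r exprVn mulrC.
have -> : (fun y : R => y^-1 ^+ j.+1 * expR (- y^-1)) =
    (fun y : R => y^-1) * (fun y : R => y^-1 ^+ j * expR (- y^-1)).
  by apply/funext => y; rewrite [RHS]mulrA -exprS.
apply: (is_derive_eq (is_deriveM V IH)).
have Q (w e : R) : w * (- (j%:R * (w ^+ j.+1 * e)) + w ^+ j.+2 * e) + w ^+ j * e * - w ^+ 2 =
    - ((j%:R + 1) * (w ^+ j.+2 * e)) + w ^+ j.+3 * e.
  by rewrite !exprS; move: (w ^+ j) (j%:R : R) => p q; ring.
by rewrite -natr1 -exprVn; exact: Q.
Qed.

Lemma flat_continuous0 j (e : R) : 0 < e -> \forall h \near (0 : R), `|flat j h| < e.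
Proof.
move=> e0; have c0 : 0 < j.+1`!%:R :> R by rewrite ltr0n fact_gt0.
near=> h; rewrite ger0_norm ?flat_ge0// (le_lt_trans (flat_le _ _))//.
rewrite mulrC -ltr_pdivlMr//; near: h; apply/nbhs_ballP.
exists (e / j.+1`!%:R) => /=; first by rewrite divr_gt0.
by move=> h; rewrite /ball /= sub0r normrN.
Unshelve. all: by end_near. Qed.

(** At 0 the difference quotient of [flat j] is [flat j.+1], which tends to 0 by [flat_le]. The
    family is thus closed under differentiation, up to linear combinations. *)
Lemma is_derive_flat j (x : R) : is_derive x 1 (flat j) (- (j%:R * flat j.+1 x) + flat j.+2 x).
Proof.
have [x0|x0|->] := ltrgtP x 0.
- have Z i : flat i x = 0 by rewrite /flat ltNge (ltW x0).
  rewrite !Z mulr0 oppr0 addr0; apply: (near_eq_is_derive (f := cst 0)).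
  near=> y; rewrite /flat ltNge ltW//; near: y; exact: lt_nbhsl.
- apply: (near_eq_is_derive (f := fun y : R => y^-1 ^+ j * expR (- y^-1))).
    by near=> y; rewrite /flat ifT//; near: y; exact: lt_nbhsr.
  by rewrite /flat x0; exact: is_derive_flat_gt0.
rewrite /flat ltxx mulr0 oppr0 addr0 -/(flat j).
suff L : h^-1 * (flat j h) @[h --> 0^'] --> (0 : R).
  have E : (fun h : R => h^-1 *: ((flat j \o shift 0) (h *: 1) - flat j 0)) =
      (fun h => h^-1 * flat j h).
    apply/funext => h /=; rewrite addr0 {2}/flat ltxx subr0.
    by rewrite [h *: 1]mulr1.
  split; first by rewrite /derivable E; apply/cvg_ex; exists 0.
  by rewrite /derive E; apply/(@cvg_lim R).
apply/cvgrPdist_lt => e e0; near=> h; rewrite sub0r normrN.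
have h0 : h != 0 by near: h; exact: nbhs_dnbhs_neq.
have -> : h^-1 * flat j h = flat j.+1 h.
  by rewrite /flat; case: ifP; rewrite ?mulr0// exprS mulrA.
by near: h; apply: (@cvg_within _ (nbhs (0 : R))); exact: flat_continuous0.
Unshelve. all: by end_near. Qed.

Lemma Ck_flat j k : Ck k setT (fun z : 'rV[R]_1 => flat j (z 0 0)).
Proof.
have E i (z v : 'rV[R]_1) : derivable (fun z : 'rV[R]_1 => flat i (z 0 0)) z v /\
    'D_v (fun z : 'rV[R]_1 => flat i (z 0 0)) z =
    v 0 0 * (- i%:R * flat i.+1 (z 0 0) + flat i.+2 (z 0 0)).
  have [d d'] := is_derive_flat i (z 0 0).
  have [] := derive_scale (v 0 0) d; rewrite d' mulNr; rewrite [_ *: 1]mulr1 => D <-.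
  rewrite /derivable /derive.
  have -> : (fun h : R => h^-1 *: (((fun z : 'rV[R]_1 => flat i (z 0 0)) \o shift z) (h *: v)
    - flat i (z 0 0))) =
    (fun h : R => h^-1 *: ((flat i \o shift (z 0 0)) (h *: v 0 0) - flat i (z 0 0))).
    by apply/funext => h /=; rewrite !mxE.
  by split.
have C i : forall z : 'rV[R]_1, {for z, continuous (fun z : 'rV[R]_1 => flat i (z 0 0))}.
  move=> z; apply: (continuous_comp (@coord_continuous _ _ _ 0 0 z)).
  have [d _] := is_derive_flat i (z 0 0).
  exact/differentiable_continuous/derivable1_diffP.
elim: k j => [|k IH] j; split=> // v; split=> [z _|]; first by have [] := E j z v.
apply: (eq_Ck openT (f := fun z => (cst (v 0 0) \* (cst (- j%:R) \* (fun z => flat j.+1 (z 0 0)) \+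
  (fun z => flat j.+2 (z 0 0)))) z)) => [z _|]; first by have [_ ->] := E j z v.
by apply: CkM (openT) (Ck_cst _ _ openT) (CkD openT (CkM openT (Ck_cst _ _ openT) (IH _)) (IH _)).
Qed.

(** The denominator is positive, since [x] and [1 - x] are not both nonpositive. *)
Definition step (x : R) : R := flat 0 x / (flat 0 x + flat 0 (1 - x)).

Lemma flat0_gt0 x : 0 < x -> 0 < flat 0 x.
Proof. by move=> x0; rewrite /flat x0 expr0 mul1r expR_gt0. Qed.

Lemma flat0_le0 x : x <= 0 -> flat 0 x = 0.
Proof. by move=> x0; rewrite /flat ltNge x0. Qed.

Lemma step0 x : x <= 0 -> step x = 0.
Proof. by move=> x0; rewrite /step flat0_le0// mul0r. Qed.

Lemma step1 x : 1 <= x -> step x = 1.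
Proof.
move=> x1; rewrite /step (@flat0_le0 (1 - x)) ?subr_le0// addr0 divff// gt_eqF// flat0_gt0//.
exact: lt_le_trans x1.
Qed.

Lemma Ck_comp1 m k (V : set 'rV[R]_m) (h : R -> R) (g : 'rV[R]_m -> R) : open V ->
  Ck k setT (fun z : 'rV[R]_1 => h (z 0 0)) -> Ck k V g -> Ck k V (fun z => h (g z)).
Proof.
move=> oV ch cg; pose phi (z : 'rV[R]_m) : 'rV[R]_1 := const_mx (g z).
have cphi j : Ck k V (fun z => phi z 0 j) by apply: (eq_Ck oV) cg => z _; rewrite mxE.
apply: (eq_Ck oV) (Ck_comp openT oV _ cphi ch) => // z _ /=.
by rewrite mxE.
Qed.

Lemma Ck_step k : Ck k setT (fun z : 'rV[R]_1 => step (z 0 0)).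
Proof.
have C1 := Ck_flat 0 k.
have C2 : Ck k setT (fun z : 'rV[R]_1 => flat 0 (1 - z 0 0)).
  apply: (Ck_comp1 openT C1).
  apply: (eq_Ck openT) (CkD openT (Ck_cst k 1 openT)
    (CkM openT (Ck_cst k (-1) openT) (Ck_coord k 0 openT))) => z _ /=.
  by rewrite mulN1r.
apply: CkM => //; first exact: openT.
apply: CkV => //; [exact: openT| |exact: CkD openT C1 C2].
move=> z _; rewrite gt_eqF//=.
have [z0|z0] := ltP 0 (z 0 0).
  by rewrite ltr_pwDl ?flat_ge0// flat0_gt0.
by rewrite ltr_wpDl ?flat_ge0// flat0_gt0// subr_gt0 (le_lt_trans z0).
Qed.

Lemma Ck_prod n k (U : set 'rV[R]_n) m (f : 'I_m -> 'rV[R]_n -> R) : open U ->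
  (forall i, Ck k U (f i)) -> Ck k U (fun x => \prod_i f i x).
Proof.
move=> oU; elim: m f => [|m IH] f hf.
  by apply: eq_Ck (Ck_cst k 1 oU) => // x _; rewrite big_ord0.
apply: eq_Ck (CkM oU (hf ord0) (IH (fun i => f (lift ord0 i)) _)) => // x _ /=.
by rewrite big_ord_recl.
Qed.

Lemma bump_ball n (u : 'rV[R]_n) (e : R) : 0 < e ->
  exists2 phi : 'rV[R]_n -> R, smooth_on setT phi &
    (forall z, ball u (e / 2) z -> phi z = 1) /\
    (forall z, ~ ball u (3 / 4 * e) z -> phi z = 0).
Proof.
(* The norm is the sup norm, whence a product over the coordinates. With [d = z 0 i - u 0 i], the
   argument [2 - 4 d^2 / e^2] is at least 1 for [|d| <= e / 2] and at most [-1/4] for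
   [|d| >= 3 / 4 * e]; using the square avoids the absolute value, which is not smooth. *)
move=> e0; pose arg i (z : 'rV[R]_n) := 2 + (- 4 / e ^+ 2) * ((z 0 i - u 0 i) * (z 0 i - u 0 i)).
have argE i z : arg i z = 2 - 4 * ((z 0 i - u 0 i) * (z 0 i - u 0 i)) / e ^+ 2.
  by rewrite /arg; field; rewrite gt_eqF.
exists (fun z => \prod_i step (arg i z)); last split.
- move=> k; apply: Ck_prod; first exact: openT.
  move=> i; apply: (Ck_comp1 openT (Ck_step k)).
  have C : Ck k setT (fun z : 'rV[R]_n => z 0 i - u 0 i).
    exact: CkD openT (Ck_coord k i openT) (Ck_cst k (- u 0 i) openT).
  exact: CkD openT (Ck_cst k _ openT) (CkM openT (Ck_cst k _ openT) (CkM openT C C)).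
- move=> z uz; rewrite big1// => i _; apply: step1.
  have := uz.2 0 i; rewrite /ball /= distrC ltr_norml => /andP[H1 H2].
  rewrite argE; set a := z 0 i - u 0 i in H1 H2 *.
  suff : 4 * (a * a) / e ^+ 2 <= 1 by lra.
  rewrite ler_pdivrMr ?exprn_gt0// mul1r.
  have : 0 <= (e / 2 - a) * (e / 2 + a) by rewrite mulr_ge0//; lra.
  have : 0 <= e ^+ 2 by exact: sqr_ge0.
  by rewrite expr2; nra.
- move=> z uz; apply/eqP; rewrite prodf_seq_eq0; apply/hasP.
  have [i Hi] : exists i, ~ ball (u 0 i) (3 / 4 * e) (z 0 i).
    apply/existsNP => H; apply: uz; split; first by rewrite mulr_gt0.
    by move=> i j; rewrite (ord1 i); exact: H.
  exists i; first by rewrite mem_index_enum.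
  apply/eqP/step0.
  move/negP: Hi; rewrite /ball /= -leNgt distrC => Hi.
  rewrite argE; have {}Hi : (3 / 4 * e) ^+ 2 <= (z 0 i - u 0 i) ^+ 2.
    rewrite -[leRHS]real_normK ?num_real// ler_sqr ?nnegrE//.
    by rewrite mulr_ge0// ltW.
  set a := z 0 i - u 0 i in Hi *.
  suff : 2 <= 4 * (a * a) / e ^+ 2 by lra.
  by rewrite ler_pdivlMr ?exprn_gt0//; rewrite !expr2 in Hi *; have := sqr_ge0 e; rewrite expr2; nra.
Qed.

End Bump.

(** * Smooth functions on an atlas *)

Section AtlasTopology.
Context {R : realType} {T : Type} {n : nat}.
Variable At : atlas (R := R) T n.

(** An atlas on a bare type, such as that of the total space, offers no other notion of open set. *)
Definition aopen (W : set T) := forall c, charts At c -> open (cimage c W).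

Lemma cimageP (c : chart T n) (W : set T) (u : 'rV[R]_n) : charts At c ->
  cimage c W u <-> cimage c setT u /\ W (param c u).
Proof.
move=> hc; split=> [[x [cx Wx] <-]|[[x [cx _] <-]]].
  by rewrite (coordK hc cx); split=> //; exists x.
by rewrite (coordK hc cx) => Wx; exists x => //; split.
Qed.

Lemma cimage_sub (c : chart (R := R) T n) (V W : set T) : V `<=` W -> cimage c V `<=` cimage c W.
Proof. by move=> VW u [x [cx /VW Wx] <-]; exists x. Qed.

Lemma aopenT : aopen setT.
Proof. by move=> c hc; exact: (open_cimageT hc). Qed.

Lemma aopen_chart c : charts At c -> aopen (cdom c).
Proof. by move=> hc c' hc'; exact: (cimage_open hc' hc). Qed.

Lemma aopenI V W : aopen V -> aopen W -> aopen (V `&` W).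
Proof.
move=> oV oW c hc; have -> : cimage c (V `&` W) = cimage c V `&` cimage c W.
  apply/seteqP; split=> u /=.
    by move=> [x [cx [Vx Wx]] <-]; split; exists x.
  move=> [[x [cx Vx] <-] /(cimageP _ _ hc)[_]]; rewrite (coordK hc cx) => Wx.
  by exists x.
exact: openI (oV _ hc) (oW _ hc).
Qed.

Lemma aopen_local W : (forall x, W x -> exists V, [/\ aopen V, V x & V `<=` W]) -> aopen W.
Proof.
move=> loc c hc; rewrite openE => _ [x [cx Wx] <-].
have [V [oV Vx VW]] := loc _ Wx.
apply: (filterS (cimage_sub (c := c) VW)); apply: open_nbhs_nbhs; split; first exact: oV.
by exists x.
Qed.

Lemma aopen_forall m (V : 'I_m -> set T) : (forall k, aopen (V k)) ->
  aopen [set x | forall k, V k x].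
Proof.
move=> oV c hc; rewrite openE => _ [x [cx Vx] <-].
have cVx k : cimage c (V k) (coord c x) by exists x.
have H k : nbhs (coord c x) (cimage c (V k)) by apply: open_nbhs_nbhs; split=> //; exact: oV.
have H0 : nbhs (coord c x) (cimage c setT).
  by apply: open_nbhs_nbhs; split; [exact: aopenT|exists x].
apply: filterS (filterI H0 (filter_forall (nbhs_filter (coord c x)) H)).
move=> _ [[y [cy _] <-] Vy].
exists y => //; split=> // k; have := Vy k; rewrite (cimageP _ _ hc) (coordK hc cy).
by case.
Qed.

Lemma aopenU V W : aopen V -> aopen W -> aopen (V `|` W).
Proof.
by move=> oV oW; apply: aopen_local => x [?|?];
  [exists V; split=> // y; left|exists W; split=> // y; right].
Qed.

Lemma aopen_coord c (O : set 'rV[R]_n) : charts At c -> open O ->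
  aopen [set x | cdom c x /\ O (coord c x)].
Proof.
move=> hc oO c' hc'.
have -> : cimage c' [set x | cdom c x /\ O (coord c x)] =
    cimage c' (cdom c) `&` (fun u => coord c (param c' u)) @^-1` O.
  apply/seteqP; split=> u /=.
    move=> [x [cx [cx' Ox]] <-]; rewrite (coordK hc' cx); split=> //.
    by exists x.
  by move=> [[x [cx cx'] <-]]; rewrite (coordK hc' cx) => Ox; exists x.
rewrite openE => u [Uu Ou]; apply: filterI; first exact: open_nbhs_nbhs (conj (cimage_open hc' hc) Uu).
have : {for u, continuous (fun u => coord c (param c' u))}.
  by apply: continuous_row => j; have [+ _] := transition_smooth hc' hc j 0; exact.
by apply; exact: open_nbhs_nbhs.
Qed.

Lemma smooth_within_sub (V W : set T) (f : T -> R) : V `<=` W ->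
  smooth_within At W f -> smooth_within At V f.
Proof. by move=> VW sf c hc k; exact: Ck_sub (cimage_sub VW) (sf c hc k). Qed.

Lemma smooth_within_local (W : set T) (f : T -> R) :
  (forall x, W x -> exists V, [/\ V x & smooth_within At V f]) -> smooth_within At W f.
Proof.
move=> loc c hc k; apply: Ck_local => _ [x [cx Wx] <-].
have [V [Vx sf]] := loc _ Wx.
by exists (cimage c V); [exists x|exact: sf].
Qed.

Lemma eq_smooth_within (W : set T) (f g : T -> R) : aopen W -> (forall x, W x -> f x = g x) ->
  smooth_within At W f -> smooth_within At W g.
Proof.
move=> oW fg sf c hc k; apply: (eq_Ck (oW _ hc)) (sf c hc k) => u.
by rewrite (cimageP _ _ hc) => -[_]; exact: fg.
Qed.

Lemma smooth_within_cst (W : set T) (a : R) : aopen W -> smooth_within At W (cst a).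
Proof. by move=> oW c hc k; exact: Ck_cst (oW _ hc). Qed.

Lemma smooth_withinD (W : set T) (f g : T -> R) : aopen W ->
  smooth_within At W f -> smooth_within At W g -> smooth_within At W (fun x => f x + g x).
Proof. by move=> oW sf sg c hc k; exact: CkD (oW _ hc) (sf _ hc k) (sg _ hc k). Qed.

Lemma smooth_withinM (W : set T) (f g : T -> R) : aopen W ->
  smooth_within At W f -> smooth_within At W g -> smooth_within At W (fun x => f x * g x).
Proof. by move=> oW sf sg c hc k; exact: CkM (oW _ hc) (sf _ hc k) (sg _ hc k). Qed.

Lemma smooth_withinN (W : set T) (f : T -> R) : aopen W ->
  smooth_within At W f -> smooth_within At W (fun x => - f x).
Proof.
move=> oW sf; apply: (eq_smooth_within oW) (smooth_withinM oW (smooth_within_cst (-1) oW) sf).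
by move=> x _; rewrite mulN1r.
Qed.

Lemma smooth_within_sum (W : set T) m (f : 'I_m -> T -> R) : aopen W ->
  (forall i, smooth_within At W (f i)) -> smooth_within At W (fun x => \sum_i f i x).
Proof. by move=> oW sf c hc k; apply: Ck_sum (oW _ hc) _ => i; exact: sf. Qed.

(** One chart suffices: the expression in any other chart is obtained by composing with a transition
    map. *)
Lemma smooth_within_chart c (W : set T) (f : T -> R) : charts At c -> aopen W ->
  W `<=` cdom c -> smooth_on (cimage c W) (f \o param c) -> smooth_within At W f.
Proof.
move=> hc oW Wc sf c' hc' k; pose phi u := coord c (param c' u).
have Wphi u : cimage c' W u -> cimage c W (phi u).
  by rewrite (cimageP _ _ hc') => -[_ Wu]; exists (param c' u) => //; split=> //; exact: Wc.
apply: (eq_Ck (oW _ hc')) (Ck_comp (oW _ hc) (oW _ hc') Wphi _ (sf k)) => [u|j].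
  by rewrite (cimageP _ _ hc') /= /phi => -[_ /Wc cu]; rewrite (coordK hc cu).
exact: Ck_sub (cimage_sub Wc) (transition_smooth hc' hc j k).
Qed.

Lemma smooth_within_coord c (W : set T) (O : set 'rV[R]_n) (h : 'rV[R]_n -> R) : charts At c ->
  aopen W -> W `<=` cdom c -> (forall x, W x -> O (coord c x)) -> smooth_on O h ->
  smooth_within At W (h \o coord c).
Proof.
move=> hc oW Wc WO sh; apply: (smooth_within_chart hc oW Wc) => k.
have WO' : cimage c W `<=` O by move=> _ [x [_ /WO] ? <-].
apply: (eq_Ck (oW _ hc)) (Ck_sub WO' (sh k)) => _ [x [cx Wx] <-] /=.
by rewrite (coordK hc cx).
Qed.

(** Nothing is known of [g] outside [W], but there the point lies in [O], where the product is 0. *)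
Lemma smooth_extend (O W : set T) (chi g : T -> R) : aopen O -> aopen W ->
  (forall x, O x \/ W x) -> smooth_within At setT chi -> (forall x, O x -> chi x = 0) ->
  smooth_within At W g -> smooth_within At setT (fun x => chi x * g x).
Proof.
move=> oO oW OW schi chi0 sg; apply: smooth_within_local => x _.
have [Ox|Wx] := OW x; [exists O|exists W]; split=> //.
  apply: (eq_smooth_within oO) (smooth_within_cst 0 oO) => y /chi0 ->.
  by rewrite mul0r.
exact: smooth_withinM (smooth_within_sub _ schi) sg.
Qed.

Record bump_at (x : T) (W : set T) := BumpAt {
  bump : T -> R;
  bump_one : set T;
  bump_zero : set T;
  bump_one_open : aopen bump_one;
  bump_one_at : bump_one x;
  bump_one_sub : bump_one `<=` W;
  bump_zero_open : aopen bump_zero;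
  bump1 : forall y, bump_one y -> bump y = 1;
  bump0 : forall y, bump_zero y -> bump y = 0;
  bump_cover : forall y, bump_zero y \/ W y;
  bump_smooth : smooth_within At setT bump }.

(** Stated for an arbitrary atlas, so that one theory of tangent vectors serves both [M] and the
    total space. *)
Definition bumpy := forall x W, aopen W -> W x -> inhabited (bump_at x W).

End AtlasTopology.

Section Boxes.
Context {R : realType}.

Definition box n (u : 'rV[R]_n) (e : R) : set 'rV[R]_n :=
  [set v | forall i, `[u 0 i - e, u 0 i + e]%classic (v 0 i)].

Lemma box_compact n (u : 'rV[R]_n) e : compact (box u e).
Proof.
apply: (rV_compact (A := fun i => `[u 0 i - e, u 0 i + e]%classic)) => i.
exact: segment_compact.
Qed.

Lemma ball_box n (u v : 'rV[R]_n) e : ball u e v -> box u e v.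
Proof.
move=> [_ uv] i; have := uv 0 i; rewrite /ball /= ltr_norml => /andP[? ?].
by rewrite /= in_itv /=; apply/andP; split; lra.
Qed.

Lemma box_ball n (u v : 'rV[R]_n) e e' : e < e' -> 0 < e' -> box u e v -> ball u e' v.
Proof.
move=> ee' e'0 uv; split=> // i j; rewrite (ord1 i); have := uv j.
by rewrite /= in_itv /= => /andP[? ?]; rewrite /ball /= ltr_norml; apply/andP; split; lra.
Qed.

Lemma box_closed n (u : 'rV[R]_n) e : closed (box u e).
Proof. by apply: compact_closed; [exact: norm_hausdorff|exact: box_compact]. Qed.

End Boxes.

(** * Bump functions on the base and on the total space *)

Section ManifoldBumps.
Context {R : realType} {n : nat}.
Variable M : manifold R n.
Local Notation AM := (matlas M).

Lemma open_aopen (W : set M) : open W -> aopen AM W.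
Proof. by move=> oW c hc; exact: cimage_open_sub. Qed.

Lemma manifold_bumpy : bumpy AM.
Proof.
move=> x W oW Wx; have [c hc cx] := chart_cover AM x.
set u := coord c x; set W1 := W `&` cdom c.
have oW1 : aopen AM W1 by apply: aopenI => //; exact: aopen_chart.
have uW1 : cimage c W1 u by exists x.
have /nbhs_ballP[e /= e0 eW] := open_nbhs_nbhs (conj (oW1 c hc) uW1).
have [phi sphi [phi1 phi0]] := bump_ball u e0.
have box_e : box u (3 / 4 * e) `<=` cimage c W1.
  by move=> v uv; apply: eW; apply: box_ball uv => //; lra.
have boxT v : box u (3 / 4 * e) v -> cimage c setT v.
  by move=> /box_e; apply: cimage_sub.
(* [K] is compact, hence closed since [M] is Hausdorff; the bump, extended by 0, vanishes on its
   open complement. The factor [3 / 4 < 1] keeps the closed box inside the ball of radius [e]. *)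
pose K := param c @` box u (3 / 4 * e).
have cK : closed K.
  apply: compact_closed; first exact: manifold_hausdorff.
  apply: continuous_compact; last exact: box_compact.
  by apply: continuous_in_subspaceT => v /[!inE] /boxT; exact: param_cont.
pose chi y := if `[< cdom c y >] then phi (coord c y) else 0.
have chiE y : cdom c y -> chi y = phi (coord c y) by move=> cy; rewrite /chi asboolT.
have chi0 y : (~` K) y -> chi y = 0.
  rewrite /chi; case: asboolP => // cy Ky; apply: phi0 => uy; apply: Ky.
  by exists (coord c y); [exact: ball_box|exact: (coordK hc cy)].
have oK : aopen AM (~` K) by apply: open_aopen; exact: closed_openC.
have oV := aopen_coord hc (ball_open u (e / 2)).
split; apply: (@BumpAt _ _ _ AM x W chi [set y | cdom c y /\ ball u (e / 2) (coord c y)] (~` K)) => //.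
- by split=> //; apply: ballxx; rewrite divr_gt0.
- move=> y [cy uy]; have : cimage c W1 (coord c y).
    by apply: eW; apply: le_ball uy; lra.
  by rewrite (cimageP _ _ hc) (coordK hc cy) => -[_ []].
- by move=> y [cy uy]; rewrite chiE// phi1.
- move=> y; have [|Ky] := pselect (K y); last by left.
  move=> [v /box_e + <-]; rewrite (cimageP _ _ hc) => -[_ []]; by right.
- apply: smooth_within_local => y _; have [cy|cy] := pselect (cdom c y).
    exists (cdom c); split=> //.
    have oc := aopen_chart hc.
    apply: (eq_smooth_within oc) (smooth_within_coord hc oc _ _ sphi) => // z cz.
    by rewrite chiE.
  exists (~` K); split.
    by move=> [v /box_e [z [cz _] <-]]; rewrite (coordK hc cz) => E; apply: cy; rewrite -E.
  by apply: (eq_smooth_within oK) (smooth_within_cst 0 oK) => z /chi0.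
Qed.

End ManifoldBumps.

Section TotalBumps.
Context {R : realType} {n r : nat} {M : manifold R n}.
Variable A : vector_bundle M r.
Local Notation AM := (matlas M).
Local Notation AA := (total_atlas A).

Lemma total_charts_chart c t : charts AM c -> trivs A t -> charts AA (total_chart c t).
Proof. by move=> hc ht; exists c, t. Qed.

Lemma open_lsubmx (O : set 'rV[R]_n) : open O -> open (@lsubmx R 1 n r @^-1` O).
Proof. by move=> oO; apply: open_comp => // z _; exact: continuous_lsubmx. Qed.

Lemma aopen_base (W : set M) : aopen AM W -> aopen AA (@base _ _ _ _ A @^-1` W).
Proof.
move=> oW _ [c [t [hc ht ->]]]; rewrite cimage_total//; apply: open_lsubmx.
by apply: (aopenI (open_aopen _) oW hc); exact: tdom_open ht.
Qed.

Lemma smooth_base (W : set M) (f : M -> R) : smooth_within AM W f ->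
  smooth_within AA (@base _ _ _ _ A @^-1` W) (fun a => f (base a)).
Proof.
move=> sf _ [c [t [hc ht ->]]] k; rewrite cimage_total//.
apply: (Ck_lsubmx _ (sf c hc k)).
by move=> z [x [cx [_ Wx]] xz]; exists x.
Qed.

Lemma total_bumpy : bumpy AA.
Proof.
move=> a W oW Wa; have [c hc cx] := chart_cover AM (base a).
have [t ht tx] := triv_cover A (base a).
pose C := total_chart c t; have hC : charts AA C := total_charts_chart hc ht.
set u := coord C a; set W1 := W `&` cdom C.
have oW1 : aopen AA W1 by apply: aopenI => //; exact: aopen_chart.
have uW1 : cimage C W1 u by exists a.
have /nbhs_ballP[e /= e0 eW] := open_nbhs_nbhs (conj (oW1 C hC) uW1).
have [phi sphi [phi1 phi0]] := bump_ball u e0.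
have oct : aopen AM (cdom c `&` tdom t).
  by apply: open_aopen; apply: openI; [exact: cdom_open|exact: tdom_open].
have [[chi V O oV Va VW oO chi1 chi0 OW schi]] := manifold_bumpy oct (conj cx tx).
have oB := aopen_coord hC (closed_openC (@box_closed _ _ u (3 / 4 * e))).
have oC : aopen AA (cdom C) := aopen_chart hC.
have oUe := aopen_coord hC (ball_open u (e / 2)).
have eb : ball u (e / 2) `<=` cimage C W1.
  by move=> v uv; apply: eW; apply: le_ball uv; lra.
pose chi' (b : total_space A) := chi (base b) * phi (coord C b).
pose V' := (@base _ _ _ _ A @^-1` V) `&` [set b | cdom C b /\ ball u (e / 2) (coord C b)].
pose O' := (@base _ _ _ _ A @^-1` O) `|`
  [set b | cdom C b /\ (~` box u (3 / 4 * e)) (coord C b)].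
split; apply: (@BumpAt _ _ _ AA a W chi' V' O').
- by apply: aopenI => //; exact: aopen_base.
- by split=> //; split=> //; apply: ballxx; rewrite divr_gt0.
- move=> b [_ [cb /eb]].
  by rewrite (cimageP _ _ hC) (coordK hC cb) => -[_ []].
- by apply: aopenU => //; exact: aopen_base.
- by move=> b [Vb [cb ub]]; rewrite /chi' chi1// phi1// mulr1.
- move=> b [Ob|[cb nb]]; first by rewrite /chi' chi0// mul0r.
  by rewrite /chi' phi0 ?mulr0// => /ball_box.
- move=> b; have [Ob|cb] := OW (base b); first by left; left.
  have [ub|ub] := pselect (box u (3 / 4 * e) (coord C b)); last by left; right.
  right; have : cimage C W1 (coord C b) by apply: eW; apply: box_ball ub => //; lra.
  by rewrite (cimageP _ _ hC) (coordK hC cb) => -[_ []].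
- apply: (smooth_extend (aopen_base oO) oC) => //.
  + by move=> b; exact: OW.
  + exact: smooth_base schi.
  + by move=> b; exact: chi0.
  + exact: smooth_within_coord sphi.
Qed.

End TotalBumps.

(** * Tangent vectors *)

Section Hadamard.
Context {R : realType}.

Lemma is_derive_coord n (z v : 'rV[R]_n) k : is_derive z v (fun z : 'rV[R]_n => z 0 k) (v 0 k).
Proof.
suff L : h^-1 * ((h *: v + z) 0 k - z 0 k) @[h --> 0^'] --> v 0 k.
  by split; [apply/cvg_ex; eexists; exact: L|rewrite /derive; apply/(@cvg_lim R)].
apply: cvg_near_cst; near=> h; have h0 : h != 0 by near: h; exact: nbhs_dnbhs_neq.
by rewrite !mxE addrK mulKf.
Unshelve. all: by end_near. Qed.

(** [g k] is the integral of the k-th partial derivative along the segment from [u] to [z], which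
    stays in the ball; the expansion is the fundamental theorem of calculus on that segment. *)
Lemma hadamard n (U : set 'rV[R]_n) (f : 'rV[R]_n -> R) u e : open U -> smooth_on U f ->
  0 < e -> ball u e `<=` U ->
  exists g : 'I_n -> 'rV[R]_n -> R, [/\ forall k, smooth_on (ball u e) (g k),
    forall k, g k u = 'D_(delta_mx 0 k) f u &
    forall z, ball u e z -> f z = f u + \sum_k (z 0 k - u 0 k) * g k z].
Proof.
move=> oU sf e0 uU; pose phi (w : 'rV[R]_(1 + n)) := u + w 0 (lshift n ord0) *: (rsubmx w - u).
have phiE s z : phi (slice s z) = s *: (z - u) + u.
  by rewrite /phi /slice row_mxEl mxE row_mxKr addrC.
have cphi k j : Ck k setT (fun w => phi w 0 j).
  apply: (eq_Ck openT (f := fun w => u 0 j + w 0 (lshift n ord0) * (w 0 (rshift 1 j) + - u 0 j))).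
    by move=> w _; rewrite !mxE.
  apply: CkD openT (Ck_cst _ _ openT) (CkM openT (Ck_coord _ _ openT)
    (CkD openT (Ck_coord _ _ openT) (Ck_cst _ _ openT))).
have phic : continuous phi.
  by move=> w; apply: continuous_row => j; have [+ _] := cphi 0 j; apply.
pose W := phi @^-1` U; have oW : open W by apply: open_comp => // w _; exact: phic.
have seg z (s : R) : ball u e z -> 0 <= s <= 1 -> ball u e (s *: (z - u) + u).
  rewrite -ball_normE /ball_ /= => uz /andP[s0 s1].
  have -> : u - (s *: (z - u) + u) = s *: (u - z) by apply/rowP => j; rewrite !mxE; ring.
  by rewrite normrZ ger0_norm// (le_lt_trans _ uz)// ler_piMl.
have segW z : ball u e z -> forall s : R, 0 <= s <= 1 -> W (slice s z).
  by move=> uz s s01; rewrite /W /= phiE; apply: uU; exact: seg.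
have cD k m : Ck m W ('D_(delta_mx 0 k) f \o phi).
  apply: (Ck_comp oU oW _ _ ((sf m.+1).2 _).2) => // j.
  exact: (Ck_sub (@subsetT _ W) (cphi m j)).
exists (fun k z => int01 (fun s => ('D_(delta_mx 0 k) f \o phi) (slice s z))); split.
- by move=> k m; apply: Ck_int01 (oW) (ball_open _ _) (cD k m) segW.
- move=> k; rewrite (@eq_int01 _ _ (fun=> 'D_(delta_mx 0 k) f u)).
    by rewrite /int01 Rintegral_cst//= lebesgue_measure_itv/= lte_fin ltr01 oppr0 adde0 mulr1.
  by move=> s _ /=; rewrite phiE subrr scaler0 add0r.
move=> z uz; have cs k : cont01 (fun s => ('D_(delta_mx 0 k) f \o phi) (slice s z)).
  exact: cont01_slice (cD k 0) (segW z uz).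
have cs' k := cont01M (@cont01_cst _ (z 0 k - u 0 k)) (cs k).
have D : int01 (fun s => \sum_k (z 0 k - u 0 k) * ('D_(delta_mx 0 k) f \o phi) (slice s z)) =
    (fun s => f (s *: (z - u) + u)) 1 - (fun s => f (s *: (z - u) + u)) 0.
  apply: (int01_derive (G := fun s => f (s *: (z - u) + u))) => [|s s01]; first exact: cont01_sum.
  have Us := segW z uz s s01; have c1 := sf 1%N.
  have -> : \sum_k (z 0 k - u 0 k) * ('D_(delta_mx 0 k) f \o phi) (slice s z) =
      'D_(z - u) f (s *: (z - u) + u).
    rewrite (C1_derive_sum _ oU c1) -?phiE//.
    by apply: eq_bigr => k _; rewrite !mxE.
  by apply: is_derive_line; apply: C1_derivable c1 _; rewrite -phiE.
rewrite int01_sum// in D; move: D; rewrite /= scale1r scale0r add0r subrK => D.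
have -> : f z = f u + (f z - f u) by ring.
by rewrite -D; congr (_ + _); apply: eq_bigr => k _; exact: (int01Z (z 0 k - u 0 k) (cs k)).
Qed.

End Hadamard.

Section TangentSpace.
Context {R : realType} {T : Type} {n : nat} {At : atlas (R := R) T n}.
Local Notation C := (Cinf At).
Implicit Types (f g : C) (a : T).

Lemma to_CinfE (g : T -> R) : smooth_within At setT g -> to_Cinf At g = g :> (T -> R).
Proof. by move=> sg; rewrite /to_Cinf /insubd insubT //=; exact/asboolP. Qed.

Lemma Cinf1E a : (1 : C) a = 1. Proof. by []. Qed.
Lemma CinfDE f g a : (f + g) a = f a + g a. Proof. by []. Qed.
Lemma CinfNE f a : (- f) a = - f a. Proof. by []. Qed.
Lemma CinfME f g a : (f * g) a = f a * g a. Proof. by []. Qed.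
Lemma CinfZE (k : R) f a : (k *: f) a = k * f a. Proof. by []. Qed.

Lemma Cinf_sumE (I : Type) (s : seq I) (F : I -> C) a : (\sum_(i <- s) F i) a = \sum_(i <- s) F i a.
Proof. by elim: s => [|i s IH]; rewrite ?big_nil// !big_cons CinfDE IH. Qed.

Lemma Cinf_eq f g : (forall a, f a = g a) -> f = g.
Proof. by move=> fg; apply/val_inj/funext. Qed.

Section Derivation.
Variables (a : T) (v : tangent At a).

Lemma tangent_linear (k : R) f g : v (k *: f + g) = k * v f + v g.
Proof. by case: v => w /= /asboolP[+ _]; apply. Qed.

Lemma tangentM f g : v (f * g) = f a * v g + g a * v f.
Proof. by case: v => w /= /asboolP[_ +]; apply. Qed.

Lemma tangentD f g : v (f + g) = v f + v g.
Proof. by rewrite -{1}[f]scale1r tangent_linear mul1r. Qed.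

Lemma tangent0 : v 0 = 0.
Proof. by have /eqP := tangentD 0 0; rewrite addr0 -subr_eq0 opprD addNKr oppr_eq0 => /eqP. Qed.

Lemma tangentZ (k : R) f : v (k *: f) = k * v f.
Proof. by rewrite -[k *: f]addr0 tangent_linear tangent0 addr0. Qed.

Lemma tangentN f : v (- f) = - v f.
Proof. by rewrite -scaleN1r tangentZ mulN1r. Qed.

Lemma tangent_sum (I : Type) (s : seq I) (F : I -> C) :
  v (\sum_(i <- s) F i) = \sum_(i <- s) v (F i).
Proof. by apply: big_morph; [exact: tangentD|exact: tangent0]. Qed.

Lemma tangent1 : v 1 = 0.
Proof.
have := tangentM 1 1; rewrite mulr1.
change ((1 : C) a) with (1 : R); rewrite !mul1r => /eqP.
by rewrite -subr_eq0 opprD addNKr oppr_eq0 => /eqP.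
Qed.

End Derivation.
End TangentSpace.

(** * Locality of derivations and their coordinates in a chart *)

Section LocalTangent.
Context {R : realType} {T : Type} {n : nat} {At : atlas (R := R) T n}.
Hypothesis bAt : bumpy At.
Local Notation C := (Cinf At).
Implicit Types (f g : C) (a : T) (c : chart (R := R) T n).

(** Derivations act on global functions only, so a germ is first made global by a cut-off. *)
Lemma local_extension a W (g : T -> R) : aopen At W -> W a -> smooth_within At W g ->
  exists G : C, exists V, [/\ aopen At V, V a, V `<=` W & forall y, V y -> G y = g y].
Proof.
move=> oW Wa sg; have [[chi V O oV Va VW oO chi1 chi0 OW schi]] := bAt oW Wa.
have sG := smooth_extend oO oW OW schi chi0 sg.
exists (to_Cinf At (fun x => chi x * g x)), V; split=> // y Vy.
by rewrite (to_CinfE sG) chi1// mul1r.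
Qed.

(** For a bump [chi] at [a] the product [(f - g) * chi] is 0 everywhere, and the Leibniz rule at [a]
    reduces its derivative to [v (f - g)]. *)
Lemma tangent_local a (v : tangent At a) W f g : aopen At W -> W a ->
  (forall x, W x -> f x = g x) -> v f = v g.
Proof.
move=> oW Wa fg; have [[chi V O oV Va VW oO chi1 chi0 OW schi]] := bAt oW Wa.
have E : (f - g) * to_Cinf At chi = 0.
  apply: Cinf_eq => x; rewrite CinfME (to_CinfE schi) CinfDE CinfNE.
  have [/chi0 ->|/fg ->] := OW x; first by rewrite mulr0.
  by rewrite subrr mul0r.
have := congr1 v E; rewrite tangentM (tangent0 v) (to_CinfE schi) chi1//.
rewrite CinfDE CinfNE fg// subrr mul0r add0r mul1r tangentD tangentN => /eqP.
by rewrite subr_eq0 => /eqP.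
Qed.

(** A chart coordinate is not a global function; it is replaced by a global function with the same
    germ at [a]. *)
Definition is_lcoord c a (k : 'I_n) (G : C) : Prop :=
  exists V, [/\ aopen At V, V a & forall y, V y -> cdom c y /\ G y = coord c y 0 k].

(* Junk value 0 when [a] is not in the chart [c]. *)
Definition lcoord c a k : C := xget 0 [set G | is_lcoord c a k G].

Lemma lcoordP c a k : charts At c -> cdom c a -> is_lcoord c a k (lcoord c a k).
Proof.
move=> hc ca; suff : exists G, is_lcoord c a k G by move/xgetPex; exact.
have [|G [V [oV Va VW GE]]] := local_extension (aopen_chart hc) ca (g := fun x => coord c x 0 k).
  apply: (smooth_within_coord (O := setT) (h := fun u => u 0 k) hc (aopen_chart hc)) => // m.
  exact: Ck_coord openT.
by exists G, V; split=> // y Vy; split; [exact: VW|exact: GE].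
Qed.

Definition tvec c a (v : tangent At a) : 'rV[R]_n := \row_k v (lcoord c a k).

Lemma tvec_lcoord c a (v : tangent At a) k G : charts At c -> cdom c a ->
  is_lcoord c a k G -> v G = tvec c v 0 k.
Proof.
move=> hc ca [V [oV Va GE]]; have [V' [oV' Va' GE']] := lcoordP k hc ca.
rewrite mxE; apply: (tangent_local v (aopenI oV oV')) => // x [Vx V'x].
by rewrite (GE _ Vx).2 (GE' _ V'x).2.
Qed.

Lemma tvecP c a (k : R) (v w : tangent At a) : tvec c (k *: v + w) = k *: tvec c v + tvec c w.
Proof. by apply/rowP => i; rewrite !mxE. Qed.

Lemma cinf_chart c f : charts At c -> smooth_on (cimage c (cdom c)) (f \o param c).
Proof. by move=> hc; rewrite -cimage_setT; exact: Cinf_smooth. Qed.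

Lemma cimage_mem c a : cdom c a -> cimage c (cdom c) (coord c a).
Proof. by exists a. Qed.

(** By Hadamard's lemma [f] has the germ of [f a] plus a sum of products of [lcoord c a k], minus
    its value at [a], with [G k]. The Leibniz rule kills the constants and the terms in which [v]
    acts on [G k]. *)
Lemma tvecE c a (v : tangent At a) f : charts At c -> cdom c a ->
  v f = 'D_(tvec c v) (f \o param c) (coord c a).
Proof.
move=> hc ca; set U := cimage c (cdom c); set u := coord c a.
have oU : open U by exact: (cimage_open hc hc).
have Uu : U u by exact: cimage_mem.
have /nbhs_ballP[e /= e0 eU] := open_nbhs_nbhs (conj oU Uu).
have sf := cinf_chart f hc.
have [g [sg gu fE]] := hadamard oU sf e0 eU.
pose B := [set x | cdom c x /\ ball u e (coord c x)].
have oB : aopen At B := aopen_coord hc (ball_open u e).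
have Ba : B a by split=> //; exact: ballxx.
have ext k : exists G : C, exists V, [/\ aopen At V, V a, V `<=` B &
    forall y, V y -> G y = (g k \o coord c) y].
  apply: local_extension => //.
  by apply: (smooth_within_coord hc oB _ _ (sg k)) => x [].
have [G {}ext] := choice ext; have [V {}ext] := choice ext.
have loc k := lcoordP k hc ca; have [V' {}loc] := choice loc.
pose F : C := (f a) *: (1 : C) + \sum_k (lcoord c a k - (u 0 k) *: (1 : C)) * G k.
pose W := B `&` [set x | forall k, (V k `&` V' k) x].
have oW : aopen At W.
  apply: aopenI => //; apply: aopen_forall => k; apply: aopenI.
    by have [] := ext k.
  by have [] := loc k.
have Wa : W a.
  split=> // k; split; first by have [] := ext k.
  by have [] := loc k.
have -> : v f = v F.
  apply: (tangent_local v oW Wa) => x [[cx ux] WV].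
  rewrite CinfDE CinfZE Cinf1E Cinf_sumE mulr1.
  have := fE _ ux; rewrite [(_ \o _) (coord c x)]/comp (coordK hc cx).
  rewrite [(_ \o _) u]/comp (coordK hc ca) => ->; congr (_ + _).
  apply: eq_bigr => k _; have [Vx V'x] := WV k.
  have [_ _ _ GE] := ext k; have [_ _ /(_ _ V'x)[_ E]] := loc k.
  by rewrite CinfME CinfDE CinfNE CinfZE Cinf1E E GE// mulr1.
rewrite tangentD tangentZ tangent1 mulr0 add0r tangent_sum.
rewrite (C1_derive_sum _ oU (sf 1%N) Uu); apply: eq_bigr => k _.
rewrite tangentM CinfDE CinfNE CinfZE Cinf1E.
have [_ Va' /(_ _ Va')[_ ->]] := loc k; have [_ Vk _ /(_ _ Vk)->] := ext k.
rewrite mulr1 subrr mul0r add0r /= gu mulrC; congr (_ * _).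
by rewrite tangentD tangentN tangentZ tangent1 mulr0 subr0 mxE.
Qed.

End LocalTangent.

Lemma smooth_on_derive {R : realType} n (U : set 'rV[R]_n) f v :
  smooth_on U f -> smooth_on U ('D_v f).
Proof. by move=> sf k; exact: ((sf k.+1).2 v).2. Qed.

Section ChartTangent.
Context {R : realType} {T : Type} {n : nat} {At : atlas (R := R) T n}.
Hypothesis bAt : bumpy At.
Local Notation C := (Cinf At).
Implicit Types (f g : C) (a : T) (c : chart (R := R) T n).

Lemma tvec_inj c a (v w : tangent At a) : charts At c -> cdom c a -> tvec c v = tvec c w -> v = w.
Proof.
by move=> hc ca E; apply/val_inj/funext => f; rewrite /= !(tvecE bAt _ f hc ca) E.
Qed.

Section Dvec.
Variables (c : chart (R := R) T n) (a : T).
Hypotheses (hc : charts At c) (ca : cdom c a).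

Let oU : open (cimage c (cdom c)). Proof. exact: (cimage_open hc hc). Qed.
Let Uu : cimage c (cdom c) (coord c a). Proof. exact: cimage_mem. Qed.
Let c1 f : Ck 1 (cimage c (cdom c)) (f \o param c). Proof. exact: cinf_chart. Qed.

Fact dvec_subproof (xi : 'rV[R]_n) :
  (fun f : C => 'D_xi (f \o param c) (coord c a)) \in derivation_at At a.
Proof.
have d f : derivable (f \o param c : 'rV[R]_n -> R) (coord c a) xi := C1_derivable (c1 f) Uu.
apply/asboolP; split=> [k f g|f g].
  have [D E] := is_deriveZ k (derivableP (d f)).
  have [_ F] := is_deriveD (DeriveDef D E) (derivableP (d g)).
  exact: F.
have [_ F] := is_deriveM (derivableP (d f)) (derivableP (d g)).
by move: F; rewrite /= (coordK hc ca).
Qed.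

Definition dvec xi : tangent At a := Tangent (dvec_subproof xi).

Lemma dvecE xi f : dvec xi f = 'D_xi (f \o param c) (coord c a). Proof. by []. Qed.

Lemma tvec_dvec xi : tvec c (dvec xi) = xi.
Proof.
apply/rowP => k; rewrite mxE dvecE.
have [V [oV Va GE]] := lcoordP bAt k hc ca.
have [_ <-] := is_derive_coord (coord c a) xi k.
have nV : nbhs (coord c a) (cimage c V).
  by apply: open_nbhs_nbhs; split; [exact: oV|exists a].
apply: near_eq_derive; apply: filterS nV => _ [y [cy Vy] <-] /=.
by rewrite (coordK hc cy) (GE _ Vy).2.
Qed.

End Dvec.

(** The extension [lcoord c a k] varies with [a]; near a given point a single one computes the
    coordinate at all nearby points, by [tvec_lcoord]. *)
Lemma tvec_smooth c (X : forall a, tangent At a) k : charts At c -> smooth_vfield X ->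
  smooth_within At (cdom c) (fun a => tvec c (X a) 0 k).
Proof.
move=> hc sX; apply: smooth_within_local => a ca.
have [V [oV Va GE]] := lcoordP bAt k hc ca; exists V; split=> //.
apply: (eq_smooth_within oV) (smooth_within_sub (subsetT _) (sX (lcoord c a k))) => x Vx.
have [cx _] := GE _ Vx; apply: (tvec_lcoord bAt) => //.
by exists V.
Qed.

Lemma smooth_of_tvec c W (X : forall a, tangent At a) f : charts At c -> aopen At W ->
  W `<=` cdom c -> (forall k, smooth_within At W (fun a => tvec c (X a) 0 k)) ->
  smooth_within At W (fun a => X a f).
Proof.
move=> hc oW Wc sX; have oU := cimage_open hc hc; have sf := cinf_chart f hc.
apply: (eq_smooth_within oW (f := fun a => \sum_k tvec c (X a) 0 k *
    ('D_(delta_mx 0 k) (f \o param c) \o coord c) a)).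
  move=> a /Wc ca; rewrite (tvecE bAt _ f hc ca).
  by rewrite (C1_derive_sum _ oU (sf 1%N)) //; exact: cimage_mem.
apply: smooth_within_sum => // k; apply: smooth_withinM => //.
have WU x : W x -> cimage c (cdom c) (coord c x) by move=> /Wc; exact: cimage_mem.
exact: (smooth_within_coord hc oW Wc WU (smooth_on_derive (delta_mx 0 k) sf)).
Qed.

End ChartTangent.

(** * Vertical lifts and the tangent map of the projection *)

Section VerticalLift.
Context {R : realType} {n r : nat} {M : manifold R n}.
Variable A : vector_bundle M r.
Local Notation AM := (matlas M).
Local Notation AA := (total_atlas A).
Local Notation tcd c t := (cdom (total_chart c t)).

Definition along (a : total_space A) (u : A (base a)) (s : R) : total_space A :=
  vec (projT2 a + s *: u).

Lemma coord_along c t a u s : cdom (total_chart (A := A) c t) a ->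
  coord (total_chart c t) (along u s) =
    s *: row_mx 0 (tcoord t (base a) u) + coord (total_chart c t) a.
Proof.
move=> _ /=; rewrite scale_row_mx add_row_mx scaler0 add0r linearD linearZ /=.
by rewrite addrC.
Qed.

Lemma along_derive c t a (u : A (base a)) (f : Cinf AA) : charts AM c -> trivs A t ->
  cdom (total_chart (A := A) c t) a ->
  'D_1 (fun s => f (along u s)) 0 =
    'D_(row_mx 0 (tcoord t (base a) u)) (f \o param (total_chart c t)) (coord (total_chart c t) a).
Proof.
move=> hc ht ca; have hC := total_charts_chart hc ht; set w := row_mx 0 _.
set C := total_chart c t.
have -> : (fun s => f (along u s)) = (fun s : R => (f \o param C) (s *: w + coord C a)).
  by apply/funext => s; rewrite [RHS]/comp -(coord_along _ _ ca) (coordK hC).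
have [|_ ->] := @is_derive_line _ _ (f \o param C) (coord C a) w 0.
  apply: (C1_derivable (cinf_chart f hC 1%N)); rewrite scale0r add0r.
  exact: cimage_mem.
by rewrite scale0r add0r.
Qed.

(** The operator is free of charts; a chart is used only to recognize it as some [dvec], hence as a
    derivation. *)
Fact vlift_subproof a (u : A (base a)) :
  (fun f : Cinf AA => 'D_1 (fun s => f (along u s)) 0) \in derivation_at AA a.
Proof.
have [c hc ca] := chart_cover AM (base a); have [t ht ta] := triv_cover A (base a).
have Ca : cdom (total_chart c t) a by [].
have -> : (fun f : Cinf AA => 'D_1 (fun s => f (along u s)) 0) =
    dvec (total_charts_chart hc ht) Ca (row_mx 0 (tcoord t (base a) u)).
  by apply/funext => f; exact: along_derive.
exact: valP.
Qed.

Definition vlift a (u : A (base a)) : tangent AA a := Tangent (vlift_subproof u).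

Lemma vlift_dvec c t a (u : A (base a)) (hc : charts AM c) (ht : trivs A t)
  (Ca : cdom (total_chart (A := A) c t) a) :
  vlift u = dvec (total_charts_chart hc ht) Ca (row_mx 0 (tcoord t (base a) u)).
Proof. by apply/val_inj/funext => f; exact: along_derive. Qed.

Lemma tvec_vlift c t a (u : A (base a)) : charts AM c -> trivs A t ->
  cdom (total_chart (A := A) c t) a ->
  tvec (total_chart c t) (vlift u) = row_mx 0 (tcoord t (base a) u).
Proof.
by move=> hc ht Ca; rewrite (vlift_dvec _ hc ht Ca) (tvec_dvec (@total_bumpy _ _ _ _ A)).
Qed.

(** A function pulled back from [M] is constant on the line [along u]. *)
Lemma tangent_proj_vlift a (u : A (base a)) : tangent_proj (vlift u) = 0.
Proof.
apply/val_inj/funext => f; rewrite /= /derive.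
by apply/(@cvg_lim R) => //; apply: cvg_near_cst; near=> h; rewrite subrr [LHS]mulr0.
Unshelve. all: by end_near. Qed.

(** The pullback of a coordinate extension on [M] is a coordinate extension on the total space, for
    one of the first [n] coordinates. *)
Lemma tvec_proj c t a (v : tangent AA a) : charts AM c -> trivs A t ->
  cdom (total_chart (A := A) c t) a ->
  tvec c (tangent_proj v) = lsubmx (tvec (total_chart c t) v).
Proof.
move=> hc ht Ca; have hC := total_charts_chart hc ht; apply/rowP => k; rewrite mxE [RHS]mxE.
apply: (tvec_lcoord (@total_bumpy _ _ _ _ A) v hC Ca).
have [V [oV Va GE]] := lcoordP (@manifold_bumpy _ _ M) k hc Ca.1.
exists ((@base _ _ _ _ A @^-1` V) `&` cdom (total_chart c t)); split=> //.
  by apply: aopenI; [exact: aopen_base|exact: aopen_chart].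
by move=> y [Vy Cy]; split=> //=; rewrite row_mxEl (GE _ Vy).2.
Qed.

End VerticalLift.

(** * The prolongation *)

Section ProlongCoordinates.
Context {R : realType} {n r : nat} {M : manifold R n}.
Variable A : lie_algebroid M r.
Local Notation AM := (matlas M).
Local Notation AA := (total_atlas A).

Lemma pfibreP a (k : R) (z w : prolong (A := A) a) : pfibre (k *: z + w) = k *: pfibre z + pfibre w.
Proof. by []. Qed.

Lemma panchorP a (k : R) (z w : prolong (A := A) a) :
  panchor (k *: z + w) = k *: panchor z + panchor w.
Proof. by []. Qed.

Lemma panchorE a (k : R) (z w : prolong (A := A) a) f :
  panchor (k *: z + w) f = k * panchor z f + panchor w f.
Proof. by []. Qed.

Lemma prolongP a (z : prolong (A := A) a) : anchor A (base a) (pfibre z) = tangent_proj (panchor z).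
Proof. by have /asboolP := valP z. Qed.

Lemma prolong_eq a (z w : prolong (A := A) a) : pfibre z = pfibre w -> panchor z = panchor w -> z = w.
Proof.
move=> E F; apply/val_inj; rewrite /= [prolong_pair z]surjective_pairing.
by rewrite [prolong_pair w]surjective_pairing; congr (_, _).
Qed.

Fact pvert_subproof a (u : A (base a)) : (0, vlift u) \in @in_prolong _ _ _ _ A a.
Proof. by apply/asboolP; rewrite /= tangent_proj_vlift linear0. Qed.

Definition pvert a (u : A (base a)) : prolong a := Prolong (pvert_subproof u).

Section Chart.
Variables (c : chart (R := R) M n) (t : trivialization A r).
Hypotheses (hc : charts AM c) (ht : trivs A t).
Let C := total_chart c t.
Let hC : charts AA C. Proof. exact: total_charts_chart. Qed.
Let bA : bumpy AA. Proof. exact: total_bumpy. Qed.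

(** The base part of the tangent vector is the anchor of the [A]-component, so [beta] and [eta]
    together form [2r] coordinates on each fibre of the prolongation. *)
Definition beta a (z : prolong (A := A) a) : 'rV[R]_r := tcoord t (base a) (pfibre z).
Definition eta a (z : prolong (A := A) a) : 'rV[R]_r := rsubmx (tvec C (panchor z)).

Lemma betaP a (k : R) (z w : prolong (A := A) a) : beta (k *: z + w) = k *: beta z + beta w.
Proof. by rewrite /beta pfibreP linearP. Qed.

Lemma etaP a (k : R) (z w : prolong (A := A) a) : eta (k *: z + w) = k *: eta z + eta w.
Proof. by rewrite /eta panchorP tvecP linearP. Qed.

HB.instance Definition _ a :=
  GRing.isLinear.Build R (prolong (A := A) a) 'rV[R]_r _ (@beta a) (@betaP a).
HB.instance Definition _ a :=
  GRing.isLinear.Build R (prolong (A := A) a) 'rV[R]_r _ (@eta a) (@etaP a).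

Lemma prolong_ext a (z w : prolong (A := A) a) : cdom C a -> beta z = beta w -> eta z = eta w ->
  z = w.
Proof.
move=> Ca E F; have {}E : pfibre z = pfibre w by apply: (can_inj (tcoordK ht Ca.2)).
apply: prolong_eq => //; apply: (tvec_inj bA hC Ca).
rewrite -[LHS]hsubmxK -[RHS]hsubmxK; congr row_mx; last exact: F.
by rewrite -!tvec_proj// -!prolongP E.
Qed.

Section Hor.
Variables (a : total_space A) (Ca : cdom C a).

(** The horizontal lift for the flat connection of the chart: base part the anchor of [b], fibre
    part 0. *)
Fact phor_subproof (b : A (base a)) :
  (b, dvec hC Ca (row_mx (tvec c (anchor A (base a) b)) 0)) \in @in_prolong _ _ _ _ A a.
Proof.
apply/asboolP => /=; apply: (tvec_inj (@manifold_bumpy _ _ M) hc Ca.1).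
by rewrite (tvec_proj _ hc ht Ca) (tvec_dvec bA) row_mxKl.
Qed.

Definition phor (b : A (base a)) : prolong a := Prolong (phor_subproof b).

Lemma beta_phor b : beta (phor b) = tcoord t (base a) b. Proof. by []. Qed.

Lemma eta_phor b : eta (phor b) = 0.
Proof. by rewrite /eta [panchor _]/panchor /= (tvec_dvec bA) row_mxKr. Qed.

End Hor.

Lemma beta_pvert a (u : A (base a)) : beta (pvert u) = 0.
Proof. by rewrite /beta [pfibre _]/pfibre /= linear0. Qed.

Lemma eta_pvert a (u : A (base a)) : cdom C a -> eta (pvert u) = tcoord t (base a) u.
Proof. by move=> Ca; rewrite /eta [panchor _]/panchor /= (tvec_vlift _ hc ht Ca) row_mxKr. Qed.

(** [phor] requires a proof that [a] lies in the chart. The value 0 elsewhere gives a smooth section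
    when [s] vanishes on an open set covering [M] together with the chart. *)
Definition hor_section (s : forall x, A x) : psection A := fun a =>
  match pselect (cdom C a) with left Ca => phor Ca (s (base a)) | right _ => 0 end.

Lemma hor_sectionE s a (Ca : cdom C a) : hor_section s a = phor Ca (s (base a)).
Proof.
rewrite /hor_section; case: pselect => [Ca'|//].
by rewrite (Prop_irrelevance Ca Ca').
Qed.

Definition vert_section (s : forall x, A x) : psection A := fun a => pvert (s (base a)).

Lemma smooth_pullback s : smooth_section (A := A) s ->
  smooth_pullback_section (A := A) (fun a => s (base a)).
Proof. by move=> ss t' ht' j; exact: (smooth_base (A := A) (ss t' ht' j)). Qed.

End Chart.

Lemma smooth_pullback0 : smooth_pullback_section (A := A) (fun a => 0).
Proof.
move=> t ht j; have oT : aopen AA (@base _ _ _ _ A @^-1` tdom t).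
  by apply: aopen_base; apply: open_aopen; exact: tdom_open.
apply: (eq_smooth_within oT) (smooth_within_cst 0 oT) => a _.
by rewrite linear0 mxE.
Qed.

(** Projecting onto the zero section brings vertical lifts under the defining rule of the
    bracket. *)
Lemma vert_section_projectable s : smooth_section (A := A) s ->
  projectable (vert_section s) (fun=> 0).
Proof.
move=> ss; split=> //; last first.
  move=> t ht j; have oT : aopen AM (tdom t) by apply: open_aopen; exact: tdom_open.
  apply: (eq_smooth_within oT) (smooth_within_cst 0 oT) => a _.
  by rewrite linear0 mxE.
split; first exact: smooth_pullback0.
move=> f; apply: smooth_within_local => a _.
have [c hc ca] := chart_cover AM (base a); have [t ht ta] := triv_cover A (base a).
have hC := total_charts_chart hc ht; have oC := aopen_chart hC.
exists (cdom (total_chart c t)); split=> //.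
apply: (smooth_of_tvec (@total_bumpy _ _ _ _ A) f hC oC) => // k.
have -> : (fun a => tvec (total_chart c t) (panchor (vert_section s a)) 0 k) =
  (fun a => tvec (total_chart c t) (vlift (s (base a))) 0 k) by [].
case: (split_ordP k) => j ->.
  apply: (eq_smooth_within oC) (smooth_within_cst 0 oC) => b Cb.
  by rewrite (tvec_vlift _ hc ht Cb) row_mxEl mxE.
have sb : smooth_within AA (cdom (total_chart c t)) (fun a => tcoord t (base a) (s (base a)) 0 j).
  by apply: smooth_within_sub (smooth_base (A := A) (ss t ht j)) => b [].
apply: (eq_smooth_within oC) sb => b Cb.
by rewrite (tvec_vlift _ hc ht Cb) row_mxEr.
Qed.

End ProlongCoordinates.

(** * Global sections that form a frame near a point *)

Section Frames.
Context {R : realType} {n r : nat} {M : manifold R n}.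
Variable A : lie_algebroid M r.
Local Notation AM := (matlas M).
Local Notation AA := (total_atlas A).

Section Chart.
Variables (c : chart (R := R) M n) (t : trivialization A r).
Hypotheses (hc : charts AM c) (ht : trivs A t).
Let C := total_chart c t.
Let hC : charts AA C. Proof. exact: total_charts_chart. Qed.
Let bA : bumpy AA. Proof. exact: total_bumpy. Qed.

Lemma aopen_tdom t' : trivs A t' -> aopen AM (tdom t').
Proof. by move=> ht'; apply: open_aopen; exact: tdom_open. Qed.

Definition frame (chi : M -> R) (i : 'I_r) (x : M) : A x := chi x *: tinv t x (delta_mx 0 i).

Lemma frame_smooth (chi : M -> R) (O : set M) i : smooth_within AM setT chi -> aopen AM O ->
  (forall x, O x -> chi x = 0) -> (forall x, O x \/ tdom t x) -> smooth_section (frame chi i).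
Proof.
move=> schi oO chi0 Ot t' ht' j; apply: smooth_within_local => x tx.
have [Ox|t'x] := Ot x.
  have oOt := aopenI oO (aopen_tdom ht').
  exists (O `&` tdom t'); split=> //.
  apply: (eq_smooth_within oOt) (smooth_within_cst 0 oOt) => y [/chi0 Oy _].
  by rewrite /frame Oy scale0r linear0 mxE.
have ott := aopenI (aopen_tdom ht) (aopen_tdom ht').
exists (tdom t `&` tdom t'); split=> //.
apply: (eq_smooth_within ott) (smooth_withinM ott (smooth_within_sub (subsetT _) schi)
  (triv_smooth ht ht' i j)) => y _.
by rewrite /frame linearZ mxE.
Qed.

Lemma hor_section0 s a : s (base a) = 0 -> hor_section hc ht s a = 0.
Proof.
move=> s0; have [Ca|Ca] := pselect (cdom C a); last first.
  by rewrite /hor_section; case: pselect.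
rewrite (hor_sectionE _ _ _ Ca); apply: (prolong_ext hc ht Ca).
  by rewrite beta_phor s0 !linear0.
by rewrite eta_phor linear0.
Qed.

Lemma hor_section_projectable s (O : set M) : smooth_section (A := A) s -> aopen AM O ->
  (forall x, O x -> s x = 0) -> (forall x, O x \/ (cdom c `&` tdom t) x) ->
  projectable (hor_section hc ht s) s.
Proof.
move=> ss oO s0 Oct; have pf a : pfibre (hor_section hc ht s a) = s (base a).
  have [/s0 E|Ca] := Oct (base a); first by rewrite hor_section0// E.
  by rewrite (hor_sectionE _ _ _ (Ca : cdom C a)).
split=> //; split.
  have -> : (fun a => pfibre (hor_section hc ht s a)) = (fun a => s (base a)).
    exact: functional_extensionality_dep pf.
  exact: smooth_pullback ss.
move=> f; apply: smooth_within_local => a _; have [Oa|Ca] := Oct (base a).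
  have oO' := aopen_base (A := A) oO.
  exists (@base _ _ _ _ A @^-1` O); split=> //.
  apply: (eq_smooth_within oO') (smooth_within_cst 0 oO') => b /s0 E.
  by rewrite hor_section0.
have oC := aopen_chart hC; exists (cdom C); split=> //.
apply: (smooth_of_tvec bA f hC oC) => // k.
have tv b (Cb : cdom C b) : tvec C (panchor (hor_section hc ht s b)) =
    row_mx (tvec c (anchor A (base b) (s (base b)))) 0.
  by rewrite (hor_sectionE _ _ _ Cb) [panchor _]/panchor /= (tvec_dvec bA).
case: (split_ordP k) => j ->.
  have := tvec_smooth (@manifold_bumpy _ _ M) j hc (anchor_smooth ss).
  move=> /(smooth_base (A := A)) sm.
  have sm' := smooth_within_sub (V := cdom C) (fun b (Cb : cdom C b) => Cb.1) sm.
  by apply: (eq_smooth_within oC) sm' => b Cb; rewrite tv// row_mxEl.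
apply: (eq_smooth_within oC) (smooth_within_cst 0 oC) => b Cb.
by rewrite tv// row_mxEr mxE.
Qed.

Section Local.
Variables (x0 : M) (bp : bump_at AM x0 (cdom c `&` tdom t)).

(** Brackets act on global sections, hence the cut-off; the sections form the frame of the
    trivialization only over [bump_one bp]. *)
Definition lframe i := frame (bump bp) i.
Definition hframe i : psection A := hor_section hc ht (lframe i).
Definition vframe i : psection A := vert_section (lframe i).

Lemma lframe_smooth i : smooth_section (lframe i).
Proof.
apply: (@frame_smooth _ (bump_zero bp)).
- exact: bump_smooth.
- exact: bump_zero_open.
- exact: bump0.
- by move=> x; have [|[]] := bump_cover bp x; [left|right].
Qed.

Lemma hframe_projectable i : projectable (hframe i) (lframe i).
Proof.
apply: (@hor_section_projectable _ (bump_zero bp)).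
- exact: lframe_smooth.
- exact: bump_zero_open.
- by move=> x /(bump0 (b := bp)) E; rewrite /lframe /frame E scale0r.
- exact: bump_cover.
Qed.

Lemma vframe_projectable i : projectable (vframe i) (fun=> 0).
Proof. by apply: vert_section_projectable; exact: lframe_smooth. Qed.

Lemma hframe_smooth i : psmooth (hframe i). Proof. by have [] := hframe_projectable i. Qed.
Lemma vframe_smooth i : psmooth (vframe i). Proof. by have [] := vframe_projectable i. Qed.

Lemma bump_one_dom a : bump_one bp (base a) -> cdom C a.
Proof. exact: bump_one_sub. Qed.

Lemma tcoord_lframe i x : tdom t x -> tcoord t x (lframe i x) = bump bp x *: delta_mx 0 i.
Proof. by move=> tx; rewrite linearZ tinvK. Qed.

Lemma beta_hframe i a : cdom C a -> beta t (hframe i a) = bump bp (base a) *: delta_mx 0 i.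
Proof. by move=> Ca; rewrite /hframe (hor_sectionE _ _ _ Ca) beta_phor tcoord_lframe//; case: Ca. Qed.

Lemma eta_hframe i a : cdom C a -> eta c t (hframe i a) = 0.
Proof. by move=> Ca; rewrite /hframe (hor_sectionE _ _ _ Ca) eta_phor. Qed.

Lemma beta_vframe i a : beta t (vframe i a) = 0.
Proof. exact: beta_pvert. Qed.

Lemma eta_vframe i a : cdom C a -> eta c t (vframe i a) = bump bp (base a) *: delta_mx 0 i.
Proof. by move=> Ca; rewrite (eta_pvert hc ht)// tcoord_lframe//; case: Ca. Qed.

Lemma prolong_decomp a (z : prolong (A := A) a) : cdom C a -> bump bp (base a) *: z =
  \sum_i beta t z 0 i *: hframe i a + \sum_i eta c t z 0 i *: vframe i a.
Proof.
move=> Ca; apply: (prolong_ext hc ht Ca); rewrite linearZ linearD /= !linear_sum /=.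
  rewrite [X in _ + X]big1 ?addr0 => [|i _]; last by rewrite linearZ /= beta_vframe scaler0.
  rewrite {1}[beta t z]row_sum_delta scaler_sumr; apply: eq_bigr => i _.
  by rewrite [RHS]linearZ /= beta_hframe// !scalerA mulrC.
rewrite [X in X + _]big1 ?add0r => [|i _]; last by rewrite linearZ /= eta_hframe// scaler0.
rewrite {1}[eta c t z]row_sum_delta scaler_sumr; apply: eq_bigr => i _.
by rewrite [RHS]linearZ /= eta_vframe// !scalerA mulrC.
Qed.

Lemma prolong_decomp1 a (z : prolong (A := A) a) : bump_one bp (base a) -> z =
  \sum_i beta t z 0 i *: hframe i a + \sum_i eta c t z 0 i *: vframe i a.
Proof.
move=> Va; have Ca := bump_one_dom Va.
by rewrite -prolong_decomp// bump1// scale1r.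
Qed.

End Local.
End Chart.
End Frames.

(** * Tensoriality and the differential *)

Section SmoothSections.
Context {R : realType} {n r : nat} {M : manifold R n}.
Variable A : lie_algebroid M r.
Local Notation AM := (matlas M).
Local Notation AA := (total_atlas A).
Local Notation C := (Cinf AA).
Implicit Types (X Y Z W : psection A) (f g : C).

Lemma psection_eq X Y : (forall a, X a = Y a) -> X = Y.
Proof. exact: functional_extensionality_dep. Qed.

Definition scal f Z : psection A := fun b => f b *: Z b.
Definition addS Z W : psection A := fun b => Z b + W b.
Definition zeroS : psection A := fun=> 0.

Lemma psmooth_comb f Z W : psmooth Z -> psmooth W -> psmooth (addS (scal f Z) W).
Proof.
move=> [sZ vZ] [sW vW]; split.
  move=> t ht j; have oT := aopen_base (A := A) (aopen_tdom ht).
  apply: (eq_smooth_within oT) (smooth_withinD oT (smooth_withinM oT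
    (smooth_within_sub (subsetT _) (Cinf_smooth f)) (sZ t ht j)) (sW t ht j)) => a _.
  by rewrite /= pfibreP linearP !mxE.
move=> g; have oT := @aopenT _ _ _ AA.
apply: (eq_smooth_within oT) (smooth_withinD oT (smooth_withinM oT
  (Cinf_smooth f) (vZ g)) (vW g)) => a _.
by rewrite panchorE.
Qed.

Lemma psmooth0 : psmooth zeroS.
Proof.
split; first exact: smooth_pullback0.
by move=> g; exact: (smooth_within_cst 0 (@aopenT _ _ _ AA)).
Qed.

Lemma psmooth_scal f Z : psmooth Z -> psmooth (scal f Z).
Proof.
move=> sZ; have := psmooth_comb f sZ psmooth0.
by congr psmooth; apply: psection_eq => a; rewrite /addS addr0.
Qed.

Lemma psmoothD Z W : psmooth Z -> psmooth W -> psmooth (addS Z W).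
Proof.
move=> sZ sW; have := psmooth_comb 1 sZ sW.
by congr psmooth; apply: psection_eq => a; rewrite /addS /scal Cinf1E scale1r.
Qed.

Definition sumS (I : Type) (s : seq I) (F : I -> psection A) : psection A :=
  fun b => \sum_(i <- s) F i b.

Lemma sumS_cons (I : Type) i (s : seq I) (F : I -> psection A) :
  sumS (i :: s) F = addS (F i) (sumS s F).
Proof. by apply: psection_eq => b; rewrite /sumS big_cons. Qed.

Lemma sumS_nil (I : Type) (F : I -> psection A) : sumS [::] F = zeroS.
Proof. by apply: psection_eq => b; rewrite /sumS big_nil. Qed.

Lemma psmooth_sum (I : Type) (s : seq I) (F : I -> psection A) :
  (forall i, psmooth (F i)) -> psmooth (sumS s F).
Proof.
move=> sF; elim: s => [|i s IH]; first by rewrite sumS_nil; exact: psmooth0.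
by rewrite sumS_cons; exact: psmoothD.
Qed.

Definition cstC (k : R) : C := k *: (1 : C).

Lemma cstCE k a : cstC k a = k.
Proof. by rewrite CinfZE Cinf1E mulr1. Qed.

Lemma exists_frame (a : total_space A) : exists c t (hc : charts AM c) (ht : trivs A t)
  (bp : bump_at AM (base a) (cdom c `&` tdom t)), bump_one bp (base a).
Proof.
have [c hc ca] := chart_cover AM (base a); have [t ht ta] := triv_cover A (base a).
have oct : aopen AM (cdom c `&` tdom t) := aopenI (aopen_chart hc) (aopen_tdom ht).
have [bp] := manifold_bumpy oct (conj ca ta).
by exists c, t, hc, ht, bp; exact: bump_one_at.
Qed.

Lemma exists_section a (z : prolong (A := A) a) : exists2 Z, psmooth Z & Z a = z.
Proof.
have [c [t [hc [ht [bp Va]]]]] := exists_frame a.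
exists (addS (sumS (index_enum 'I_r) (fun i => scal (cstC (beta t z 0 i)) (hframe hc ht bp i)))
  (sumS (index_enum 'I_r) (fun i => scal (cstC (eta c t z 0 i)) (vframe bp i)))).
  by apply: psmoothD; apply: psmooth_sum => i; apply: psmooth_scal;
    [exact: hframe_smooth|exact: vframe_smooth].
rewrite [RHS](prolong_decomp1 hc ht z Va) /addS /sumS; congr (_ + _).
  by apply: eq_bigr => i _; rewrite /scal cstCE.
by apply: eq_bigr => i _; rewrite /scal cstCE.
Qed.

Lemma eta_smooth c t Z j : charts AM c -> trivs A t -> psmooth Z ->
  smooth_within AA (cdom (total_chart c t)) (fun a => eta c t (Z a) 0 j).
Proof.
move=> hc ht [_ sZ]; have hC := total_charts_chart hc ht; have oC := aopen_chart hC.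
apply: (eq_smooth_within oC) (tvec_smooth (@total_bumpy _ _ _ _ A) (rshift n j) hC sZ) => a _.
by rewrite /eta [RHS]mxE.
Qed.

Lemma beta_smooth c t Z j : charts AM c -> trivs A t -> psmooth Z ->
  smooth_within AA (cdom (total_chart c t)) (fun a => beta t (Z a) 0 j).
Proof. by move=> hc ht [sZ _]; apply: smooth_within_sub (sZ t ht j) => a []. Qed.

Section Tensorial.
Variables (a : total_space A) (Phi : psection A -> R).
Hypothesis PhiD : forall Z W, psmooth Z -> psmooth W -> Phi (addS Z W) = Phi Z + Phi W.
Hypothesis PhiZ : forall f Z, psmooth Z -> Phi (scal f Z) = f a * Phi Z.

Lemma tensorial0 : Phi zeroS = 0.
Proof.
have -> : zeroS = scal 0 zeroS by apply: psection_eq => b; rewrite /scal scaler0.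
by rewrite (PhiZ _ psmooth0) mul0r.
Qed.

Lemma tensorial_sum (I : Type) (s : seq I) (F : I -> psection A) :
  (forall i, psmooth (F i)) -> Phi (sumS s F) = \sum_(i <- s) Phi (F i).
Proof.
move=> sF; elim: s => [|i s IH]; first by rewrite sumS_nil big_nil tensorial0.
by rewrite sumS_cons big_cons PhiD ?IH//; exact: psmooth_sum.
Qed.

(** Near [a], [Z] is a combination of global frame sections with coefficients vanishing at [a].
    Multiplication by a bump leaves [Phi Z] unchanged and makes this combination valid
    everywhere. *)
Lemma tensorial_eq0 Z : psmooth Z -> Z a = 0 -> Phi Z = 0.
Proof.
move=> sZ Za; have [c [t [hc [ht [bp Va]]]]] := exists_frame a.
have hC := total_charts_chart hc ht; have oC := aopen_chart hC.
have Ca : cdom (total_chart c t) a := bump_one_dom Va.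
have bA := @total_bumpy _ _ _ _ A.
have oV : aopen AA (@base _ _ _ _ A @^-1` bump_one bp).
  by apply: aopen_base; exact: bump_one_open.
have [B {}HB] := choice (fun i => local_extension bA oC Ca (beta_smooth i hc ht sZ)).
have [VB {}HB] := choice HB.
have [E {}HE] := choice (fun i => local_extension bA oC Ca (eta_smooth i hc ht sZ)).
have [VE {}HE] := choice HE.
pose U := (@base _ _ _ _ A @^-1` bump_one bp) `&` [set b | forall i, (VB i `&` VE i) b].
have oU : aopen AA U.
  apply: aopenI => //; apply: aopen_forall => i.
  by apply: aopenI; [have [] := HB i|have [] := HE i].
have Ua : U a by split=> // i; split; [have [] := HB i|have [] := HE i].
have [th] := bA a U oU Ua.
pose TH := to_Cinf AA (bump th).
have THE b : TH b = bump th b by rewrite /TH (to_CinfE (bump_smooth th)).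
have -> : Phi Z = Phi (scal TH Z).
  by rewrite PhiZ// THE bump1 ?mul1r//; exact: bump_one_at.
(* On [bump_zero th] both sides vanish; on [U] the extended coefficients are the true ones. *)
have -> : scal TH Z = addS (sumS (index_enum 'I_r) (fun i => scal (TH * B i) (hframe hc ht bp i)))
    (sumS (index_enum 'I_r) (fun i => scal (TH * E i) (vframe bp i))).
  apply: psection_eq => b; rewrite /scal /addS /sumS.
  have [b0|[Vb VBE]] := bump_cover th b.
    rewrite THE bump0// scale0r !big1 ?addr0// => i _;
    by rewrite CinfME THE bump0// mul0r scale0r.
  rewrite [in LHS](prolong_decomp1 hc ht (Z b) Vb) scalerDr !scaler_sumr; congr (_ + _);
  apply: eq_bigr => i _; rewrite CinfME scalerA; congr (_ * _ *: _); have [Bb Eb] := VBE i.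
    by have [_ _ _ ->] := HB i.
  by have [_ _ _ ->] := HE i.
have sX i : psmooth (scal (TH * B i) (hframe hc ht bp i)) by apply: psmooth_scal; exact: hframe_smooth.
have sV i : psmooth (scal (TH * E i) (vframe bp i)) by apply: psmooth_scal; exact: vframe_smooth.
rewrite PhiD; [|exact: psmooth_sum..].
rewrite !tensorial_sum// !big1 ?addr0// => i _.
  rewrite PhiZ; last exact: vframe_smooth.
  by have [_ Ei _ EE] := HE i; rewrite CinfME EE// Za linear0 mxE mulr0 mul0r.
rewrite PhiZ; last exact: hframe_smooth.
by have [_ Bi _ BB] := HB i; rewrite CinfME BB// Za linear0 mxE mulr0 mul0r.
Qed.

Lemma tensorial_eq Z W : psmooth Z -> psmooth W -> Z a = W a -> Phi Z = Phi W.
Proof.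
move=> sZ sW ZW; have sN : psmooth (scal (-1) W) by exact: psmooth_scal.
have := tensorial_eq0 (psmoothD sZ sN); rewrite PhiD// PhiZ// => H.
apply/eqP; rewrite -subr_eq0 -mulN1r; apply/eqP; apply: H.
by rewrite /addS /scal CinfNE Cinf1E ZW scaleN1r subrr.
Qed.

End Tensorial.
End SmoothSections.

(** * Bracket identities and compatibility of the anchor *)

Section BracketCalculus.
Context {R : realType} {n r : nat} {M : manifold R n}.
Variables (A : lie_algebroid M r) (B : prolongation_bracket A).
Local Notation AA := (total_atlas A).
Local Notation C := (Cinf AA).
Implicit Types (X Y Z W : psection A) (f g : C).

Let PB := pbracketP B.

Definition lie_Cinf X g : C := to_Cinf AA (fun b => panchor (X b) g).

Lemma lie_CinfE X g b : psmooth X -> lie_Cinf X g b = panchor (X b) g.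
Proof. by move=> [_ sX]; rewrite /lie_Cinf (to_CinfE (sX g)). Qed.

Lemma pb_smooth X Y : psmooth X -> psmooth Y -> psmooth (B X Y).
Proof. exact: (br_closed PB). Qed.

Lemma pb_anti X Y : psmooth X -> psmooth Y -> B X Y = scal (-1) (B Y X).
Proof.
move=> sX sY; apply: psection_eq => a; rewrite (br_anti PB sX sY).
by rewrite /scal CinfNE Cinf1E scaleN1r.
Qed.

Lemma pbDr X Y Z : psmooth X -> psmooth Y -> psmooth Z -> B X (addS Y Z) = addS (B X Y) (B X Z).
Proof.
move=> sX sY sZ; apply: psection_eq => a; have := br_linear PB 1 sX sY sZ a.
rewrite scale1r => E; have -> : addS Y Z = (fun b => 1 *: Y b + Z b).
  by apply: psection_eq => b; rewrite scale1r.
exact: E.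
Qed.

Lemma pbZr f X Y : psmooth X -> psmooth Y ->
  B X (scal f Y) = addS (scal f (B X Y)) (scal (lie_Cinf X f) Y).
Proof.
move=> sX sY; apply: psection_eq => a; rewrite (br_leibniz PB f sX sY).
by rewrite /addS /scal lie_CinfE.
Qed.

Lemma lie_Cinf_opp1 X : psmooth X -> lie_Cinf X (-1) = 0.
Proof. by move=> sX; apply: Cinf_eq => b; rewrite lie_CinfE// tangentN tangent1 oppr0. Qed.

Lemma scalN1 Z a : scal (-1) Z a = - Z a.
Proof. by rewrite /scal CinfNE Cinf1E scaleN1r. Qed.

Lemma scal0 Z a : scal 0 Z a = 0.
Proof. by rewrite /scal scale0r. Qed.

Lemma pbNr X Y a : psmooth X -> psmooth Y -> B X (scal (-1) Y) a = - B X Y a.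
Proof. by move=> sX sY; rewrite pbZr// lie_Cinf_opp1// /addS scalN1 scal0 addr0. Qed.

(** Expanding the Jacobi identity for [X], [Y], [scal f Z] by the Leibniz rule leaves the defect of
    this equation times [Z a]. A section with [Z a] nonzero exists unless the fibre is zero, and
    then both sides vanish. *)
Lemma panchor_bracket X Y f a : psmooth X -> psmooth Y ->
  panchor (B X Y a) f = panchor (X a) (lie_Cinf Y f) - panchor (Y a) (lie_Cinf X f).
Proof.
move=> sX sY; have sXY := pb_smooth sX sY.
have [nz|] := pselect (exists z : prolong (A := A) a, z != 0); last first.
  move=> nz; have z0 (z : prolong (A := A) a) : z = 0.
    by apply/eqP/negPn/negP => z0; apply: nz; exists z.
  have Z g : panchor (0 : prolong (A := A) a) g = 0 by [].
  by rewrite (z0 (B X Y a)) (z0 (X a)) (z0 (Y a)) !Z subr0.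
case: nz => z nz; have [Z sZ Za] := exists_section z.
have sfZ := psmooth_scal f sZ.
have [sYZ sXZ] := (pb_smooth sY sZ, pb_smooth sX sZ).
have bracket3 U V : psmooth U -> psmooth V -> B U (B V (scal f Z)) a =
    f a *: B U (B V Z) a + panchor (U a) f *: B V Z a +
    (panchor (V a) f *: B U Z a + panchor (U a) (lie_Cinf V f) *: Z a).
  move=> sU sV; have sVZ := pb_smooth sV sZ.
  rewrite (pbZr f sV sZ) (pbDr sU (psmooth_scal f sVZ) (psmooth_scal (lie_Cinf V f) sZ)).
  by rewrite (pbZr f sU sVZ) (pbZr (lie_Cinf V f) sU sZ) /addS /scal (lie_CinfE f a sU) (lie_CinfE f a sV)
    (lie_CinfE _ a sU).
have e1 := bracket3 _ _ sX sY.
have J := br_jacobi PB sX sY sfZ a.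
have e2 : B Y (B (scal f Z) X) a = - (f a *: B Y (B X Z) a + panchor (Y a) f *: B X Z a +
    (panchor (X a) f *: B Y Z a + panchor (Y a) (lie_Cinf X f) *: Z a)).
  by rewrite -(bracket3 _ _ sY sX) (pb_anti sfZ sX) (pbNr a sY (pb_smooth sX sfZ)).
have e3 : B (scal f Z) (B X Y) a = - (f a *: B (B X Y) Z a + panchor (B X Y a) f *: Z a).
  by rewrite (br_anti PB sfZ sXY) (pbZr f sXY sZ) /addS /scal (lie_CinfE f a sXY).
have J0 := br_jacobi PB sX sY sZ a.
have e4 : B Y (B Z X) a = - B Y (B X Z) a.
  by rewrite (pb_anti sZ sX) (pbNr a sY sXZ).
have e5 : B Z (B X Y) a = - B (B X Y) Z a by rewrite (br_anti PB sZ sXY).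
move: J; rewrite e1 e2 e3.
have J1 : B X (B Y Z) a = B Y (B X Z) a + B (B X Y) Z a.
  by apply/eqP; rewrite -subr_eq0 opprD addrA -e4 -e5 J0.
rewrite J1 Za => J.
have : (panchor (X a) (lie_Cinf Y f) - panchor (Y a) (lie_Cinf X f) - panchor (B X Y a) f) *: z = 0.
  rewrite -[RHS]J !scalerBl scalerDr !opprD.
  (* Terms 1 and 6, 2 and 10, 3 and 8, 4 and 7 are opposite; terms 5, 9 and 11 make up the left-hand
     side. *)
  by rewrite [RHS](AC (((3*2)*(2*2))*2) ((1*6)*(2*10)*(3*8)*(4*7)*(5*9*11))) /= !subrr !add0r.
by move/eqP; rewrite scaler_eq0 (negPf nz) orbF subr_eq0 => /eqP ->.
Qed.

End BracketCalculus.

(** * The differential of a 1-form: existence and closedness *)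

Section Differential.
Context {R : realType} {n r : nat} {M : manifold R n}.
Variables (A : lie_algebroid M r) (B : prolongation_bracket A).
Local Notation AA := (total_atlas A).
Local Notation C := (Cinf AA).
Implicit Types (X Y Z W : psection A) (f g : C).

Let PB := pbracketP B.

Lemma pderivE X (g : total_space A -> R) a : pderiv X g a = panchor (X a) (to_Cinf AA g).
Proof. by []. Qed.

Section OneForm.
Variable zeta : form1 A.

Definition ev1 X : C := to_Cinf AA (fun b => zeta b (X b)).

Lemma ev1E X b : psmooth X -> ev1 X b = zeta b (X b).
Proof. by move=> sX; rewrite /ev1 (to_CinfE (form1_smooth zeta sX)). Qed.

Lemma d1E X Y a : d1 B zeta X Y a =
  panchor (X a) (ev1 Y) - panchor (Y a) (ev1 X) - zeta a (B X Y a).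
Proof. by []. Qed.

Lemma d1_anti X Y a : psmooth X -> psmooth Y -> d1 B zeta X Y a = - d1 B zeta Y X a.
Proof. by move=> sX sY; rewrite !d1E (br_anti PB sX sY) linearN /=; ring. Qed.

Lemma ev1D X Y : psmooth X -> psmooth Y -> ev1 (addS X Y) = ev1 X + ev1 Y.
Proof.
move=> sX sY; apply: Cinf_eq => b; rewrite CinfDE !ev1E//; last exact: psmoothD.
by rewrite linearD.
Qed.

Lemma ev1Z f X : psmooth X -> ev1 (scal f X) = f * ev1 X.
Proof.
move=> sX; apply: Cinf_eq => b; rewrite CinfME !ev1E//; last exact: psmooth_scal.
by rewrite linearZ.
Qed.

Lemma panchorD a (z w : prolong (A := A) a) f : panchor (z + w) f = panchor z f + panchor w f.
Proof. by []. Qed.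

Lemma panchorZ a k (z : prolong (A := A) a) f : panchor (k *: z) f = k * panchor z f.
Proof. by []. Qed.

Lemma addSE X Y a : addS X Y a = X a + Y a. Proof. by []. Qed.
Lemma scalE f X a : scal f X a = f a *: X a. Proof. by []. Qed.

Lemma d1D X Y Z a : psmooth X -> psmooth Y -> psmooth Z ->
  d1 B zeta X (addS Y Z) a = d1 B zeta X Y a + d1 B zeta X Z a.
Proof.
move=> sX sY sZ; rewrite !d1E ev1D// tangentD pbDr// !addSE panchorD [zeta a (_ + _)]linearD.
ring.
Qed.

Lemma d1Z X f Y a : psmooth X -> psmooth Y ->
  d1 B zeta X (scal f Y) a = f a * d1 B zeta X Y a.
Proof.
move=> sX sY; rewrite !d1E ev1Z// tangentM (pbZr _ f sX sY) !addSE !scalE panchorZ (lie_CinfE f a sX) (ev1E a sY).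
rewrite [zeta a (_ + _)]linearD [zeta a (f a *: _)]linearZ [zeta a (panchor _ _ *: _)]linearZ.
change (f a * panchor (X a) (ev1 Y) + zeta a (Y a) * panchor (X a) f
  - f a * panchor (Y a) (ev1 X) - (f a * zeta a (B X Y a) + panchor (X a) f * zeta a (Y a)) =
  f a * (panchor (X a) (ev1 Y) - panchor (Y a) (ev1 X) - zeta a (B X Y a))); ring.
Qed.

Lemma d1_tensorial X X' Y Y' a : psmooth X -> psmooth X' -> psmooth Y -> psmooth Y' ->
  X a = X' a -> Y a = Y' a -> d1 B zeta X Y a = d1 B zeta X' Y' a.
Proof.
move=> sX sX' sY sY' EX EY; have H W : psmooth W -> d1 B zeta W Y a = d1 B zeta W Y' a.
  move=> sW; apply: (@tensorial_eq _ _ _ _ _ a (fun Z => d1 B zeta W Z a)) => // *.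
    exact: d1D.
  exact: d1Z.
have H' W : psmooth W -> d1 B zeta W X a = d1 B zeta W X' a.
  move=> sW; apply: (@tensorial_eq _ _ _ _ _ a (fun Z => d1 B zeta W Z a)) => // *.
    exact: d1D.
  exact: d1Z.
by rewrite H// d1_anti// H'// -d1_anti.
Qed.

(** An arbitrary global section through [z]: by [d1_tensorial] the choice does not affect [d1],
    which thereby becomes a form on the fibres. *)
Definition ext_sec a (z : prolong (A := A) a) : psection A :=
  projT1 (cid2 (exists_section z)).

Lemma ext_sec_smooth a (z : prolong (A := A) a) : psmooth (ext_sec z).
Proof. by rewrite /ext_sec; case: cid2. Qed.

Lemma ext_secE a (z : prolong (A := A) a) : ext_sec z a = z.
Proof. by rewrite /ext_sec; case: cid2. Qed.

Lemma d1_ext X Y a : psmooth X -> psmooth Y ->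
  d1 B zeta (ext_sec (X a)) (ext_sec (Y a)) a = d1 B zeta X Y a.
Proof. by move=> sX sY; apply: d1_tensorial; rewrite ?ext_secE//; exact: ext_sec_smooth. Qed.

Lemma d1_smooth X Y : psmooth X -> psmooth Y -> smooth_within AA setT (d1 B zeta X Y).
Proof.
move=> sX sY; have oT := @aopenT _ _ _ AA.
apply: smooth_withinD => //; last first.
  by apply: smooth_withinN => //; apply: form1_smooth; exact: pb_smooth.
apply: smooth_withinD => //; first exact: (sX.2 (ev1 Y)).
by apply: smooth_withinN => //; exact: (sY.2 (ev1 X)).
Qed.

Lemma exists_differential : exists dzeta : form2 A, is_differential B zeta dzeta.
Proof.
pose F a (z w : prolong (A := A) a) := d1 B zeta (ext_sec z) (ext_sec w) a.
have Fr a (k : R) (z w w' : prolong (A := A) a) : F a z (k *: w + w') = k * F a z w + F a z w'.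
  rewrite /F; have sc := psmooth_scal (cstC A k) (ext_sec_smooth w).
  rewrite (@d1_tensorial _ (ext_sec z) _
    (addS (scal (cstC A k) (ext_sec w)) (ext_sec w')))//; try exact: ext_sec_smooth.
  - by rewrite d1D ?d1Z ?cstCE//; exact: ext_sec_smooth.
  - by apply: psmoothD => //; exact: ext_sec_smooth.
  - by rewrite ext_secE /addS /scal cstCE !ext_secE.
have Fa a (z w : prolong (A := A) a) : F a z w = - F a w z.
  by rewrite /F d1_anti//; exact: ext_sec_smooth.
have Fl a (k : R) (z z' w : prolong (A := A) a) : F a (k *: z + z') w = k * F a z w + F a z' w.
  by rewrite Fa Fr (Fa a z w) (Fa a z' w); ring.
have F0 a (z : prolong (A := A) a) : F a z z = 0 by have := Fa a z z; lra.
have Fs Z W : psmooth Z -> psmooth W ->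
    smooth_within AA setT (fun a => F a (Z a) (W a)).
  move=> sZ sW; have := d1_smooth sZ sW; congr smooth_within.
  by apply/funext => a; rewrite /F d1_ext.
exists (Form2 Fl Fr F0 Fs) => X Y sX sY a /=.
by rewrite /F d1_ext.
Qed.

(** Second derivatives cancel because the anchor respects brackets; the values of [zeta] on double
    brackets cancel by the Jacobi identity. *)
Lemma differential_closed (dzeta : form2 A) : is_differential B zeta dzeta -> closed2 B dzeta.
Proof.
move=> dz X Y Z sX sY sZ a.
have sXY := pb_smooth B sX sY; have sXZ := pb_smooth B sX sZ; have sYZ := pb_smooth B sY sZ.
have ev2 U V : psmooth U -> psmooth V -> to_Cinf AA (fun b => dzeta b (U b) (V b)) =
    lie_Cinf U (ev1 V) - lie_Cinf V (ev1 U) - ev1 (B U V).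
  move=> sU sV; have sUV := pb_smooth B sU sV.
  apply: Cinf_eq => b; rewrite (to_CinfE (form2_smooth dzeta sU sV)) (dz _ _ sU sV) d1E.
  by rewrite CinfDE CinfNE CinfDE CinfNE ev1E// !lie_CinfE.
rewrite /d2 !pderivE !ev2// (dz _ _ sXY sZ) (dz _ _ sXZ sY) (dz _ _ sYZ sX) !d1E.
rewrite !tangentD !tangentN !panchor_bracket//.
have J := br_jacobi PB sX sY sZ a.
have J' : B (B X Y) Z a = B (B X Z) Y a - B (B Y Z) X a.
  rewrite (br_anti PB sXY sZ) (br_anti PB sXZ sY) (br_anti PB sYZ sX) opprK.
  have : B Y (B Z X) a = - B Y (B X Z) a by rewrite (pb_anti B sZ sX) pbNr//.
  move: J => /[swap] ->; move/eqP; rewrite addr_eq0 => /eqP <-.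
  by rewrite addrC.
rewrite J' linearB /=; ring.
Qed.

End OneForm.
End Differential.

(** * The fibrewise primitive *)

Section FibreIntegral.
Context {R : realType} {n r : nat}.
Implicit Types (z : 'rV[R]_(n + r)) (f : 'rV[R]_(n + r) -> R) (U : set 'rV[R]_(n + r)).

Definition dilz (s : R) z : 'rV[R]_(n + r) := row_mx (lsubmx z) (s *: rsubmx z).

(** All real [s] are allowed: the sets in question are cylinders containing whole fibres. *)
Definition dil_closed U := forall z s, U z -> U (dilz s z).

Definition fibre_int f z : R := int01 (fun s => f (dilz s z)).

Definition vdir (v : 'rV[R]_r) : 'rV[R]_(n + r) := row_mx 0 v.

Let phi (w : 'rV[R]_(1 + (n + r))) : 'rV[R]_(n + r) :=
  dilz (w 0 (lshift (n + r) ord0)) (rsubmx w).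

Let phi_slice s z : phi (slice s z) = dilz s z.
Proof. by rewrite /phi /slice row_mxEl mxE row_mxKr. Qed.

Let Ck_phi k j : Ck k setT (fun w => phi w 0 j).
Proof.
case: (split_ordP j) => i ->.
  apply: (eq_Ck openT) (Ck_coord k (rshift 1 (lshift r i)) openT) => w _.
  by rewrite /phi /dilz row_mxEl !mxE.
apply: (eq_Ck openT) (CkM openT (Ck_coord k (lshift (n + r) ord0) openT)
  (Ck_coord k (rshift 1 (rshift n i)) openT)) => w _.
by rewrite /phi /dilz row_mxEr !mxE.
Qed.

Let phi_open U : open U -> open (phi @^-1` U).
Proof.
move=> oU; apply: open_comp => // w _; apply: continuous_row => j.
by have [+ _] := Ck_phi 0 j; apply.
Qed.

Let Ck_comp_phi k U f : open U -> Ck k U f -> Ck k (phi @^-1` U) (f \o phi).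
Proof.
move=> oU cf; apply: (Ck_comp oU (phi_open oU) _ _ cf) => // j.
exact: (Ck_sub (@subsetT _ _) (Ck_phi k j)).
Qed.

Let fibre_intE f z : fibre_int f z = int01 (fun s => (f \o phi) (slice s z)).
Proof. by congr int01; apply/funext => s /=; rewrite phi_slice. Qed.

Lemma fibre_int_smooth U f : open U -> dil_closed U -> smooth_on U f -> smooth_on U (fibre_int f).
Proof.
move=> oU dU sf k.
have UW z : U z -> forall s : R, 0 <= s <= 1 -> (phi @^-1` U) (slice s z).
  by move=> Uz s _; rewrite /= phi_slice; exact: dU.
apply: (eq_Ck oU) (Ck_int01 (phi_open oU) oU (Ck_comp_phi oU (sf k)) UW) => z _.
by rewrite fibre_intE.
Qed.

Lemma cont01_dilz U f z : open U -> dil_closed U -> Ck 0 U f -> U z -> cont01 (fun s => f (dilz s z)).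
Proof.
move=> oU dU cf Uz; have -> : (fun s => f (dilz s z)) = (fun s => (f \o phi) (slice s z)).
  by apply/funext => s /=; rewrite phi_slice.
apply: cont01_slice (Ck_comp_phi oU cf) _ => s _; rewrite /= phi_slice; exact: dU.
Qed.

(** The factor [s] is the derivative of the dilation in a fibre direction. *)
Lemma derive_fibre_int U f z v : open U -> dil_closed U -> Ck 1 U f -> U z ->
  is_derive z (vdir v) (fibre_int f) (int01 (fun s => s * 'D_(vdir v) f (dilz s z))).
Proof.
move=> oU dU cf Uz.
have UW : forall s : R, 0 <= s <= 1 -> (phi @^-1` U) (slice s z).
  by move=> s _; rewrite /= phi_slice; exact: dU.
have D := derive_int01 (vdir v) (phi_open oU) (Ck_comp_phi oU cf) UW.
have -> : fibre_int f = (fun z => int01 (fun s => (f \o phi) (slice s z))).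
  by apply/funext => z'; exact: fibre_intE.
apply: (is_derive_eq D); apply: eq_int01 => s _.
have [_ <-] := derive_scale s (C1_derivable (v := vdir v) cf (dU _ s Uz)).
rewrite /derive.
suff -> : (fun h : R => h^-1 *: (((f \o phi) \o shift (slice s z)) (h *: row_mx 0 (vdir v)) -
      (f \o phi) (slice s z))) =
    (fun h : R => h^-1 *: ((f \o shift (dilz s z)) (h *: (s *: vdir v)) - f (dilz s z))) by [].
apply/funext => h /=; rewrite -slice_line !phi_slice; congr (_ *: (f _ - _)).
rewrite /dilz /vdir !linearD !linearZ /= row_mxKl row_mxKr.
by rewrite !scale_row_mx add_row_mx !scaler0 !add0r !scalerA mulrC.
Qed.

(* The Poincare lemma along the fibres, with the radial homotopy. *)
Lemma fibre_poincare U (g : 'I_r -> 'rV[R]_(n + r) -> R) z k : open U -> dil_closed U ->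
  (forall j, smooth_on U (g j)) -> U z ->
  (forall j s, 'D_(vdir (delta_mx 0 k)) (g j) (dilz s z) =
     'D_(vdir (delta_mx 0 j)) (g k) (dilz s z)) ->
  'D_(vdir (delta_mx 0 k)) (fun z => \sum_j z 0 (rshift n j) * fibre_int (g j) z) z = g k z.
Proof.
move=> oU dU sg Uz sym; set e := vdir (delta_mx 0 k).
have cg j := cont01_dilz oU dU (sg j 0%N) Uz.
have cD j v : cont01 (fun s => 'D_(vdir v) (g j) (dilz s z)).
  exact: (cont01_dilz oU dU (smooth_on_derive _ (sg j) 0%N) Uz).
have csD j v : cont01 (fun s => s * 'D_(vdir v) (g j) (dilz s z)).
  by apply: cont01M (cD j v) => s _; exact: cvg_id.
have D j : is_derive z e (fun z => z 0 (rshift n j) * fibre_int (g j) z)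
    (z 0 (rshift n j) * int01 (fun s => s * 'D_e (g j) (dilz s z)) +
     fibre_int (g j) z * (j == k)%:R).
  have := is_deriveM (is_derive_coord z e (rshift n j))
    (derive_fibre_int (delta_mx 0 k) oU dU (sg j 1%N) Uz).
  by rewrite /e /vdir row_mxEr mxE eqxx /=.
have [_ E] := is_derive_sum (h := fun j z => z 0 (rshift n j) * fibre_int (g j) z) D.
have -> : (fun z => \sum_j z 0 (rshift n j) * fibre_int (g j) z) =
    \sum_j (fun z => z 0 (rshift n j) * fibre_int (g j) z).
  by apply/funext => z'; rewrite fct_sumE.
rewrite {}E big_split /= [X in _ + X](bigD1 k) //= eqxx mulr1.
rewrite [X in _ + (_ + X)]big1 ?addr0 => [|j /negPf ->]; last by rewrite mulr0.
have cS : cont01 (fun s => \sum_j z 0 (rshift n j) * (s * 'D_e (g j) (dilz s z))).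
  by apply: cont01_sum => j; exact: cont01M (@cont01_cst _ _) (csD j _).
have -> : \sum_j z 0 (rshift n j) * int01 (fun s => s * 'D_e (g j) (dilz s z)) =
    int01 (fun s => \sum_j z 0 (rshift n j) * (s * 'D_e (g j) (dilz s z))).
  rewrite int01_sum => [|j]; last exact: cont01M (@cont01_cst _ _) (csD j _).
  by apply: eq_bigr => j _; rewrite int01Z//; exact: csD.
rewrite -int01D//.
pose y : 'rV[R]_(n + r) := vdir (rsubmx z); pose z0 : 'rV[R]_(n + r) := row_mx (lsubmx z) 0.
have dE s : dilz s z = s *: y + z0.
  by rewrite /dilz /y /vdir /z0 scale_row_mx add_row_mx scaler0 add0r addr0.
have L s : 'D_y (g k) (dilz s z) = \sum_j z 0 (rshift n j) * 'D_(vdir (delta_mx 0 j)) (g k) (dilz s z).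
  have c1 := sg k 1%N; have Us := dU _ s Uz.
  rewrite (C1_derive_sum _ oU c1 Us) big_split_ord /= big1 ?add0r => [|j _].
    apply: eq_bigr => j _; rewrite [y 0 _]row_mxEr mxE.
    suff -> : delta_mx 0 (rshift n j) = vdir (delta_mx 0 j) by [].
    apply/rowP => l; case: (split_ordP l) => i ->.
      by rewrite /vdir row_mxEl mxE mxE eq_lrshift andbF.
    by rewrite /vdir row_mxEr !mxE eq_rshift.
  by rewrite /y /vdir row_mxEl mxE mul0r.
(* The integrand is the derivative of [s * g k (dilz s z)]: the symmetry hypothesis turns the sum of
   the ['D_e (g j)] into the radial derivative ['D_y (g k)]. *)
transitivity (1 * g k (dilz 1 z) - 0 * g k (dilz 0 z)); last first.
  by rewrite mul1r mul0r subr0 /dilz scale1r hsubmxK.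
apply: (int01_derive (G := fun s => s * g k (dilz s z))) => [|s _]; first exact: cont01D cS (cg k).
have -> : (fun s => s * g k (dilz s z)) = (id : R -> R) * (fun s => g k (s *: y + z0)).
  by apply/funext => s'; rewrite dE.
have ds : derivable (g k) (s *: y + z0) y.
  by rewrite -dE; exact: C1_derivable (sg k 1%N) (dU _ s Uz).
apply: (is_derive_eq (is_deriveM (is_derive_id s 1) (is_derive_line ds))).
rewrite -dE L; change (s * (\sum_j z 0 (rshift n j) * 'D_(vdir (delta_mx 0 j)) (g k) (dilz s z)) +
  g k (dilz s z) * 1 = \sum_j z 0 (rshift n j) * (s * 'D_e (g j) (dilz s z)) + g k (dilz s z)).
rewrite mulr1 big_distrr /=; congr (_ + _); apply: eq_bigr => j _.
by rewrite sym mulrCA.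
Qed.

End FibreIntegral.

Section FormAlgebra.
Context {R : realType} {n r : nat} {M : manifold R n}.
Variable (A : lie_algebroid M r) (Omega : form2 A).

Lemma form2Dl a (z z' w : prolong (A := A) a) : Omega a (z + z') w = Omega a z w + Omega a z' w.
Proof. by have := form2_linear Omega 1 z z' w; rewrite scale1r mul1r. Qed.

Lemma form2_anti a (z w : prolong (A := A) a) : Omega a z w = - Omega a w z.
Proof.
have := form2_alt Omega (z + w); have D := form2_linearr Omega 1.
have Dr x y y' : Omega a x (y + y') = Omega a x y + Omega a x y'.
  by have := form2_linearr Omega 1 x y y'; rewrite scale1r mul1r.
rewrite form2Dl !Dr !form2_alt add0r addr0 => /eqP.
by rewrite addr_eq0 => /eqP.
Qed.

Lemma form20l a (w : prolong (A := A) a) : Omega a 0 w = 0.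
Proof. by have := form2Dl (0 : prolong a) 0 w; rewrite addr0; lra. Qed.

Lemma form2Zl a (k : R) (z w : prolong (A := A) a) : Omega a (k *: z) w = k * Omega a z w.
Proof. by rewrite -[k *: z]addr0 form2_linear form20l addr0. Qed.

Lemma form2Dr a (z w w' : prolong (A := A) a) : Omega a z (w + w') = Omega a z w + Omega a z w'.
Proof. by rewrite form2_anti form2Dl opprD -!form2_anti. Qed.

Lemma form2_suml a (I : Type) (s : seq I) (k : I -> R) (z : I -> prolong (A := A) a) w :
  Omega a (\sum_(i <- s) k i *: z i) w = \sum_(i <- s) k i * Omega a (z i) w.
Proof.
elim: s => [|i s IH]; first by rewrite !big_nil form20l.
by rewrite !big_cons form2Dl form2Zl IH.
Qed.

Lemma form2_sumr a (I : Type) (s : seq I) (k : I -> R) (z : I -> prolong (A := A) a) w :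
  Omega a w (\sum_(i <- s) k i *: z i) = \sum_(i <- s) k i * Omega a w (z i).
Proof.
rewrite form2_anti form2_suml -sumrN; apply: eq_bigr => i _.
by rewrite -mulrN -form2_anti.
Qed.

End FormAlgebra.

Section Primitive.
Context {R : realType} {n r : nat} {M : manifold R n}.
Variable (A : lie_algebroid M r) (Omega : form2 A).
Hypothesis Overt : vanishes_on_vertical Omega.
Local Notation AM := (matlas M).
Local Notation AA := (total_atlas A).

Lemma exists_lift a (b : A (base a)) : exists z : prolong (A := A) a, pfibre z = b.
Proof.
have [c [t [hc [ht [bp Va]]]]] := exists_frame (A := A) a.
by exists (phor hc ht (bump_one_dom Va) b).
Qed.

(** Any choice will do: two lifts of [b] differ by a vertical element, which pairs to 0 with
    vertical elements under [Omega]. *)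
Definition lift a (b : A (base a)) : prolong (A := A) a := projT1 (cid (exists_lift b)).

Lemma liftE a (b : A (base a)) : pfibre (lift b) = b.
Proof. by rewrite /lift; case: cid. Qed.

Definition dil (a : total_space A) (s : R) : total_space A := vec (s *: projT2 a).

(** The vertical argument is the velocity of the curve [s |-> s a]. This is the radial homotopy
    operator on the fibre, applied to the 1-form [Omega( . , z)] with the [A]-component of [z] as a
    parameter. *)
Definition zeta_fun a (z : prolong (A := A) a) : R :=
  int01 (fun s => Omega (dil a s) (@pvert _ _ _ _ A (dil a s) (projT2 a))
    (@lift (dil a s) (pfibre z))).

Section Chart.
Variables (c : chart (R := R) M n) (t : trivialization A r).
Hypotheses (hc : charts AM c) (ht : trivs A t).
Let C := total_chart c t.
Let hC : charts AA C. Proof. exact: total_charts_chart. Qed.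
Variables (x0 : M) (bp : bump_at AM x0 (cdom c `&` tdom t)).
Local Notation X := (hframe hc ht bp).
Local Notation V := (vframe bp).

Definition gram j i : Cinf AA := to_Cinf AA (fun a => Omega a (V j a) (X i a)).

Lemma gramE j i a : gram j i a = Omega a (V j a) (X i a).
Proof. by rewrite (to_CinfE (form2_smooth Omega (vframe_smooth ht bp j) (hframe_smooth hc ht bp i))). Qed.

Lemma vertical_beta a (z : prolong (A := A) a) : vertical z -> beta t z = 0.
Proof. by rewrite /beta => ->; rewrite linear0. Qed.

Lemma vframe_vertical j a : vertical (V j a). Proof. by []. Qed.

Lemma Omega_vert a (v z : prolong (A := A) a) : bump_one bp (base a) -> vertical v ->
  Omega a v z = \sum_i beta t z 0 i * \sum_j eta c t v 0 j * gram j i a.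
Proof.
move=> Va vv; rewrite {1}(prolong_decomp1 hc ht z Va) form2Dr [X in _ + X]form2_sumr.
rewrite [X in _ + X]big1 ?addr0 => [|i _]; last by rewrite Overt ?mulr0.
rewrite form2_sumr; apply: eq_bigr => i _; congr (_ * _).
rewrite {1}(prolong_decomp1 hc ht v Va) (vertical_beta vv).
rewrite [X in Omega a (X + _)]big1 ?add0r => [|j _]; last by rewrite mxE scale0r.
by rewrite form2_suml; apply: eq_bigr => j _; rewrite gramE.
Qed.

Let U := cimage C (cdom C).
Let oU : open U. Proof. exact: (cimage_open hC hC). Qed.

Lemma UE z : U z <-> cimage c (cdom c `&` tdom t) (lsubmx z).
Proof.
have -> : U = lsubmx @^-1` cimage c (cdom c `&` tdom t); last by [].
rewrite /U (_ : cdom C = @base _ _ _ _ A @^-1` (cdom c `&` tdom t)) //.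
rewrite cimage_total//; apply/seteqP; split=> u /= [x [cx tx] <-].
  by exists x => //; split=> //; case: tx.
by exists x => //; split=> //; split=> //; case: tx.
Qed.

Lemma dil_closedU : dil_closed U.
Proof. by move=> z s; rewrite !UE /dilz row_mxKl. Qed.

Lemma coord_dil a s : coord C (dil a s) = dilz s (coord C a).
Proof. by rewrite /= /dilz row_mxKl row_mxKr linearZ. Qed.

Definition gram_chart j i : 'rV[R]_(n + r) -> R := gram j i \o param C.

Lemma gram_chart_smooth j i : smooth_on U (gram_chart j i). Proof. exact: cinf_chart. Qed.

Lemma gram_chart_dil j i a s : cdom C a -> gram_chart j i (dilz s (coord C a)) = gram j i (dil a s).
Proof. by move=> Ca; rewrite -coord_dil /gram_chart [LHS]/comp (coordK hC). Qed.

Definition zeta_chart i (z : 'rV[R]_(n + r)) : R := \sum_j z 0 (rshift n j) * fibre_int (gram_chart j i) z.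

Lemma zeta_chart_smooth i : smooth_on U (zeta_chart i).
Proof.
move=> k; apply: Ck_sum => // j; apply: CkM => //; first exact: Ck_coord.
exact: (fibre_int_smooth oU dil_closedU (gram_chart_smooth j i)).
Qed.

(** Linearity in [z], which the arbitrary [lift] hides, and smoothness are both read off from this
    coordinate form. *)
Lemma zeta_local a (z : prolong (A := A) a) : bump_one bp (base a) ->
  zeta_fun z = \sum_i beta t z 0 i * zeta_chart i (coord C a).
Proof.
move=> Va; have Ca : cdom C a := bump_one_dom Va.
have Uca : U (coord C a) by exact: cimage_mem.
have cG j i : cont01 (fun s => gram_chart j i (dilz s (coord C a))).
  exact: (cont01_dilz oU dil_closedU (gram_chart_smooth j i 0%N) Uca).
have cyG j i : cont01 (fun s => coord C a 0 (rshift n j) * gram_chart j i (dilz s (coord C a))).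
  exact: cont01M (@cont01_cst _ _) (cG j i).
have cS i : cont01 (fun s => \sum_j coord C a 0 (rshift n j) * gram_chart j i (dilz s (coord C a))).
  by apply: cont01_sum => j; exact: cyG.
rewrite /zeta_fun (@eq_int01 _ _ (fun s => \sum_i beta t z 0 i *
    \sum_j coord C a 0 (rshift n j) * gram_chart j i (dilz s (coord C a)))).
  rewrite int01_sum => [|i]; last exact: cont01M (@cont01_cst _ _) (cS i).
  apply: eq_bigr => i _; rewrite int01Z//; congr (_ * _).
  rewrite int01_sum//; apply: eq_bigr => j _; exact: int01Z.
move=> s _; rewrite Omega_vert//; apply: eq_bigr => i _; congr (_ * _).
  by rewrite /beta liftE.
apply: eq_bigr => j _; rewrite (eta_pvert hc ht)// gram_chart_dil//; congr (_ * _).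
by rewrite /= row_mxEr.
Qed.

End Chart.
End Primitive.

(** * The primitive as a horizontal form, and its differential *)

Section PrimitiveForm.
Context {R : realType} {n r : nat} {M : manifold R n}.
Variable (A : lie_algebroid M r) (Omega : form2 A).
Hypothesis Overt : vanishes_on_vertical Omega.
Local Notation AM := (matlas M).
Local Notation AA := (total_atlas A).

Fact zeta_linear a (k : R) (z w : prolong (A := A) a) :
  zeta_fun Omega (k *: z + w) = k * zeta_fun Omega z + zeta_fun Omega w.
Proof.
have [c [t [hc [ht [bp Va]]]]] := exists_frame a.
rewrite !(zeta_local Overt hc ht _ Va) betaP big_distrr -big_split /=.
by apply: eq_bigr => i _; rewrite !mxE; ring.
Qed.

HB.instance Definition _ a :=
  GRing.isLinear.Build R (prolong (A := A) a) R^o _ (@zeta_fun _ _ _ _ A Omega a) (@zeta_linear a).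

Fact zeta_smooth (Z : psection A) : psmooth Z ->
  smooth_within AA setT (fun a => zeta_fun Omega (Z a)).
Proof.
move=> sZ; apply: smooth_within_local => a _.
have [c [t [hc [ht [bp Va]]]]] := exists_frame a.
have hC := total_charts_chart hc ht.
set C := total_chart c t; pose W := @base _ _ _ _ A @^-1` bump_one bp.
have oW : aopen AA W by apply: aopen_base; exact: bump_one_open.
have WC : W `<=` cdom C by move=> b; exact: bump_one_dom.
exists W; split=> //.
apply: (eq_smooth_within oW (f := fun a => \sum_i beta t (Z a) 0 i *
    (zeta_chart Omega hc ht bp i \o coord C) a)).
  by move=> b Vb; rewrite (zeta_local Overt hc ht _ Vb).
apply: smooth_within_sum => // i; apply: smooth_withinM => //.
  exact: smooth_within_sub WC (beta_smooth i hc ht sZ).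
apply: (smooth_within_coord hC oW WC _ (zeta_chart_smooth Omega hc ht bp i)) => b /WC.
exact: cimage_mem.
Qed.

Definition zeta : form1 A :=
  @Form1 _ _ _ _ A (fun a => @zeta_fun _ _ _ _ A Omega a : {linear prolong a -> R^o}) zeta_smooth.

Lemma zeta_vertical a (z : prolong (A := A) a) : vertical z -> zeta a z = 0.
Proof.
move=> vz; have [c [t [hc [ht [bp Va]]]]] := exists_frame a.
rewrite [LHS](zeta_local Overt hc ht _ Va) (vertical_beta t vz) big1// => i _.
by rewrite mxE mul0r.
Qed.

Lemma zeta_horizontal : horizontal1 zeta.
Proof. by move=> Z [_ vZ] a; exact: zeta_vertical. Qed.

Section Closed.
Variable B : prolongation_bracket A.
Hypothesis Oclosed : closed2 B Omega.

Lemma bracket00 (s : forall x, A x) x : smooth_section s -> bracket (l := A) (fun=> 0) s x = 0.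
Proof.
move=> ss; have s0 : smooth_section (A := A) (fun=> 0).
  by have [_ + _] := vert_section_projectable ss.
rewrite (br_anti (bracketP A))//.
(* With [k = 1] and zero sections, linearity reads [b = b + b]. *)
have := br_linear (bracketP A) 1 ss s0 s0 x.
have -> : (fun b : M => 1 *: (0 : A b) + 0) = (fun b => 0 : A b).
  by apply: functional_extensionality_dep => b; rewrite scaler0 addr0.
rewrite scale1r => /eqP; rewrite -subr_eq0 opprD addNKr => /eqP /eqP.
by rewrite oppr_eq0 => /eqP ->; rewrite oppr0.
Qed.

(** The bracket projects onto the bracket of the zero section with [s], which is 0. *)
Lemma bracket_vertical (Z1 Z2 : psection A) s a : projectable Z1 (fun=> 0) -> projectable Z2 s ->
  vertical (B Z1 Z2 a).
Proof.
move=> p1 p2; have [+ _] := pbracket_proj B p1 p2 a.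
by rewrite /vertical => ->; apply: bracket00; case: p2.
Qed.

Section Chart.
Variables (c : chart (R := R) M n) (t : trivialization A r).
Hypotheses (hc : charts AM c) (ht : trivs A t).
Let C := total_chart c t.
Let hC : charts AA C. Proof. exact: total_charts_chart. Qed.
Let bA : bumpy AA. Proof. exact: total_bumpy. Qed.
Variables (x0 : M) (bp : bump_at AM x0 (cdom c `&` tdom t)).
Local Notation X := (hframe hc ht bp).
Local Notation V := (vframe bp).
Local Notation G := (gram Omega hc ht bp).
Local Notation GH := (gram_chart Omega hc ht bp).

Let W := @base _ _ _ _ A @^-1` bump_one bp.
Let oW : aopen AA W. Proof. by apply: aopen_base; exact: bump_one_open. Qed.

Lemma tvec_vframe j a : W a -> tvec C (panchor (V j a)) = vdir (n := n) (delta_mx 0 j).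
Proof.
move=> Wa; have Ca : cdom C a := bump_one_dom Wa.
rewrite [LHS](tvec_vlift _ hc ht Ca) tcoord_lframe//; last by case: Ca.
by rewrite bump1// scale1r.
Qed.

Lemma vframe_derive j a f : W a ->
  panchor (V j a) f = 'D_(vdir (delta_mx 0 j)) (f \o param C) (coord C a).
Proof. by move=> Wa; rewrite (tvecE bA _ f hC (bump_one_dom Wa)) tvec_vframe. Qed.

(** Over [bump_one bp] the chart coordinates of each [V i] are constant, hence killed by every
    tangent vector, so the tangent part of the bracket is 0; its [A]-component is 0 by
    [bracket_vertical]. *)
Lemma bracket_VV j k a : W a -> B (V j) (V k) a = 0.
Proof.
move=> Wa; have Ca : cdom C a := bump_one_dom Wa.
have [sVj sVk] := (vframe_smooth ht bp j, vframe_smooth ht bp k).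
apply: (prolong_ext hc ht Ca); rewrite [RHS]linear0.
  by apply: vertical_beta; apply: bracket_vertical; exact: vframe_projectable.
apply/rowP => l; rewrite /eta mxE [LHS]mxE [RHS]mxE panchor_bracket//.
have lc (i : 'I_r) Y : psmooth (V i) -> panchor (Y : prolong (A := A) a) (lie_Cinf (V i) (lcoord C a (rshift n l))) = 0.
  move=> sV; have [V' [oV' Va' GE]] := lcoordP bA (rshift n l) hC Ca.
  have -> : panchor Y (lie_Cinf (V i) (lcoord C a (rshift n l))) =
      panchor Y (cstC A (vdir (n := n) (delta_mx 0 i) 0 (rshift n l))).
    apply: (tangent_local bA _ (aopenI oV' oW)) => // b [Vb Wb].
    have E := @tvec_lcoord _ _ _ _ bA C b (panchor (V i b)) (rshift n l) _ hC (bump_one_dom Wb).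
    by rewrite lie_CinfE// cstCE E; [rewrite tvec_vframe|exists V'].
  by rewrite tangentZ tangent1 mulr0.
by rewrite !lc// subr0.
Qed.

Lemma gram_sym j k i a : W a -> panchor (V j a) (G k i) = panchor (V k a) (G j i).
Proof.
move=> Wa; have [sVj sVk sX] := And3 (vframe_smooth ht bp j) (vframe_smooth ht bp k) (hframe_smooth hc ht bp i).
have := Oclosed sVj sVk sX a; rewrite /d2 !pderivE.
have -> : to_Cinf AA (fun b => Omega b (V j b) (V k b)) = 0.
  apply: Cinf_eq => b; rewrite (to_CinfE (form2_smooth Omega sVj sVk)).
  by rewrite Overt.
rewrite tangent0 bracket_VV// form20l.
have vb l : vertical (B (V l) (X i) a).
  by apply: (bracket_vertical _ (vframe_projectable ht bp l) (hframe_projectable hc ht bp i)).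
by rewrite !Overt// addr0 !subr0 addr0 => /eqP; rewrite subr_eq0 => /eqP.
Qed.

(** Over [bump_one bp], where the cut-off is 1, [zeta] evaluated on [X i] is [zeta_chart] in
    coordinates: the radial primitive of the fibrewise 1-form with coefficients [G j i]. *)
Lemma ev1_zeta_X k i a : W a -> panchor (V k a) (ev1 zeta (X i)) = Omega a (V k a) (X i a).
Proof.
move=> Wa; have Ca : cdom C a := bump_one_dom Wa; have sX := hframe_smooth hc ht bp i.
have Uca : cimage C (cdom C) (coord C a) by exact: cimage_mem.
rewrite -(gramE Omega hc ht) vframe_derive//.
have -> : 'D_(vdir (delta_mx 0 k)) (ev1 zeta (X i) \o param C) (coord C a) =
    'D_(vdir (delta_mx 0 k)) (zeta_chart Omega hc ht bp i) (coord C a).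
  have nW : nbhs (coord C a) (cimage C W).
    by apply: open_nbhs_nbhs; split; [exact: oW|exists a].
  apply: near_eq_derive; apply: filterS nW => _ [b [Cb Wb] <-].
  rewrite [LHS]/comp (coordK hC Cb) ev1E// [LHS](zeta_local Overt hc ht _ Wb).
  rewrite (beta_hframe hc ht bp i Cb) bump1// scale1r (bigD1 i)//= mxE !eqxx mul1r.
  by rewrite big1 ?addr0// => l /negPf li; rewrite mxE li andbF mul0r.
rewrite (fibre_poincare (cimage_open hC hC) (dil_closedU ht) (fun j => gram_chart_smooth Omega hc ht bp j i) Uca).
  by rewrite /gram_chart /comp (coordK hC Ca).
(* [W] is a preimage of a subset of [M], so it contains [dil a s] for every [s] and the symmetry
   holds along the whole ray. *)
by move=> j s; rewrite -coord_dil -!vframe_derive// gram_sym.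
Qed.

(** Of the three Koszul terms only the derivative of [zeta] on [X i] along [V k] survives: in the
    other two [zeta] is evaluated on vertical elements. *)
Lemma dzeta_VX (dz : form2 A) k i a : is_differential B zeta dz -> W a ->
  dz a (V k a) (X i a) = Omega a (V k a) (X i a).
Proof.
move=> dzP Wa; have [sV sX] := (vframe_smooth ht bp k, hframe_smooth hc ht bp i).
rewrite dzP// d1E ev1_zeta_X//.
have -> : ev1 zeta (V k) = 0.
  by apply: Cinf_eq => b; rewrite ev1E//; exact: zeta_vertical.
rewrite tangent0 subr0 zeta_vertical ?subr0//.
exact: (bracket_vertical _ (vframe_projectable ht bp k) (hframe_projectable hc ht bp i)).
Qed.

Lemma dzeta_VV (dz : form2 A) k j a : is_differential B zeta dz -> W a ->
  dz a (V k a) (V j a) = 0.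
Proof.
move=> dzP Wa; have sV l := vframe_smooth ht bp l.
have e0 l : ev1 zeta (V l) = 0.
  by apply: Cinf_eq => b; rewrite ev1E//; exact: zeta_vertical.
rewrite dzP// d1E !e0 !tangent0 bracket_VV// linear0; ring.
Qed.

End Chart.

Lemma dzeta_vertical (dz : form2 A) a (v w : prolong (A := A) a) : is_differential B zeta dz ->
  vertical v -> dz a v w = Omega a v w.
Proof.
move=> dzP vv; have [c [t [hc [ht [bp Va]]]]] := exists_frame a.
have -> : v = \sum_i eta c t v 0 i *: vframe bp i a.
  rewrite {1}(prolong_decomp1 hc ht v Va) (vertical_beta t vv).
  by rewrite [X in X + _]big1 ?add0r// => j _; rewrite mxE scale0r.
rewrite !form2_suml; apply: eq_bigr => k _; congr (_ * _).
rewrite (prolong_decomp1 hc ht w Va) !form2Dr !form2_sumr; congr (_ + _).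
  by apply: eq_bigr => i _; rewrite dzeta_VX.
by apply: eq_bigr => j _; rewrite dzeta_VV// Overt// vframe_vertical.
Qed.

End Closed.
End PrimitiveForm.

(** * Rank *)

Section Rank.
Context {R : realType} {n r : nat} {M : manifold R n}.
Variable (A : lie_algebroid M r).
Local Notation AM := (matlas M).

Section Kernel.
Variables Omega dz : form2 A.
Hypotheses (Overt : vanishes_on_vertical Omega) (Ond : nondegenerate Omega).
Hypothesis dzO : forall a (v w : prolong (A := A) a), vertical v -> dz a v w = Omega a v w.

(** The uniqueness half of [nondegenerate], at the zero functional. *)
Lemma nondegenerate0 a (z : prolong (A := A) a) : (forall w, Omega a z w = 0) -> z = 0.
Proof.
move=> z0; have [z' [_ uz]] := Ond (\0 : {linear prolong (A := A) a -> R^o}).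
have E1 : z' = z by apply: uz => w; rewrite z0.
have E2 : z' = 0 by apply: uz => w; rewrite form20l.
by rewrite -E1 E2.
Qed.

(* The vertical subspace is its own [Omega]-orthogonal: the pairing matrix between vertical
   and horizontal frames is square and, [Omega] being nondegenerate, invertible. *)
Lemma vertical_lagrangian a (z : prolong (A := A) a) :
  (forall v, vertical v -> Omega a v z = 0) -> vertical z.
Proof.
move=> zV; have [c [t [hc [ht [bp Va]]]]] := exists_frame a.
have Ca := bump_one_dom Va.
pose G := \matrix_(j, i) Omega a (vframe bp j a) (hframe hc ht bp i a).
have VX (u : 'rV[R]_r) w : Omega a (\sum_j u 0 j *: vframe bp j a) w = (beta t w *m (u *m G)^T) 0 0.
  rewrite form2_suml mxE.
  transitivity (\sum_j \sum_i u 0 j * (beta t w 0 i * G j i)).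
    apply: eq_bigr => j _; rewrite -mulr_sumr; congr (_ * _).
    rewrite {1}(prolong_decomp1 hc ht w Va) form2Dr !form2_sumr [X in _ + X]big1.
      by rewrite addr0; apply: eq_bigr => i _; rewrite [G _ _]mxE.
    by move=> i _; rewrite Overt ?mulr0.
  rewrite exchange_big; apply: eq_bigr => i _ /=.
  rewrite [X in _ = _ * X]mxE [X in _ = _ * X]mxE mulr_sumr; apply: eq_bigr => j _ /=.
  by rewrite mulrCA.
(* A row [u] in the left kernel gives a vertical element that is orthogonal to the horizontal frame
   by [uG] and to the vertical one by [Overt], hence zero. *)
have Gu : G \in unitmx.
  rewrite -row_free_unit; apply: inj_row_free => u uG.
  have u0 : \sum_j u 0 j *: vframe bp j a = 0.
    by apply: nondegenerate0 => w; rewrite VX uG trmx0 mulmx0 mxE.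
  have := congr1 (fun z => eta c t z) u0; rewrite linear0 linear_sum /=.
  move=> <-; rewrite [LHS]row_sum_delta; apply: eq_bigr => j _.
  by rewrite linearZ /= (eta_vframe hc ht)// bump1// scale1r.
have bG : beta t z *m G^T = 0.
  apply/rowP => j; have := VX (delta_mx 0 j) z.
  rewrite zV; last first.
    rewrite /vertical; have -> : \sum_j0 (delta_mx 0 j : 'rV[R]_r) 0 j0 *: vframe bp j0 a = vframe bp j a.
      rewrite (bigD1 j)//= mxE !eqxx scale1r big1 ?addr0// => l /negPf lj.
      by rewrite mxE lj andbF scale0r.
    by [].
  rewrite trmx_mul trmx_delta mulmxA => E; rewrite [RHS]mxE E.
  by rewrite -colE [RHS]mxE.
have : beta t z = 0.
  have := congr1 (mulmx^~ (invmx G^T)) bG; rewrite mul0mx.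
  by rewrite mulmxK ?unitmx_tr.
rewrite /beta /vertical => b0; apply: (can_inj (tcoordK ht Ca.2)).
by rewrite b0 linear0.
Qed.

(** An element of the kernel is [Omega]-orthogonal to all vertical ones, hence vertical; but then
    [dz] and [Omega] agree on it, and [Omega] is nondegenerate. *)
Lemma dz_kernel a (z : prolong (A := A) a) : (forall w, dz a z w = 0) -> z = 0.
Proof.
move=> z0; have vz : vertical z.
  apply: vertical_lagrangian => v vv.
  by rewrite -dzO// form2_anti z0 oppr0.
by apply: nondegenerate0 => w; rewrite -dzO.
Qed.

End Kernel.

(** The horizontal and vertical frames together form a basis of [2r] elements, whose images span the
    image and, the kernel being zero, remain independent. *)
Lemma has_rank_of_kernel (dz : form2 A) :
  (forall a (z : prolong (A := A) a), (forall w, dz a z w = 0) -> z = 0) ->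
  has_rank dz (2 * r)%N.
Proof.
move=> ker; rewrite mul2n -addnn => a.
have [c [t [hc [ht [bp Va]]]]] := exists_frame a; have Ca := bump_one_dom Va.
pose e (j : 'I_(r + r)) : prolong (A := A) a :=
  match fintype.split j with inl i => hframe hc ht bp i a | inr i => vframe bp i a end.
have el i : e (lshift r i) = hframe hc ht bp i a by rewrite /e (unsplitK (inl i)).
have er i : e (rshift r i) = vframe bp i a by rewrite /e (unsplitK (inr i)).
have esum x : \sum_j x j *: e j =
    \sum_i x (lshift r i) *: hframe hc ht bp i a + \sum_i x (rshift r i) *: vframe bp i a.
  by rewrite big_split_ord; congr (_ + _); apply: eq_bigr => i _; rewrite ?el ?er.
exists e; split=> [x x0 j|z].
  have {}x0 : \sum_j x j *: e j = 0.
    by apply: ker => w; rewrite form2_suml.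
  rewrite esum in x0.
  have bx : \row_i x (lshift r i) = 0.
    have := congr1 (fun z => beta t z) x0; rewrite linear0 linearD /= !linear_sum /=.
    rewrite [X in _ + X]big1 ?addr0 => [<-|i _]; last by rewrite linearZ /= beta_vframe scaler0.
    rewrite [LHS]row_sum_delta; apply: eq_bigr => i _.
    by rewrite linearZ /= (beta_hframe hc ht)// bump1// scale1r mxE.
  have ex : \row_i x (rshift r i) = 0.
    have := congr1 (fun z => eta c t z) x0; rewrite linear0 linearD /= !linear_sum /=.
    rewrite [X in X + _]big1 ?add0r => [<-|i _]; last by rewrite linearZ /= eta_hframe// scaler0.
    rewrite [LHS]row_sum_delta; apply: eq_bigr => i _.
    by rewrite linearZ /= (eta_vframe hc ht)// bump1// scale1r mxE.
  case: (split_ordP j) => i ->.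
    by have /rowP/(_ i) := bx; rewrite !mxE.
  by have /rowP/(_ i) := ex; rewrite !mxE.
exists (fun j => match fintype.split j with inl i => beta t z 0 i | inr i => eta c t z 0 i end) => w.
rewrite -form2_suml esum {1}(prolong_decomp1 hc ht z Va); congr (dz a (_ + _) w).
  by apply: eq_bigr => i _; rewrite (unsplitK (inl i)).
by apply: eq_bigr => i _; rewrite (unsplitK (inr i)).
Qed.

End Rank.

(** * Differences of 2-forms and the decomposition *)

Section Difference.
Context {R : realType} {n r : nat} {M : manifold R n}.
Variables (A : lie_algebroid M r) (Omega Psi : form2 A).

Fact form2B_linear a (k : R) (z z' w : prolong (A := A) a) :
  Omega a (k *: z + z') w - Psi a (k *: z + z') w =
  k * (Omega a z w - Psi a z w) + (Omega a z' w - Psi a z' w).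
Proof. by rewrite !form2_linear; ring. Qed.

Fact form2B_linearr a (k : R) (z w w' : prolong (A := A) a) :
  Omega a z (k *: w + w') - Psi a z (k *: w + w') =
  k * (Omega a z w - Psi a z w) + (Omega a z w' - Psi a z w').
Proof. by rewrite !form2_linearr; ring. Qed.

Fact form2B_alt a (z : prolong (A := A) a) : Omega a z z - Psi a z z = 0.
Proof. by rewrite !form2_alt subr0. Qed.

Fact form2B_smooth Z W : psmooth Z -> psmooth W ->
  smooth_within (total_atlas A) setT (fun a => Omega a (Z a) (W a) - Psi a (Z a) (W a)).
Proof.
move=> sZ sW; apply: smooth_withinD (@aopenT _ _ _ _) (form2_smooth Omega sZ sW) _.
exact: smooth_withinN (@aopenT _ _ _ _) (form2_smooth Psi sZ sW).
Qed.

Definition form2B : form2 A := Form2 form2B_linear form2B_linearr form2B_alt form2B_smooth.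

Lemma form2B_closed (B : prolongation_bracket A) :
  closed2 B Omega -> closed2 B Psi -> closed2 B form2B.
Proof.
move=> cO cP X Y Z sX sY sZ a; have := cO X Y Z sX sY sZ a; have := cP X Y Z sX sY sZ a.
rewrite /d2 !pderivE.
have E U W : psmooth U -> psmooth W -> to_Cinf (total_atlas A) (fun b => form2B b (U b) (W b)) =
    to_Cinf (total_atlas A) (fun b => Omega b (U b) (W b)) -
    to_Cinf (total_atlas A) (fun b => Psi b (U b) (W b)).
  move=> sU sW; apply: Cinf_eq => b; rewrite CinfDE CinfNE.
  by rewrite !to_CinfE//; exact: form2_smooth.
rewrite !E// !tangentD !tangentN /= => HP HO.
by rewrite -[RHS](subr0 0) -{1}HO -HP; ring.
Qed.

End Difference.

Theorem proposition7p2 (R : realType) (n r : nat) (M : manifold R n)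
    (A : lie_algebroid M r) (B : prolongation_bracket A) (Omega : form2 A) :
  symplectic B Omega -> vanishes_on_vertical Omega ->
  exists (Theta dzeta : form2 A) (zeta : form1 A),
    is_differential B zeta dzeta /\
    (forall (a : total_space A) (z w : prolong a),
       Omega a z w = (Theta a z w + dzeta a z w)%R) /\
    horizontal1 zeta /\
    horizontal2 Theta /\
    closed2 B Theta /\
    has_rank dzeta (2 * r)%N.
Proof.
move=> [Oclosed Ond] Overt; have [dz dzP] := exists_differential B (zeta Overt).
have dzO a (v w : prolong (A := A) a) : vertical v -> dz a v w = Omega a v w.
  by move=> vv; exact: (dzeta_vertical Oclosed w dzP vv).
exists (form2B Omega dz), dz, (zeta Overt); split=> //; split.
  by move=> a z w /=; rewrite subrK.
split; first exact: zeta_horizontal.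
split; first by move=> Z [_ vZ] a w /=; rewrite dzO// subrr.
split; first exact: form2B_closed Oclosed (differential_closed dzP).
by apply: has_rank_of_kernel => a z; exact: (dz_kernel Overt Ond dzO).
Qed.
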